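(* Let $k$ be algebraically closed, let $\mathcal H=(\mathcal P,\le,\{\Delta_i\}_{i\in\mathcal P})$ be an admissible homological system for a finite-dimensional $k$-algebra $\Lambda$, let $A$ be the Yoneda algebra of $\Delta=\bigoplus_i\Delta_i$ with a fixed strict $A_\infty$-structure, $B$ its bar construction, $\mathcal A=\mathcal A(\Delta)=(T,\delta)$ the corresponding weak ditalgebra and $I$ the corresponding ideal of $A(\Delta)$. Then there is an equivalence of categories $$H^{-1}(\operatorname{tw}(B))\simeq(\mathcal A,I)\text{-Mod}.$$ Since $\operatorname{tw}(B)(\underline X,\underline Y)_n=0$ for $n<-1$, the category $H^{-1}(\operatorname{tw}(B))$ coincides with the category $Z_{-1}(\operatorname{tw}(B))$, whose objects are those of $\operatorname{tw}(B)$, whose morphisms $t:\underline X\to\underline Y$ are the elements $t\in\operatorname{ad}(B)(X,Y)_{-1}$ with $$b_1^{tw}(t)=\sum_{i_0,i_1\ge0}b^{ad}_{i_0+i_1+1}(\delta_Y^{\otimes i_1}\otimes t\otimes\delta_X^{\otimes i_0})=0,$$ and where the composition of $t_1:\underline X_0\to\underline X_1$ and $t_2:\underline X_1\to\underline X_2$ is $$t_2t_1=b_2^{tw}(t_2\otimes t_1)=\sum_{i_0,i_1,i_2\ge0}b^{ad}_{i_0+i_1+i_2+2}(\delta_{X_2}^{\otimes i_2}\otimes t_2\otimes\delta_{X_1}^{\otimes i_1}\otimes t_1\otimes\delta_{X_0}^{\otimes i_0}).$$ An equivalence functor $M:Z_{-1}(\operatorname{tw}(B))\to(\mathcal A,I)\text{-Mod}$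 is given as follows: for an object $\underline X=(X,\delta_X)$, $M(\underline X)$ is the $A(\Delta)$-module $(X^{op},\Psi(\delta_X))$; for a morphism $t:\underline X\to\underline Y$, $M(t)=(M(t)^0,M(t)^1):M(\underline X)\to M(\underline Y)$ with $$M(t)^0=\Psi(t)\Big(\sum_{j\in\mathcal P}e_j^*\Big)\quad\text{and}\quad M(t)^1(\xi)=\Psi(t)(\xi)\ \text{ for }\xi\in\hat D(J).$$
   Context: $k$ acts centrally on all algebras and bimodules; $\otimes=\otimes_S$ unless indicated; Koszul sign rule $(f\otimes g)(a\otimes b)=(-1)^{|g||a|}f(a)\otimes g(b)$. Homological systems. A preordered set $(\mathcal P,\le)$ is a non-empty set with a reflexive transitive relation; $i\sim j$ means $i\le j$ and $j\le i$. A (finite) homological system for $\Lambda$ consists of a finite preordered set $(\mathcal P,\le)$ and pairwise non-isomorphic indecomposable finite-dimensional $\Lambda$-modules $\Delta_i$, $i\in\mathcal P$, with: $\operatorname{Hom}_\Lambda(\Delta_i,\Delta_j)\ne0$ implies $i\le j$; $\operatorname{Ext}^1_\Lambda(\Delta_i,\Delta_j)\ne0$ implies $i\le j$ and $i\not\sim j$. It is admissible if $\Lambda$ has a finite filtration with quotients isomorphic to modules in $\{\Delta_i\}$ and the number of isoclasses of indecomposable projective $\Lambda$-modules equals $|\mathcal P|$. Yoneda algebra. $e_i\in\operatorname{End}_\Lambda(\Delta)$ is the idempotent projecting onto $\Delta_i$; $\operatorname{End}_\Lambda(\Delta)=S\oplus J$, $S=\bigoplus_ike_i$, $J$ the radical.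 $A=\bigoplus_{n\ge0}\operatorname{Ext}^n_\Lambda(\Delta,\Delta)$. A strict $A_\infty$-structure on $A$ is a sequence of homogeneous $S$-$S$-bimodule morphisms $m_n:A^{\otimes n}\to A$ ($n\ge1$) of degree $2-n$ with $\sum_{r+s+t=n,\,s\ge1,\,r,t\ge0}(-1)^{r+st}m_{r+1+t}(id^{\otimes r}\otimes m_s\otimes id^{\otimes t})=0$ for all $n$, with $m_1=0$, $m_2$ induced by the product, and $m_n(z_1\otimes\cdots\otimes z_n)=0$ for $n\ge3$ whenever some $z_u\in\{e_j\}$. Bar construction and dual. $B=A[1]$ ($B_n=A_{n+1}$), $\sigma:A\to B$ the identity, of degree $-1$, $b_n:B^{\otimes n}\to B$ (degree $1$) defined by $b_n\sigma^{\otimes n}=\sigma m_n$. So $B_{-1}=S\oplus J$, $B_0=\operatorname{Ext}^1_\Lambda(\Delta,\Delta)$, $B_n=0$ for $n<-1$. For a graded $S$-$S$-bimodule $M$ with finite-dimensional components vanishing in sufficiently negative degrees, $\hat D(M)=\bigoplus_n\hat D(M)_n$, $\hat D(M)_n=\hat D(M_{-n})=\operatorname{Hom}_S({}_SM_{-n},{}_SS)$, with actions $(s*\alpha*s')(m)=\alpha(ms')s$. $\hat\theta_n:\hat D(B)^{\otimes n}\to\hat D(B^{\otimes n})$ is the isomorphism $\hat\theta_n(\alpha_1\otimes\cdots\otimes\alpha_n)(a_1\otimes\cdots\otimes a_n)=\alpha_1(a_1\alpha_2(a_2\cdots\alpha_n(a_n)\cdots))$, $\hat\tau_n$ its inverse,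 $\hat d(b_n)(\alpha)=\hat\tau_n(\alpha\circ b_n)$. $\hat D(B)_1=\bigoplus_ike_i^*\oplus\hat D(J)$, where $e_i^*(e_j)=\delta_{ij}e_j$, $e_i^*(J)=0$, and $\hat D(J)$ is the set of functionals vanishing on $S$. The pair $(\mathcal A(\Delta),I)$. Let $\widehat T_S(\hat D(B))=\prod_{n\ge0}\hat D(B)^{\otimes n}$, $d(\alpha)=\sum_{n\ge1}\hat d(b_n)(\alpha)$ for $\alpha\in\hat D(B)$, and $\pi:\widehat T_S(\hat D(B))\to\widehat T_S(\hat D(B)_0\oplus\hat D(J))$ the projection killing (componentwise) all tensors of homogeneous elements having a factor of negative degree, and all tensors of elements of $\hat D(B)_0\cup\hat D(B)_1$ having a factor $e_s^*$. $T=T_S(\hat D(B)_0\oplus\hat D(J))$, graded with $\hat D(B)_0$ in degree $0$ and $\hat D(J)$ in degree $1$; $\delta:T\to T$ is the degree-$1$ map with $\delta(S)=0$, $\delta(ab)=\delta(a)b+(-1)^{|a|}a\delta(b)$, $\delta(x)=\pi d(x)$ for $x\in\hat D(B)_0\oplus\hat D(J)$. $A(\Delta)=T_0=T_S(\hat D(B)_0)$, $V=T_1=A(\Delta)\otimes\hat D(J)\otimes A(\Delta)$. $I$ is the ideal of $A(\Delta)$ generated by the image of $\beta:\hat D(B_1)\to A(\Delta)$, $\beta(x)=\sum_{n\ge2}\hat\tau(x\circ b_n|_{B_0^{\otimes n}})$ (finite sum), $\hat\tau:\hat D(B_0^{\otimes n})\to\hat D(B_0)^{\otimes n}$ being the inverse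 of the map given by the formula of $\hat\theta_n$. The category $(\mathcal A,I)\text{-Mod}$. Objects: left $A(\Delta)$-modules $M$ with $IM=0$ (an $A(\Delta)$-module is the same as a pair $(M,\rho_M)$ with $M$ a left $S$-module and $\rho_M:\hat D(B_0)\to\operatorname{Hom}_k(M,M)$ an $S$-$S$-bimodule morphism). Morphisms $M\to N$: pairs $(f^0,f^1)$ with $f^0\in\operatorname{Hom}_k(M,N)$, $f^1\in\operatorname{Hom}_{A(\Delta)\text{-}A(\Delta)}(V,\operatorname{Hom}_k(M,N))$ (equivalently, $f^1$ is given by its restriction, an $S$-$S$-bimodule map on $\hat D(J)$), such that $af^0[m]=f^0[am]+f^1(\delta(a))[m]$ for $a\in A(\Delta)$, $m\in M$. Composition: $gf=(g^0f^0,(gf)^1)$, $(gf)^1(v)=g^0f^1(v)+g^1(v)f^0+\sum_jg^1(u_j)f^1(v_j)$ where $\delta(v)=\sum_ju_jv_j$, $u_j,v_j\in V$. $\operatorname{ad}(B)$ and $\operatorname{tw}(B)$. For right $S$-modules $X,Y$: $\operatorname{ad}(B)(X,Y)=\bigoplus_{i,j\in\mathcal P}\operatorname{Hom}_k(Xe_i,Ye_j)\otimes_ke_jBe_i$, graded by the degree of $B$; $b_n^{ad}((f_n\otimes a_n)\otimes_k\cdots\otimes_k(f_1\otimes a_1))=f_n\cdots f_1\otimes b_n(a_n\otimes\cdots\otimes a_1)$, where $\operatorname{Hom}_k(Xe_i,Ye_j)$ is viewed inside $\operatorname{Hom}_k(X,Y)=\bigoplus_{i,j}\operatorname{Hom}_k(Xe_i,Ye_j)$.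 Fix a basis $\mathbb B=\bigcup_t\mathbb B_t$ of $B$, $\mathbb B_t$ being a basis of $B_t$ which is a union of bases of the spaces $e_jB_te_i$, with $\mathbb B_{-1}=\{e_i\mid i\in\mathcal P\}\cup\mathbb J$, $\mathbb J\subseteq J$. Objects of $\operatorname{tw}(B)$: pairs $\underline X=(X,\delta_X)$, $X$ a right $S$-module, $\delta_X=\sum_{x\in\mathbb B}f_x\otimes x\in\operatorname{ad}(B)(X,X)_0$, such that (1) there is a finite filtration $0=X_0\subseteq X_1\subseteq\cdots\subseteq X_\ell=X$ by right $S$-submodules with $f_x(X_r)\subseteq X_{r-1}$ for all $x$ and $r\in\{1,\dots,\ell\}$, and (2) $\sum_{s\ge1}b_s^{ad}(\delta_X^{\otimes s})=0$ (a finite sum). $\operatorname{tw}(B)(\underline X,\underline Y)=\operatorname{ad}(B)(X,Y)$ and $b_n^{tw}(t_n\otimes\cdots\otimes t_1)=\sum_{i_0,\dots,i_n\ge0}b^{ad}_{i_0+\cdots+i_n+n}(\delta_{X_n}^{\otimes i_n}\otimes t_n\otimes\cdots\otimes\delta_{X_1}^{\otimes i_1}\otimes t_1\otimes\delta_{X_0}^{\otimes i_0})$. $H^{-1}(\operatorname{tw}(B))$ is the category with the same objects, morphism spaces the degree $-1$ cohomology of the complexes $(\operatorname{tw}(B)(\underline X,\underline Y),b_1^{tw})$, and composition $\overline{t_2}\,\overline{t_1}=\overline{b_2^{tw}(t_2\otimes t_1)}$; $Z_{-1}$ denotes the degree $-1$ cocycles. The map $\Psi$. $X^{op}$ is $X$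 viewed as a left $S$-module ($S$ is commutative). For right $S$-modules $X,Y$ and $n\in\mathbb Z$, $\Psi:\operatorname{ad}(B)(X,Y)_n\to\operatorname{Hom}_{S\text{-}S}(\hat D(B_n),\operatorname{Hom}_k(X^{op},Y^{op}))$ is given by $\Psi(\sum_{x\in\mathbb B_n}f_x\otimes x)(\zeta)=\sum_xf_x\zeta(x)$, where $(fs)(m)=f(m)s$ for $f\in\operatorname{Hom}_k(X,Y)$, $s\in S$. *)

(* Defs.v *)
From HB Require Import structures.
From mathcomp Require Import all_boot all_order all_algebra all_field.
From mathcomp Require Import boolp classical_sets functions cardinality fsbigop.

Set Implicit Arguments.
Unset Strict Implicit.
Unset Printing Implicit Defensive.

Import Order.TTheory GRing.Theory Num.Theory.

Local Open Scope classical_set_scope.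
Local Open Scope ring_scope.

(* Categories. A hom-set is the subquotient {f : hom X Y | mor f} / heq. *)

Record precat := Precat {
  ob :> Type;
  hom : ob -> ob -> Type;
  mor : forall X Y, hom X Y -> Prop;
  heq : forall X Y, hom X Y -> hom X Y -> Prop;
  idm : forall X, hom X X;
  comp : forall X Y Z, hom Y Z -> hom X Y -> hom X Z }.

Arguments mor {p X Y} _.
Arguments heq {p X Y} _ _.
Arguments idm {p} X.
Arguments comp {p X Y Z} _ _.

Record is_category (C : precat) : Prop := IsCategory {
  heq_refl : forall (X Y : C) (f : hom X Y), mor f -> heq f f;
  heq_sym : forall (X Y : C) (f g : hom X Y),
    mor f -> mor g -> heq f g -> heq g f;
  heq_trans : forall (X Y : C) (f g h : hom X Y),
    mor f -> mor g -> mor h -> heq f g -> heq g h -> heq f h;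
  mor_id : forall X : C, mor (idm X);
  mor_comp : forall (X Y Z : C) (g : hom Y Z) (f : hom X Y),
    mor g -> mor f -> mor (comp g f);
  heq_comp : forall (X Y Z : C) (g g' : hom Y Z) (f f' : hom X Y),
    mor g -> mor g' -> mor f -> mor f' ->
    heq g g' -> heq f f' -> heq (comp g f) (comp g' f');
  comp_id_l : forall (X Y : C) (f : hom X Y),
    mor f -> heq (comp (idm Y) f) f;
  comp_id_r : forall (X Y : C) (f : hom X Y),
    mor f -> heq (comp f (idm X)) f;
  comp_assoc : forall (X Y Z T : C) (h : hom Z T) (g : hom Y Z) (f : hom X Y),
    mor h -> mor g -> mor f ->
    heq (comp h (comp g f)) (comp (comp h g) f) }.

Record prefunctor (C D : precat) := Prefunctor {
  fob :> C -> D;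
  fmap : forall X Y : C, hom X Y -> hom (fob X) (fob Y) }.

Arguments fmap {C D} p {X Y} _.

Record is_functor (C D : precat) (F : prefunctor C D) : Prop := IsFunctor {
  fmap_mor : forall (X Y : C) (f : hom X Y), mor f -> mor (fmap F f);
  fmap_heq : forall (X Y : C) (f g : hom X Y),
    mor f -> mor g -> heq f g -> heq (fmap F f) (fmap F g);
  fmap_id : forall X : C, heq (fmap F (idm X)) (idm (F X));
  fmap_comp : forall (X Y Z : C) (g : hom Y Z) (f : hom X Y),
    mor g -> mor f ->
    heq (fmap F (comp g f)) (comp (fmap F g) (fmap F f)) }.

Definition id_functor (C : precat) : prefunctor C C :=
  Prefunctor (fun X Y (f : hom X Y) => f).

Definition comp_functor (C D E : precat) (G : prefunctor D E)
    (F : prefunctor C D) : prefunctor C E :=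
  Prefunctor (fun X Y (f : hom X Y) => fmap G (fmap F f)).

Definition natural_iso (C D : precat) (F G : prefunctor C D) : Prop :=
  exists (eta : forall X : C, hom (F X) (G X))
         (eta' : forall X : C, hom (G X) (F X)),
  [/\ forall X, mor (eta X) /\ mor (eta' X),
      forall X, heq (comp (eta' X) (eta X)) (idm (F X)),
      forall X, heq (comp (eta X) (eta' X)) (idm (G X))
    & forall (X Y : C) (f : hom X Y), mor f ->
        heq (comp (eta Y) (fmap F f)) (comp (fmap G f) (eta X))].

Definition is_equivalence (C D : precat) (F : prefunctor C D) : Prop :=
  exists G : prefunctor D C,
  [/\ is_functor G, natural_iso (comp_functor G F) (id_functor C)
    & natural_iso (comp_functor F G) (id_functor D)].

Definition equivalent (C D : precat) : Prop :=
  exists F : prefunctor C D, is_functor F /\ is_equivalence F.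

(* Modules over a finite-dimensional algebra L, and Ext. The ground field k
   acts on an L-module through c%:A. *)

Section Modules.
Context {k : fieldType} {L : falgType k}.

Definition finite_dim (M : lmodType L) : Prop :=
  exists (n : nat) (v : 'I_n -> M), forall x, exists c : 'I_n -> k,
    x = \sum_(i < n) ((c i)%:A : L) *: v i.

Definition submodule (M : lmodType L) (U : set M) : Prop :=
  U 0 /\ forall (a : L) x y, U x -> U y -> U (a *: x + y).

Definition indecomposable (M : lmodType L) : Prop :=
  (exists x : M, x <> 0) /\
  forall U1 U2 : set M, submodule U1 -> submodule U2 ->
    (forall x, U1 x -> U2 x -> x = 0) ->
    (forall x, exists x1 x2, [/\ U1 x1, U2 x2 & x = x1 + x2]) ->
    (forall x, U1 x -> x = 0) \/ (forall x, U2 x -> x = 0).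

Definition isomorphic (M N : lmodType L) : Prop :=
  exists f : {linear M -> N}, bijective f.

Definition projective (Q : lmodType L) : Prop :=
  forall (M N : lmodType L) (g : {linear M -> N}) (f : {linear Q -> N}),
    (forall y, exists x, g x = y) ->
    exists h : {linear Q -> M}, forall x, g (h x) = f x.

Record projective_resolution (M : lmodType L) := ProjectiveResolution {
  pr_ob : nat -> lmodType L;
  pr_d : forall n, {linear pr_ob n.+1 -> pr_ob n};
  pr_eps : {linear pr_ob 0 -> M};
  pr_projective : forall n, projective (pr_ob n);
  pr_eps_surj : forall y, exists x, pr_eps x = y;
  pr_exact0 : forall x, pr_eps x = 0 <-> exists y, x = pr_d 0 y;
  pr_exact : forall n x, pr_d n x = 0 <-> exists y, x = pr_d n.+1 y }.

Definition cocycle (M N : lmodType L) (R : projective_resolution M) (n : nat)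
    (f : {linear pr_ob R n -> N}) : Prop :=
  forall x, f (pr_d R n x) = 0.

Definition coboundary (M N : lmodType L) (R : projective_resolution M)
    (n : nat) : {linear pr_ob R n -> N} -> Prop :=
  match n with
  | 0 => fun f => forall x, f x = 0
  | n'.+1 => fun f => exists g : {linear pr_ob R n' -> N},
      forall x, f x = g (pr_d R n' x)
  end.

Definition hom_nonzero (M N : lmodType L) : Prop :=
  exists (f : {linear M -> N}) (x : M), f x <> 0.

Definition ext_nonzero (n : nat) (M N : lmodType L) : Prop :=
  exists (R : projective_resolution M) (f : {linear pr_ob R n -> N}),
    cocycle f /\ ~ coboundary f.

End Modules.

Section HomologicalSystems.
Context {k : fieldType} {L : falgType k}.
Context {disp : Order.disp_t} {P : finPreorderType disp}.
Implicit Types (D : P -> lmodType L).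

Record homological_system D : Prop := HomologicalSystem {
  hs_nonempty : exists i : P, True;
  hs_findim : forall i, finite_dim (D i);
  hs_indec : forall i, indecomposable (D i);
  hs_noniso : forall i j, i <> j -> ~ isomorphic (D i) (D j);
  hs_hom : forall i j, hom_nonzero (D i) (D j) -> (i <= j)%O;
  hs_ext : forall i j, ext_nonzero 1 (D i) (D j) ->
    (i <= j)%O /\ ~ ((i <= j)%O /\ (j <= i)%O) }.

Definition filtered_by D : Prop :=
  exists (l : nat) (F : nat -> set L^o),
  [/\ forall r, submodule (F r),
      F 0%N = [set 0], F l = setT,
      forall r, (r < l)%N -> F r `<=` F r.+1
    & forall r, (r < l)%N -> exists (i : P) (phi : L^o -> D i),
      [/\ forall (a : L) x y, F r.+1 x -> F r.+1 y ->
            phi (a *: x + y) = a *: phi x + phi y,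
          forall y, exists2 x, F r.+1 x & phi x = y
        & forall x, F r.+1 x -> (phi x = 0 <-> F r x)]].

Definition indec_projectives_counted : Prop :=
  exists Q : P -> lmodType L,
  [/\ forall i, projective (Q i) /\ indecomposable (Q i),
      forall i j, i <> j -> ~ isomorphic (Q i) (Q j)
    & forall M : lmodType L, projective M -> indecomposable M ->
        exists i, isomorphic M (Q i)].

Definition admissible D : Prop :=
  filtered_by D /\ indec_projectives_counted.

Record direct_sum D := DirectSum {
  ds_car :> lmodType L;
  ds_in : forall i, {linear D i -> ds_car};
  ds_pr : forall i, {linear ds_car -> D i};
  ds_pr_in : forall i x, ds_pr i (ds_in i x) = x;
  ds_pr_in0 : forall i j x, i <> j -> ds_pr i (ds_in j x) = 0;
  ds_sum : forall x, x = \sum_i ds_in i (ds_pr i x) }.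

(* The Yoneda algebra: the homogeneous component of degree n is the
   quotient of n-cocycles by n-coboundaries, yo_cls being the quotient map;
   the product of the classes of g and f is the class of g o F, for F a chain
   map lifting f. *)
Record yoneda_algebra D (DD : direct_sum D) (R : projective_resolution DD) :=
  YonedaAlgebra {
  yo_alg :> algType k;
  yo_cls : forall n, {linear pr_ob R n -> DD} -> yo_alg;
  yo_lin : forall n (c : k) (f g h : {linear pr_ob R n -> DD}),
    cocycle f -> cocycle g -> (forall x, h x = (c%:A : L) *: f x + g x) ->
    yo_cls h = c *: yo_cls f + yo_cls g;
  yo_ker : forall n (f : {linear pr_ob R n -> DD}), cocycle f ->
    (yo_cls f = 0 <-> coboundary f);
  yo_mul : forall n m (f : {linear pr_ob R n -> DD})
      (g : {linear pr_ob R m -> DD})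
      (F : forall r, {linear pr_ob R (r + n) -> pr_ob R r})
      (h : {linear pr_ob R (m + n) -> DD}),
    cocycle f -> cocycle g ->
    (forall x, pr_eps R (F 0%N x) = f x) ->
    (forall r x, F r (pr_d R (r + n) x) = pr_d R r (F r.+1 x)) ->
    (forall x, h x = g (F m x)) ->
    yo_cls g * yo_cls f = yo_cls h;
  yo_one : yo_cls (pr_eps R) = 1;
  yo_span : forall a : yo_alg, exists N (f : forall n, {linear pr_ob R n -> DD}),
    (forall n, cocycle (f n)) /\ a = \sum_(n < N) yo_cls (f n);
  yo_direct : forall N (f : forall n, {linear pr_ob R n -> DD}),
    (forall n, cocycle (f n)) -> \sum_(n < N) yo_cls (f n) = 0 ->
    forall n, (n < N)%N -> yo_cls (f n) = 0 }.

End HomologicalSystems.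

(* An algebra with a family of subspaces indexed by degrees in Z and a
   family of elements indexed by P (the idempotents e_i). *)
Record graded_algebra (k : fieldType) (P : finType) := GradedAlgebra {
  ga_alg :> algType k;
  ga_deg : int -> set ga_alg;
  ga_e : P -> ga_alg }.

Definition yoneda_graded (k : fieldType) (L : falgType k) disp
    (P : finPreorderType disp) (D : P -> lmodType L) (DD : direct_sum D)
    (R : projective_resolution DD) (Y : yoneda_algebra R) :
    graded_algebra k P :=
  GradedAlgebra
    (fun z : int => match z with
     | Posz n => [set a : Y | exists2 f : {linear pr_ob R n -> DD},
                    cocycle f & a = yo_cls Y f]
     | Negz _ => [set 0]
     end)
    (fun i => yo_cls Y (ds_in DD i \o (ds_pr DD i \o pr_eps R))).

(* A right S-module, S being the product of the k e_i: a k-space with a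
   complete system of orthogonal idempotents, sm_e i being the action of e_i.
   Since S is commutative, the same record describes left S-modules and
   X^op = X. *)
Record smodule (k : fieldType) (P : finType) := SModule {
  sm_car :> lmodType k;
  sm_e : P -> {linear sm_car -> sm_car};
  sm_orth : forall i j x, sm_e i (sm_e j x) = if i == j then sm_e i x else 0;
  sm_sum : forall x, x = \sum_i sm_e i x }.

(* A tensor algebra, over S, of a sub-S-S-bimodule W of U, with e_i acting on
   the left by l i and on the right by r i. *)
Record tensor_algebra (k : fieldType) (P : finType) (U : lmodType k)
    (W : set U) (l r : P -> U -> U) := TensorAlgebra {
  ta_alg :> algType k;
  ta_e : P -> ta_alg;
  ta_in : U -> ta_alg;
  ta_compat :
    [/\ forall i j, ta_e i * ta_e j = if i == j then ta_e i else 0,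
        \sum_i ta_e i = 1,
        forall (c : k) x y, W x -> W y ->
          ta_in (c *: x + y) = c *: ta_in x + ta_in y
      & forall i x, W x ->
          ta_in (l i x) = ta_e i * ta_in x /\ ta_in (r i x) = ta_in x * ta_e i];
  ta_universal : forall (Q : algType k) (q_e : P -> Q) (q_in : U -> Q),
    [/\ forall i j, q_e i * q_e j = if i == j then q_e i else 0,
        \sum_i q_e i = 1,
        forall (c : k) x y, W x -> W y ->
          q_in (c *: x + y) = c *: q_in x + q_in y
      & forall i x, W x ->
          q_in (l i x) = q_e i * q_in x /\ q_in (r i x) = q_in x * q_e i] ->
    exists phi : {lrmorphism ta_alg -> Q},
      [/\ forall i, phi (ta_e i) = q_e i,
          forall x, W x -> phi (ta_in x) = q_in x
        & forall psi : {lrmorphism ta_alg -> Q},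
            (forall i, psi (ta_e i) = q_e i) ->
            (forall x, W x -> psi (ta_in x) = q_in x) -> psi =1 phi] }.

Section Bar.
Context {k : fieldType} {P : finType} {A : graded_algebra k P}.
Local Notation e := (@ga_e _ _ A).

(* m s stands for m_n(s_1 (x) ... (x) s_n), n = size s > 0; the value at the
   empty sequence is irrelevant. *)
Definition multilinear (m : seq A -> A) : Prop :=
  forall (u v : seq A) (c : k) x y,
    m (u ++ (c *: x + y) :: v) = c *: m (u ++ x :: v) + m (u ++ y :: v).

Definition bimodule_morphisms (m : seq A -> A) : Prop :=
  [/\ multilinear m,
      forall u v i x y, m (u ++ x * e i :: y :: v) = m (u ++ x :: e i * y :: v),
      forall v i x, m (e i * x :: v) = e i * m (x :: v)
    & forall u i x, m (rcons u (x * e i)) = m (rcons u x) * e i].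

Definition homogeneous_word (w : seq (int * A)) : Prop :=
  forall p, p \in w -> ga_deg p.1 p.2.

(* The Koszul sign of id^r (x) m_s (x) id^t on homogeneous arguments is
   (-1)^((2 - s)(|a_1| + ... + |a_r|)). *)
Definition stasheff (m : seq A -> A) : Prop :=
  forall w : seq (int * A), (0 < size w)%N -> homogeneous_word w ->
  let n := size w in
  let a := map snd w in
  \sum_(r < n.+1) \sum_(s < n.+1 | (0 < s)%N && (r + s <= n)%N)
     ((-1 : k) ^ ((r + s * (n - r - s))%N%:Z
                  + (2 - s%:Z) * \sum_(p <- take r w) p.1)) *:
       m (take r a ++ m (take s (drop r a)) :: drop (r + s)%N a) = 0.

Record strict_Ainfinity (m : seq A -> A) : Prop := StrictAinfinity {
  ai_morph : bimodule_morphisms m;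
  ai_deg : forall w, (0 < size w)%N -> homogeneous_word w ->
    ga_deg (\sum_(p <- w) p.1 + 2 - (size w)%:Z) (m (map snd w));
  ai_stasheff : stasheff m;
  ai_m1 : forall x, m [:: x] = 0;
  ai_m2 : forall x y, m [:: x; y] = x * y;
  ai_unit : forall s, (3 <= size s)%N -> (exists j, e j \in s) -> m s = 0 }.

(* B = A[1] has underlying space A and sigma is the identity of A. As sigma
   has degree -1, sigma^{(x) n}(a_1 (x) ... (x) a_n) carries the Koszul sign
   (-1)^((n - 1)|a_1| + (n - 2)|a_2| + ... + |a_{n-1}|). *)
Definition is_bar (m b : seq A -> A) : Prop :=
  multilinear b /\
  forall w : seq (int * A), (0 < size w)%N -> homogeneous_word w ->
    ((-1 : k) ^ (\sum_(u < size w)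
        ((size w).-1 - u)%N%:Z * (nth (0, 0) w u).1)) *: b (map snd w)
    = m (map snd w).

Definition bdeg (t : int) : set A := ga_deg (t + 1).

(* The radical J of the algebra A_0 = End(Delta). *)
Definition radical : set A :=
  [set a | ga_deg 0 a /\
     forall x, ga_deg 0 x -> exists2 y, ga_deg 0 y & y * (1 - x * a) = 1].

Definition in_S (a : A) : Prop := exists c : P -> k, a = \sum_i c i *: e i.

(* Elements of the dual of B are functionals B -> S, seen as maps A -> A with
   values in S. *)
Definition dual_deg (n : int) : set (A -> A) :=
  [set al | [/\ linear al,
                forall i a, al (e i * a) = e i * al a,
                forall a, in_S (al a)
              & forall t a, t <> - n -> bdeg t a -> al a = 0]].

Definition dual_J : set (A -> A) :=
  [set al | dual_deg 1 al /\ forall i, al (e i) = 0].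

Definition is_estar (i : P) : set (A -> A) :=
  [set al | [/\ dual_deg 1 al,
                forall j, al (e j) = if i == j then e j else 0
              & forall a, radical a -> al a = 0]].

Definition gen_space : set (A -> A) :=
  [set al | exists al0 al1, [/\ dual_deg 0 al0, dual_J al1
                              & al = (fun a => al0 a + al1 a)]].

Definition dual_l (i : P) (al : A -> A) : A -> A := fun a => al a * e i.
Definition dual_r (i : P) (al : A -> A) : A -> A := fun a => al (a * e i).

Fixpoint theta (al : seq (A -> A)) (a : seq A) : A :=
  match al, a with
  | f :: al', x :: a' => f (x * theta al' a')
  | _, _ => 1
  end.

(* A tensor of length n is given as a finite sum, ws, of pure tensors, with
   factors taken in C. The relation says that theta_n maps it to phi, as a
   functional on tensors of length n of elements of E; that is, it is
   tau_n(phi). *)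
Definition tau (C : set (A -> A)) (E : set A) (n : nat) (phi : seq A -> A)
    (ws : seq (seq (A -> A))) : Prop :=
  (forall w, w \in ws -> size w = n /\ forall al, al \in w -> C al) /\
  (forall a : seq A, size a = n -> (forall x, x \in a -> E x) ->
     \sum_(w <- ws) theta w a = phi a).

Definition killed : set (A -> A) :=
  [set al | (exists2 n : int, n < 0 & dual_deg n al) \/ exists i, is_estar i al].

Definition kept : set (A -> A) :=
  [set al | dual_deg 0 al \/ dual_J al].

(* A basis of B, homogeneous and adapted to the idempotents, with its
   coordinate functionals: idx t indexes the basis of B_t. *)
Record bar_basis := BarBasis {
  idx : int -> finType;
  bvec : forall t, idx t -> A;
  bcoord : forall t, idx t -> A -> k;
  bsrc : forall t, idx t -> P;
  btgt : forall t, idx t -> P;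
  be : P -> idx (-1);
  bvec_deg : forall t (x : idx t), bdeg t (bvec x);
  bvec_l : forall t (x : idx t), e (btgt x) * bvec x = bvec x;
  bvec_r : forall t (x : idx t), bvec x * e (bsrc x) = bvec x;
  bcoord_lin : forall t (x : idx t) (c : k) u v,
    bcoord x (c *: u + v) = c * bcoord x u + bcoord x v;
  bcoord_vec : forall t (x y : idx t), bcoord x (bvec y) = (x == y)%:R;
  bcoord_deg : forall t t' (x : idx t) a,
    t <> t' -> bdeg t' a -> bcoord x a = 0;
  bvec_span : forall t a, bdeg t a -> a = \sum_(x : idx t) bcoord x a *: bvec x;
  bvec_e : forall i, bvec (be i) = e i;
  bvec_J : forall x : idx (-1), (forall i, x <> be i) -> radical (bvec x) }.

End Bar.

Arguments bar_basis {k P} A.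

Section Ditalgebra.
Context {k : fieldType} {P : finType} {A : graded_algebra k P}.
Context (b : seq A -> A).
Context (T : tensor_algebra (@gen_space _ _ A) (@dual_l _ _ A) (@dual_r _ _ A)).

Inductive tdeg : nat -> T -> Prop :=
| tdeg_e i : tdeg 0 (ta_e T i)
| tdeg_0 al : dual_deg 0 al -> tdeg 0 (ta_in T al)
| tdeg_1 al : dual_J al -> tdeg 1 (ta_in T al)
| tdeg_mul n m x y : tdeg n x -> tdeg m y -> tdeg (n + m) (x * y)
| tdeg_zero n : tdeg n 0
| tdeg_lin n (c : k) x y : tdeg n x -> tdeg n y -> tdeg n (c *: x + y).

Lemma tdeg_one : tdeg 0 1.
Proof.
have [_ <- _ _] := ta_compat T.
elim/big_rec: _ => [|i x _ hx]; first exact: tdeg_zero.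
by rewrite -[ta_e T i]scale1r; apply: tdeg_lin => //; apply: tdeg_e.
Qed.

Definition tpart (n : nat) : {pred T} := fun x => `[< tdeg n x >].

Lemma tpartP n x : reflect (tdeg n x) (x \in tpart n).
Proof. exact: asboolP. Qed.

Lemma tpart_submod n : submod_closed (tpart n).
Proof.
split=> [|c x y /tpartP hx /tpartP hy]; apply/tpartP.
  exact: tdeg_zero.
exact: tdeg_lin.
Qed.

HB.instance Definition _ n :=
  GRing.isSubmodClosed.Build k T (tpart n) (tpart_submod n).

Lemma tpart0_mul : GRing.mulr_closed (tpart 0).
Proof.
split=> [|x y /tpartP hx /tpartP hy]; apply/tpartP; first exact: tdeg_one.
exact: (tdeg_mul hx hy).
Qed.

(* The algebra A(Delta) = T_0 and the A(Delta)-bimodule V = T_1. *)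

Definition tpart0 : {pred T} := tpart 0.
HB.instance Definition _ := GRing.SubmodClosed.on tpart0.
HB.instance Definition _ := GRing.isMulClosed.Build T tpart0 tpart0_mul.

Definition Adelta : Type := {x : T | x \in tpart0}.
HB.instance Definition _ := SubChoice.on Adelta.
HB.instance Definition _ := [SubChoice_isSubAlgebra of Adelta by <:].

Definition Vdelta : Type := {x : T | x \in tpart 1}.
HB.instance Definition _ := SubChoice.on Vdelta.
HB.instance Definition _ := [SubChoice_isSubLmodule of Vdelta by <:].

Lemma V_l_subproof (a : Adelta) (v : Vdelta) : val a * val v \in tpart 1.
Proof.
by apply/tpartP/(@tdeg_mul 0 1); apply/tpartP; [exact: (valP a) | exact: (valP v)].
Qed.

Lemma V_r_subproof (v : Vdelta) (a : Adelta) : val v * val a \in tpart 1.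
Proof.
by apply/tpartP/(@tdeg_mul 1 0); apply/tpartP; [exact: (valP v) | exact: (valP a)].
Qed.

Lemma V_gen_subproof (xi : A -> A) : dual_J xi -> ta_in T xi \in tpart 1.
Proof. by move=> h; apply/tpartP; exact: tdeg_1. Qed.

Lemma A_e_subproof (i : P) : ta_e T i \in tpart0.
Proof. by apply/tpartP; exact: tdeg_e. Qed.

Lemma A_gen_subproof (zeta : A -> A) : dual_deg 0 zeta -> ta_in T zeta \in tpart0.
Proof. by move=> h; apply/tpartP; exact: tdeg_0. Qed.

Definition V_l (a : Adelta) (v : Vdelta) : Vdelta :=
  exist _ (val a * val v) (V_l_subproof a v).

Definition V_r (v : Vdelta) (a : Adelta) : Vdelta :=
  exist _ (val v * val a) (V_r_subproof v a).

Definition A_e (i : P) : Adelta := exist _ (ta_e T i) (A_e_subproof i).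

Definition A_gen (zeta : A -> A) (h : dual_deg 0 zeta) : Adelta :=
  exist _ (ta_in T zeta) (A_gen_subproof h).

Definition V_gen (xi : A -> A) (h : dual_J xi) : Vdelta :=
  exist _ (ta_in T xi) (V_gen_subproof h).

Definition tword (w : seq (A -> A)) : T := \prod_(al <- w) ta_in T al.

(* The projection pi, on a sum of pure tensors whose factors are all in
   killed or kept. *)
Definition pi_word (ws : seq (seq (A -> A))) : T :=
  \sum_(w <- ws | all (fun al => `[< kept al >]) w) tword w.

(* y = pi (d al) *)
Definition pi_d (al : A -> A) (y : T) : Prop :=
  exists (ws : nat -> seq (seq (A -> A))) (N : nat),
  [/\ forall n, (0 < n)%N ->
        tau (killed `|` kept) setT n (fun a => al (b a)) (ws n),
      forall n, (N <= n)%N -> pi_word (ws n) = 0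
    & y = \sum_(1 <= n < N) pi_word (ws n)].

Record weak_ditalgebra := WeakDitalgebra {
  delta : T -> T;
  delta_lin : linear delta;
  delta_deg : forall n x, tdeg n x -> tdeg n.+1 (delta x);
  delta_e : forall i, delta (ta_e T i) = 0;
  delta_mul : forall n x y, tdeg n x ->
    delta (x * y) = delta x * y + (-1) ^+ n * (x * delta y);
  delta_gen : forall al, gen_space al -> pi_d al (delta (ta_in T al)) }.

(* y = beta x *)
Definition beta (x : A -> A) (y : T) : Prop :=
  exists (ws : nat -> seq (seq (A -> A))) (N : nat),
  [/\ forall n, (1 < n)%N ->
        tau (dual_deg 0) (bdeg 0) n (fun a => x (b a)) (ws n),
      forall n, (N <= n)%N -> \sum_(w <- ws n) tword w = 0
    & y = \sum_(2 <= n < N) \sum_(w <- ws n) tword w].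

Inductive idealI : Adelta -> Prop :=
| idealI_gen x (a : Adelta) : dual_deg (-1) x -> beta x (val a) -> idealI a
| idealI_0 : idealI 0
| idealI_add a a' : idealI a -> idealI a' -> idealI (a + a')
| idealI_mul c a c' : idealI a -> idealI (c * a * c').

Record module_over (Q : algType k) (M : lmodType k) := ModuleOver {
  act :> Q -> M -> M;
  act_lin_l : forall m, linear (fun a => act a m);
  act_lin_r : forall a, linear (act a);
  act_one : forall m, act 1 m = m;
  act_mul : forall a a' m, act (a * a') m = act a (act a' m) }.

Record annihilated_module (M : lmodType k) := AnnihilatedModule {
  am_act :> module_over Adelta M;
  am_I : forall a m, idealI a -> am_act a m = 0 }.

Record ai_module := AIModule {
  aim_car :> lmodType k;
  aim_act : annihilated_module aim_car }.

Context (W : weak_ditalgebra).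

Lemma delta_A_subproof (a : Adelta) : delta W (val a) \in tpart 1.
Proof. by apply/tpartP/delta_deg/tpartP; exact: (valP a). Qed.

Definition delta_A (a : Adelta) : Vdelta :=
  exist _ (delta W (val a)) (delta_A_subproof a).

Definition ai_hom (M N : ai_module) : Type :=
  ((M -> N) * (Vdelta -> M -> N))%type.

Definition ai_mor (M N : ai_module) (f : ai_hom M N) : Prop :=
  [/\ linear f.1,
      forall v, linear (f.2 v),
      forall m, linear (fun v => f.2 v m),
      forall a v a' m, f.2 (V_r (V_l a v) a') m
                       = aim_act N a (f.2 v (aim_act M a' m))
    & forall a m, aim_act N a (f.1 m)
                  = f.1 (aim_act M a m) + f.2 (delta_A a) m].

Definition decomposition (v : Vdelta) (s : seq (Vdelta * Vdelta)) : Prop :=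
  delta W (val v) = \sum_(p <- s) val p.1 * val p.2.

Definition ai_comp1 (M N Q : ai_module) (g : ai_hom N Q) (f : ai_hom M N)
    (v : Vdelta) (s : seq (Vdelta * Vdelta)) (m : M) : Q :=
  g.1 (f.2 v m) + g.2 v (f.1 m) + \sum_(p <- s) g.2 p.1 (f.2 p.2 m).

(* The decomposition of delta v into a sum of products u_j v_j is chosen
   arbitrarily; the value does not depend on it when f and g are morphisms. *)
Definition ai_comp (M N Q : ai_module) (g : ai_hom N Q) (f : ai_hom M N) :
    ai_hom M Q :=
  (fun m => g.1 (f.1 m),
   fun v => ai_comp1 g f v (xget [::] (decomposition v))).

Definition AI_Mod : precat := {|
  ob := ai_module;
  hom := ai_hom;
  mor := ai_mor;
  heq := fun _ _ f g => f = g;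
  idm := fun M => (fun m => m, fun _ _ => 0);
  comp := ai_comp |}.

End Ditalgebra.

Section Twisted.
Context {k : fieldType} {P : finType} {A : graded_algebra k P}.
Context (b : seq A -> A) (BB : bar_basis A).
Implicit Types X Y Z : smodule k P.

(* An element of degree t of ad(B)(X,Y) is written as the sum of the
   f x (x) x, for x in the basis of B_t; Hom_k(X e_i, Y e_j) is viewed inside
   Hom_k(X, Y). *)
Definition ad X Y (t : int) : Type := idx BB t -> X -> Y.

Definition in_ad X Y (t : int) (f : ad X Y t) : Prop :=
  forall x, linear (f x) /\
    forall m, f x m = sm_e Y (btgt x) (f x (sm_e X (bsrc x) m)).

(* Composable homogeneous tensors f_n (x) ... (x) f_1, f_n being the head. *)
Inductive adtensor X : smodule k P -> Type :=
| AdNil : adtensor X X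
| AdCons Y Z t (f : ad Y Z t) (c : adtensor X Y) : adtensor X Z.

Arguments AdNil {X}.
Arguments AdCons {X Y Z t} f c.

Fixpoint expand X Y (c : adtensor X Y) : seq ((X -> Y) * seq A) :=
  match c with
  | AdNil => [:: (id, [::])]
  | @AdCons _ _ _ t f c' =>
      [seq (fun m => f x (p.1 m), bvec x :: p.2)
         | x <- enum (idx BB t), p <- expand c']
  end.

(* The component of degree t of b^ad. *)
Definition b_ad X Y (c : adtensor X Y) (t : int) : ad X Y t :=
  fun y m => \sum_(p <- expand c) bcoord y (b p.2) *: p.1 m.

Arguments b_ad {X Y} c t y m.

Definition pow_l X Y (dlt : ad Y Y 0) (n : nat) (c : adtensor X Y) :
    adtensor X Y :=
  iter n (AdCons dlt) c.

Definition finite_filtration X (dlt : ad X X 0) : Prop :=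
  exists (l : nat) (F : nat -> set X),
  [/\ forall r, [/\ F r 0,
        forall (c : k) m m', F r m -> F r m' -> F r (c *: m + m')
      & forall i m, F r m -> F r (sm_e X i m)],
      F 0%N = [set 0], F l = setT,
      forall r, (r < l)%N -> F r `<=` F r.+1
    & forall r x m, (r < l)%N -> F r.+1 m -> F r (dlt x m)].

(* The infinite sums below have finite support, by tw_filtration. *)
Record tw_object := TwObject {
  tw_car :> smodule k P;
  tw_delta : ad tw_car tw_car 0;
  tw_in : in_ad tw_delta;
  tw_filtration : finite_filtration tw_delta;
  tw_mc : forall y m,
    \sum_(s \in [set s : nat | (0 < s)%N])
       b_ad (pow_l tw_delta s AdNil) 1 y m = 0 }.

Arguments tw_delta : clear implicits.

Definition b1_tw (X Y : tw_object) (t : int) (f : ad X Y t) : ad X Y (t + 1) :=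
  fun y m => \sum_(i \in [set: nat * nat])
    b_ad (pow_l (tw_delta Y) i.2
           (AdCons f (pow_l (tw_delta X) i.1 AdNil))) (t + 1) y m.

Definition b2_tw (X0 X1 X2 : tw_object) (f2 : ad X1 X2 (-1))
    (f1 : ad X0 X1 (-1)) : ad X0 X2 (-1) :=
  fun y m => \sum_(i \in [set: nat * nat * nat])
    b_ad (pow_l (tw_delta X2) i.2
           (AdCons f2 (pow_l (tw_delta X1) i.1.2
             (AdCons f1 (pow_l (tw_delta X0) i.1.1 AdNil))))) (-1) y m.

Definition tw_id (X : tw_object) : ad X X (-1) :=
  fun x m => \sum_(i | x == be BB i) sm_e X i m.

Definition tw_cocycle (X Y : tw_object) (f : ad X Y (-1)) : Prop :=
  in_ad f /\ forall y m, b1_tw f y m = 0.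

Definition tw_cohomologous (X Y : tw_object) (f g : ad X Y (-1)) : Prop :=
  exists2 h : ad X Y (-2), in_ad h &
    forall y m, f y m - g y m = b1_tw h y m.

Definition Hm1_tw : precat := {|
  ob := tw_object;
  hom := fun X Y : tw_object => ad X Y (-1);
  mor := tw_cocycle;
  heq := tw_cohomologous;
  idm := tw_id;
  comp := b2_tw |}.

Definition Zm1_tw : precat := {|
  ob := tw_object;
  hom := fun X Y : tw_object => ad X Y (-1);
  mor := tw_cocycle;
  heq := fun _ _ f g => f = g;
  idm := tw_id;
  comp := b2_tw |}.

(* The action on X of an element s of S, given as an element of A. *)
Definition s_act X (s : A) (m : X) : X :=
  \sum_i bcoord (be BB i) s *: sm_e X i m.

Definition Psi X Y (t : int) (f : ad X Y t) (zeta : A -> A) : X -> Y :=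
  fun m => \sum_x s_act (zeta (bvec x)) (f x m).

End Twisted.

Arguments tw_delta {k P A b BB} t _ _.

(* Main.v *)
Require Import Defs.
From HB Require Import structures.
From mathcomp Require Import all_boot all_order all_algebra all_field.
From mathcomp Require Import boolp classical_sets functions cardinality fsbigop.
From mathcomp.multinomials Require freeg.
From mathcomp Require Import ring zify.

Set Implicit Arguments.
Unset Strict Implicit.
Unset Printing Implicit Defensive.

Import Order.TTheory GRing.Theory Num.Theory.

Local Open Scope classical_set_scope.
Local Open Scope ring_scope.

(* The functor on morphisms sends t to its parts on the duals of the e_i and of
   J. By directedness of the system, composable words in a basis of Ext^1 are
   bounded, so every twisted object is nilpotent and all sums are sums of
   geometric series of operators on formal sums of words. Given twisted objects
   X0, ..., X3 and t0, t1, t2 between consecutive ones, their structure maps and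
   the t_i act as letters on X0 x X1 x X2 x X3; the A-infinity relations,
   evaluated on that space, say that b_2^tw preserves cocycles and is associative
   on them. The same action, with the e_i-parts of the t_i removed, extends to
   the tensor algebra T, and its value at delta of a dual basis vector has
   b_1^tw t0 and b_2^tw(t1, t0) as off-diagonal entries: this identifies cocycles
   with morphisms of modules and b_2^tw with their composition. Finally every
   module annihilated by I is of the form M(X): nilpotency is automatic, and
   beta of the dual basis of B_1 acting by zero is the Maurer-Cartan equation. *)

(** * Projective resolutions *)

(** [T] is given by a universal property and has no basis to compute with, so its elements are
    evaluated through actions on spaces chosen for the purpose. As [pi] kills the e_s^*, such an
    action cannot see the coefficients of a morphism at the units. These make up [M(t)^0]; strict
    unitality lets them enter [b_1^tw] and [b_2^tw] only through products with a unit, so they can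
    be split off by hand. This leaves one delicate point: a product of two J-parts must have no
    component on a unit.

    Axioms travel both ways along [M]. The unit laws pass from modules to [tw(B)]. Closure under
    composition, associativity and independence of the decomposition of [delta v] pass from [tw(B)]
    to modules, since every object and every morphism there is in the image of [M]. On objects this
    is an equality, not merely an isomorphism.

    Outside the Yoneda algebra the preorder is seen only through a rank function to [nat]. *)

Section Submodules.
Context {k : fieldType} {L : falgType k} {M : lmodType L} (U : set M).
Hypothesis hU : submodule U.

(** The proof argument is a phantom: it attaches the closure properties to the predicate, so that
    the module structure can be inferred from the type. *)
Definition sub_pred (_ : submodule U) : {pred M} := fun x => `[< U x >].

Lemma sub_pred_closed : submod_closed (sub_pred hU).
Proof.
case: hU => h0 h1; split; first exact/asboolP.
by move=> a x y /asboolP hx /asboolP hy; apply/asboolP/h1.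
Qed.

HB.instance Definition _ :=
  GRing.isSubmodClosed.Build L M (sub_pred hU) sub_pred_closed.

Definition submodule_type : Type := {x : M | x \in sub_pred hU}.
HB.instance Definition _ := SubChoice.on submodule_type.
HB.instance Definition _ := [SubChoice_isSubLmodule of submodule_type by <:].

Definition submodule_lmod : lmodType L := submodule_type.

Definition sub_incl : submodule_lmod -> M := val.
Lemma sub_incl_linear : linear sub_incl.
Proof. by move=> a x y; rewrite /sub_incl linearP. Qed.
HB.instance Definition _ :=
  GRing.isLinear.Build L submodule_lmod M *:%R sub_incl sub_incl_linear.

Lemma sub_incl_inj : injective sub_incl.
Proof. exact: val_inj. Qed.

Lemma sub_inclP x : U (sub_incl x).
Proof. by case: x => x hx; apply/asboolP. Qed.

Lemma corestriction (N : lmodType L) (f : {linear N -> M}) :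
  (forall x, U (f x)) ->
  exists g : {linear N -> submodule_lmod}, forall x, sub_incl (g x) = f x.
Proof.
move=> hf.
have hf' x : f x \in sub_pred hU by apply/asboolP.
pose g x : submodule_lmod := exist _ (f x) (hf' x).
have gl : linear g by move=> a x y; apply: val_inj; rewrite /= linearP.
pose gL : {linear N -> submodule_lmod} :=
  HB.pack g (GRing.isLinear.Build L N submodule_lmod *:%R g gl).
by exists gL.
Qed.
End Submodules.

(** [projective] lifts along surjections only, so both maps are corestricted to the image of [g]. *)
Lemma lift_through_image (k : fieldType) (L : falgType k) (Q M N : lmodType L)
    (g : {linear M -> N}) (f : {linear Q -> N}) :
  projective Q -> (forall x, exists y, g y = f x) ->
  exists h : {linear Q -> M}, forall x, g (h x) = f x.
Proof.
move=> projQ him.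
have hU : submodule [set z | exists y, g y = z].
  split; first by exists 0; rewrite linear0.
  by move=> a x y [x' <-] [y' <-]; exists (a *: x' + y'); rewrite linearP.
have [g' g'E] := corestriction hU (fun y => ex_intro _ y erefl : [set z | exists y, g y = z] (g y)).
have [f' f'E] := corestriction hU him.
have gs : forall z, exists x, g' x = z.
  move=> z; have [y hy] := sub_inclP z.
  by exists y; apply: sub_incl_inj; rewrite g'E.
have [h hE] := projQ _ _ g' f' gs.
by exists h => x; rewrite -g'E hE f'E.
Qed.

Section FreeResolution.
Import freeg.
Context {k : fieldType} {L : falgType k}.

Definition free_mod (M : lmodType L) : lmodType L :=
  freeg.FreegDefs.type_of (Phant L) (Phant M).

Definition free_lift (M N : lmodType L) (f : M -> N) : free_mod M -> N :=
  freeg.fglift f.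

Lemma free_lift_linear (M N : lmodType L) (f : M -> N) : linear (free_lift f).
Proof.
have add x y : free_lift f (x - y) = free_lift f x - free_lift f y.
  exact: freeg.lift_is_additive.
have f0 : free_lift f 0 = 0 by rewrite -[0 : free_mod M](subrr 0) add subrr.
have addD x y : free_lift f (x + y) = free_lift f x + free_lift f y.
  by rewrite -[y in LHS]opprK add -[- y]sub0r add f0 sub0r opprK.
have add_sum (I : Type) (r : seq I) (F : I -> free_mod M) :
    free_lift f (\sum_(i <- r) F i) = \sum_(i <- r) free_lift f (F i).
  by elim/big_rec2: _ => // i y1 y2 _ <-; rewrite addD.
move=> a x y; rewrite addD; congr (_ + _).
have sumE : free_lift f x = \sum_(z <- freeg.dom x) freeg.coeff z x *: f z.
  rewrite -{1}[x]freeg.freeg_sumE add_sum.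
  by apply: eq_bigr => z _; rewrite /free_lift freeg.liftU.
have -> : free_lift f (a *: x)
    = \sum_(z <- freeg.dom x) (a * freeg.coeff z x) *: f z.
  rewrite [a *: x]/(freeg.fgscale a x) /freeg.fgscale add_sum.
  by apply: eq_bigr => z _; rewrite /free_lift freeg.liftU.
rewrite sumE scaler_sumr.
by apply: eq_bigr => z _; rewrite scalerA.
Qed.

HB.instance Definition _ (M N : lmodType L) (f : M -> N) :=
  GRing.isLinear.Build L (free_mod M) N *:%R (free_lift f) (free_lift_linear f).

Definition free_gen (M : lmodType L) (x : M) : free_mod M :=
  freeg.Freeg [:: (1, x)].

Lemma free_lift_gen (M N : lmodType L) (f : M -> N) x :
  free_lift f (free_gen x) = f x.
Proof. by rewrite /free_lift /free_gen freeg.liftU scale1r. Qed.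

Lemma free_ext (M N : lmodType L) (f g : {linear free_mod M -> N}) :
  (forall x, f (free_gen x) = g (free_gen x)) -> f =1 g.
Proof.
move=> h D; rewrite -[D]freeg.freeg_sumE !linear_sum.
apply: eq_bigr => z _.
have -> : freeg.Freeg [:: (freeg.coeff z D, z)]
        = freeg.coeff z D *: free_gen z :> free_mod M.
  apply/eqP/freeg.freeg_eqP => y.
  by rewrite freeg.coeffZ !freeg.coeffU mul1r.
by rewrite !linearZ h.
Qed.

Lemma free_projective (M : lmodType L) : projective (free_mod M).
Proof.
move=> M' N g f gs.
have /choice [s sE] : forall x : M, exists y, g y = f (free_gen x) by move=> x.
exists (free_lift s : {linear free_mod M -> M'}).
apply: (@free_ext _ _ (g \o free_lift s) f) => x /=.
by rewrite free_lift_gen sE.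
Qed.

Definition free_cover (M : lmodType L) : {linear free_mod M -> M} :=
  free_lift id.

Lemma kernel_submodule (M N : lmodType L) (f : {linear M -> N}) :
  submodule [set x | f x = 0].
Proof.
split => /=; first by rewrite linear0.
by move=> a x y hx hy; rewrite linearP hx hy scaler0 addr0.
Qed.

Definition syzygy (M : lmodType L) : lmodType L :=
  submodule_lmod (kernel_submodule (free_cover M)).

(** Each step covers the kernel of the preceding free cover. Resolutions of the single Delta_i are
    required because [ext_nonzero] asks for one, while the Yoneda algebra comes with a resolution of
    their sum. *)
Lemma projective_resolution_exists (M : lmodType L) :
  inhabited (projective_resolution M).
Proof.
pose S n : lmodType L := iter n syzygy M.
pose ob n := free_mod (S n).
pose d n : {linear ob n.+1 -> ob n} :=
  sub_incl (hU := kernel_submodule (free_cover (S n)))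
    \o free_cover (S n.+1).
have cov N : forall y, exists x, free_cover N x = y.
  by move=> y; exists (free_gen y); rewrite [LHS]free_lift_gen.
have dE n (x : ob n) : free_cover (S n) x = 0 <-> exists y, x = d n y.
  split=> [hx | [y ->]]; last exact: (sub_inclP (free_cover (S n.+1) y)).
  have hx' : x \in sub_pred (kernel_submodule (free_cover (S n))) by apply/asboolP.
  have [y hy] := cov (S n.+1) (exist _ x hx').
  by exists y; rewrite /d /= hy.
split; apply: (@ProjectiveResolution _ _ M ob d (free_cover (S 0%N))).
- by move=> n; apply: free_projective.
- exact: cov.
- exact: dE.
- move=> n x; rewrite -dE; split=> [h|h].
    by apply: sub_incl_inj; rewrite linear0.
  by rewrite /d /= h linear0.
Qed.
End FreeResolution.

(** The comparison theorem: exactness is used on the side of [R], projectivity on the side of [Q],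
    which is only a complex. *)
Lemma lift_chain_map (k : fieldType) (L : falgType k) (N : lmodType L)
    (R : projective_resolution N) (Q : nat -> lmodType L)
    (dQ : forall n, {linear Q n.+1 -> Q n}) (f : {linear Q 0%N -> N}) :
  (forall n, projective (Q n)) -> (forall n x, dQ n (dQ n.+1 x) = 0) ->
  (forall x, f (dQ 0%N x) = 0) ->
  exists F : forall n, {linear Q n -> pr_ob R n},
    (forall x, pr_eps R (F 0%N x) = f x) /\
    (forall n x, F n (dQ n x) = pr_d R n (F n.+1 x)).
Proof.
move=> projQ dd fd.
(* The invariant that makes the next lifting possible; it is carried along with the map in the
   recursion. *)
pose Z n : {linear Q n -> pr_ob R n} -> Prop :=
  match n with
  | 0 => fun F => forall x, pr_eps R (F (dQ 0%N x)) = 0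
  | n'.+1 => fun F => forall x, pr_d R n' (F (dQ n'.+1 x)) = 0
  end.
have [F0 F0E] := lift_through_image (projQ 0%N)
  (fun x => pr_eps_surj R (f x)).
have Z0 : Z 0%N F0 by move=> x; rewrite F0E.
have step n (F : {F | Z n F}) : {G : {G | Z n.+1 G} |
    forall x, sval F (dQ n x) = pr_d R n (sval G x)}.
  apply: cid; case: F => F zF /=.
  have im (x : Q n.+1) : exists y, pr_d R n y = F (dQ n x).
    case: n F zF x => [|n] F zF x.
      by have /pr_exact0 [y ->] := zF x; exists y.
    by have /pr_exact [y ->] := zF x; exists y.
  have [G GE] := @lift_through_image _ _ _ _ _ (pr_d R n) (F \o dQ n) (projQ n.+1) im.
  have zG : Z n.+1 G by move=> x; rewrite GE /= dd linear0.
  by exists (exist _ G zG) => x; rewrite /= GE.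
pose S := fix S n : {F | Z n F} :=
  match n with 0 => exist _ F0 Z0 | n'.+1 => sval (step n' (S n')) end.
exists (fun n => sval (S n)); split=> [x | n x]; first exact: F0E.
exact: (svalP (step n (S n))).
Qed.

Lemma resolution_projective (k : fieldType) (L : falgType k) (M : lmodType L)
    (R : projective_resolution M) n : projective (pr_ob R n).
Proof. exact: pr_projective. Qed.
Arguments resolution_projective {k L M} R n _ _ _ _ _.

(** * The Yoneda algebra *)

Section YonedaFacts.
Context {k : fieldType} {L : falgType k}.
Context {disp : Order.disp_t} {P : finPreorderType disp}.
Context {D : P -> lmodType L} {DD : direct_sum D}.
Context {R : projective_resolution DD} (Y : yoneda_algebra R).
Local Notation A := (yoneda_graded Y).
Local Notation eps := (pr_eps R).
Local Notation cls f := (yo_cls Y f).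

Lemma pr_eps_d x : eps (pr_d R 0 x) = 0.
Proof. by apply/pr_exact0; exists x. Qed.

Lemma pr_dd n x : pr_d R n (pr_d R n.+1 x) = 0.
Proof. by apply/pr_exact; exists x. Qed.

Lemma cocycle_post (phi : {linear DD -> DD}) n (f : {linear pr_ob R n -> DD}) :
  cocycle f -> cocycle (phi \o f).
Proof. by move=> hf x; rewrite /= hf linear0. Qed.

Lemma cocycle_eps (phi : {linear DD -> DD}) : cocycle (n := 0) (phi \o eps).
Proof. by move=> x; rewrite /= pr_eps_d linear0. Qed.

Lemma yo_cls_ext n (f g : {linear pr_ob R n -> DD}) :
  cocycle f -> cocycle g -> f =1 g -> cls f = cls g.
Proof.
move=> hf hg fg; rewrite (@yo_lin _ _ _ _ _ _ _ Y n 0 g g f hg hg).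
  by rewrite scale0r add0r.
by move=> x; rewrite scale0r scale0r add0r fg.
Qed.

(** A chain lift [F] of [f] satisfies [eps \o F 0 = f], so multiplying by the class of [phi \o eps]
    amounts to composing with [phi]. *)
Lemma yo_post (phi : {linear DD -> DD}) n (f : {linear pr_ob R n -> DD}) :
  cocycle f -> cls (phi \o eps) * cls f = cls (phi \o f).
Proof.
move=> hf.
have [F [F0 FS]] := @lift_chain_map _ _ _ R (fun r => pr_ob R (r + n))
  (fun r => pr_d R (r + n)) f (fun r => resolution_projective R (r + n))
  (fun r x => pr_dd x) hf.
apply: (@yo_mul _ _ _ _ _ _ _ Y n 0 f (phi \o eps) F (phi \o f)) => //.
  exact: cocycle_eps.
by move=> x /=; rewrite F0.
Qed.

Definition ds_idem i : {linear DD -> DD} := ds_in DD i \o ds_pr DD i.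

(** The two composites differ by their bracketing only, but are distinct terms as linear maps. *)
Lemma yoneda_eE i : ga_e A i = cls (ds_idem i \o eps).
Proof. by apply: yo_cls_ext => // x; exact: (cocycle_eps (ds_idem i)). Qed.

Lemma yoneda_ee i j : ga_e A i * ga_e A j = if i == j then ga_e A i else 0.
Proof.
have ce l := cocycle_eps (ds_idem l).
rewrite !yoneda_eE yo_post //.
case: eqP => [<- | ij].
  apply: yo_cls_ext => //; first exact: cocycle_post.
  by move=> x; rewrite /= ds_pr_in.
apply/yo_ker; first exact: cocycle_post.
by move=> x /=; rewrite ds_pr_in0 // linear0.
Qed.

Lemma yoneda_sum_e : \sum_i ga_e A i = 1.
Proof.
(* [yo_lin] speaks of cocycles, so the induction carries a cocycle representing the partial sum. *)
have H (s : seq P) : exists f : {linear pr_ob R 0 -> DD},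
    [/\ cocycle f, forall x, f x = \sum_(i <- s) ds_idem i (eps x)
      & cls f = \sum_(i <- s) ga_e A i].
  elim: s => [|i s [f [cf fE clsf]]].
    exists (\0 : {linear pr_ob R 0 -> DD}); split=> //.
      by move=> x; rewrite big_nil.
    by rewrite big_nil; apply/yo_ker.
  have ce := cocycle_eps (ds_idem i).
  pose g : {linear pr_ob R 0 -> DD} := (ds_idem i \o eps) \+ f.
  exists g; split.
  - by move=> x; rewrite /= cf pr_eps_d !linear0 addr0.
  - by move=> x; rewrite big_cons /= fE.
  rewrite big_cons -clsf yoneda_eE.
  rewrite (@yo_lin _ _ _ _ _ _ _ Y 0 1 (ds_idem i \o eps) f g) ?scale1r //.
  by move=> x; rewrite !scale1r.
have [f [cf fE <-]] := H (index_enum P).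
rewrite -(yo_one Y); apply: yo_cls_ext => //; first exact: pr_eps_d.
by move=> x; rewrite fE [RHS]ds_sum.
Qed.

Lemma linear_comb_exists (M N : lmodType L) (c : k) (f g : {linear M -> N}) :
  exists h : {linear M -> N}, forall x, h x = (c%:A : L) *: f x + g x.
Proof.
pose h x := (c%:A : L) *: f x + g x.
have hl : linear h.
  move=> a x y; rewrite /h !linearP !scalerDr !scalerA.
  have -> : (c%:A : L) * a = a * c%:A by rewrite mulr_algl mulr_algr.
  by rewrite addrACA.
pose hL : {linear M -> N} :=
  HB.pack h (GRing.isLinear.Build L M N *:%R h hl).
by exists hL.
Qed.

Lemma yoneda_deg0 z : ga_deg (g := A) z 0.
Proof.
case: z => n //=; exists (\0 : {linear pr_ob R n -> DD}) => //.
apply/esym/yo_ker => //; case: n => [|n] //=.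
by exists (\0 : {linear pr_ob R n -> DD}).
Qed.

Lemma yoneda_deg_lin z (c : k) (x y : A) :
  ga_deg z x -> ga_deg z y -> ga_deg z (c *: x + y).
Proof.
case: z => n /=; last by move=> -> ->; rewrite scaler0 addr0.
move=> [f cf ->] [g cg ->].
have [h hE] := linear_comb_exists c f g.
exists h; first by move=> u; rewrite hE cf cg scaler0 addr0.
exact/esym/yo_lin.
Qed.

Lemma yoneda_deg_neg z (x : A) : z < 0 -> ga_deg z x -> x = 0.
Proof. by case: z. Qed.

Lemma yoneda_span (a : A) : exists N (f : nat -> A),
  (forall n, ga_deg n%:Z (f n)) /\ a = \sum_(n < N) f n.
Proof.
have [N [f [cf ->]]] := yo_span a.
by exists N, (fun n => yo_cls Y (f n)); split=> // n; exists (f n).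
Qed.

(** A 0-cocycle kills the image of [pr_d R 0], which is the kernel of [eps]: this identifies Ext^0
    with Hom. *)
Lemma cocycle0_factor (f : {linear pr_ob R 0 -> DD}) : cocycle f ->
  exists phi : {linear DD -> DD}, forall x, f x = phi (eps x).
Proof.
move=> cf; have [s sE] := choice (pr_eps_surj R).
have ker x : eps x = 0 -> f x = 0 by case/pr_exact0 => y ->; rewrite cf.
have fE x y : eps x = eps y -> f x = f y.
  by move=> xy; apply/subr0_eq; rewrite -linearB ker // linearB xy subrr.
pose p y := f (s y).
have pl : linear p.
  by move=> a x y; rewrite /p -linearP; apply: fE; rewrite linearP !sE.
pose pL : {linear DD -> DD} :=
  HB.pack p (GRing.isLinear.Build L DD DD *:%R p pl).
exists pL => x /=.
by apply: fE; rewrite sE.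
Qed.

(** The class [e_t a e_s] comes from the component from Delta_s to Delta_t of an endomorphism; if
    that component vanished, so would [a]. *)
Lemma yoneda_hom_directed (a : A) s t : homological_system D ->
  ga_deg 0 a -> ga_e A t * a = a -> a * ga_e A s = a -> a <> 0 -> (s <= t)%O.
Proof.
move=> hD [f cf ->] la ra a0.
have [phi phiE] := cocycle0_factor cf.
apply: (hs_hom hD); apply: contrapT => hz; apply: a0.
have z x : ds_pr DD t (phi (ds_in DD s x)) = 0.
  apply: contrapT => h; apply: hz.
  by exists (ds_pr DD t \o (phi \o ds_in DD s)), x.
have fphi : cls f = cls (phi \o eps).
  by apply: yo_cls_ext => //; exact: cocycle_eps.
rewrite -la -ra {1}fphi !yoneda_eE yo_post; last exact: cocycle_eps.
rewrite yo_post; last exact/cocycle_post/cocycle_eps.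
apply/yo_ker; first exact/cocycle_post/cocycle_post/cocycle_eps.
by move=> x /=; rewrite z linear0.
Qed.

(* A cocycle on a resolution of Delta representing e_t a e_s restricts, along
   a lift of the inclusion of Delta_s, to a cocycle on any resolution of
   Delta_s; it is a coboundary only if e_t a e_s = 0. *)
Lemma yoneda_ext_directed (a : A) s t : homological_system D ->
  ga_deg 1 a -> ga_e A t * a = a -> a * ga_e A s = a -> a <> 0 ->
  (s <= t)%O /\ ~ ((s <= t)%O /\ (t <= s)%O).
Proof.
move=> hD [f cf ->] la ra a0.
apply: (hs_ext hD).
have [R'] := projective_resolution_exists (D s).
have dd' n x : pr_d R' n (pr_d R' n.+1 x) = 0 by apply/pr_exact; exists x.
have ed' x : pr_eps R' (pr_d R' 0 x) = 0 by apply/pr_exact0; exists x.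
have [G [G0 GS]] := @lift_chain_map _ _ _ R (pr_ob R') (pr_d R')
  (ds_in DD s \o pr_eps R') (resolution_projective R') dd'
  (fun x => etrans (congr1 (ds_in DD s) (ed' x)) (linear0 _)).
have [H [H0 HS]] := @lift_chain_map _ _ _ R' (fun r => pr_ob R (r + 0))
  (fun r => pr_d R (r + 0)) (ds_pr DD s \o eps)
  (fun r => resolution_projective R (r + 0)) (fun r x => pr_dd x)
  (fun x => etrans (congr1 (ds_pr DD s) (pr_eps_d x)) (linear0 _)).
pose g : {linear pr_ob R' 1 -> D t} := ds_pr DD t \o (f \o G 1%N).
exists R', g; split=> [x | [g0 g0E]].
  by rewrite /g /= GS cf linear0.
apply: a0; rewrite -la -ra.
pose h : {linear pr_ob R (1 + 0) -> DD} := f \o (G 1%N \o H 1%N).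
have ch : cocycle h.
  by move=> x; rewrite /h /= (HS 1%N) GS cf.
have -> : cls f * ga_e A s = cls h.
  rewrite yoneda_eE.
  apply: (@yo_mul _ _ _ _ _ _ _ Y 0 1 (ds_idem s \o eps) f
            (fun r => G r \o H r) h) => //.
  - exact: cocycle_eps.
  - by move=> x /=; rewrite G0 /= H0.
  - by move=> r x /=; rewrite HS GS.
rewrite yoneda_eE yo_post //.
apply/yo_ker; first exact: cocycle_post.
exists (ds_in DD t \o (g0 \o H 0%N)) => x /=.
by rewrite HS -g0E.
Qed.

End YonedaFacts.

(** * The radical of the degree 0 part *)

Section RadicalFacts.
Context {k : fieldType} {P : finType} {A : graded_algebra k P}.
Hypothesis deg0 : forall z, ga_deg (g := A) z 0.
Hypothesis deg_lin : forall z (c : k) (x y : A),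
  ga_deg z x -> ga_deg z y -> ga_deg z (c *: x + y).
Hypothesis deg_mul : forall x y : A,
  ga_deg 0 x -> ga_deg 0 y -> ga_deg 0 (x * y).

Lemma radical_mull (x a : A) : ga_deg 0 x -> radical a -> radical (x * a).
Proof.
move=> dx [da ha]; split; first exact: deg_mul.
move=> y dy; have [z dz hz] := ha _ (deg_mul dy dx).
by exists z => //; rewrite mulrA.
Qed.

(** If [u] is a left inverse of [1 - (c *: z) * x], then [u * (1 - z * (c *: x + y)) = 1 - (u * z) *
    y], which in turn has a left inverse. *)
Lemma radical_lin (c : k) (x y : A) :
  radical x -> radical y -> radical (c *: x + y).
Proof.
move=> [dx hx] [dy hy]; split; first exact: deg_lin.
move=> z dz.
have dcz : ga_deg 0 (c *: z) by rewrite -[c *: z]addr0; apply: deg_lin.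
have [u du hu] := hx _ dcz.
have [v dv hv] := hy _ (deg_mul du dz).
exists (v * u); first exact: deg_mul.
have -> : 1 - z * (c *: x + y) = (1 - (c *: z) * x) - z * y.
  by rewrite mulrDr -scalerAr -scalerAl opprD addrA.
by rewrite -mulrA mulrBr hu [u * (z * y)]mulrA.
Qed.

(** Here [1 - y * x = 1 - y] has a left inverse, while [(1 - y) * y = 0]. *)
Lemma radical_idem (x y : A) :
  radical x -> ga_deg 0 y -> y * x = y -> y * y = y -> y = 0.
Proof.
move=> [dx hx] dy yx yy; have [z _ hz] := hx y dy.
have : z * (1 - y * x) * y = y by rewrite hz mul1r.
by rewrite yx -mulrA mulrBl mul1r yy subrr mulr0.
Qed.

End RadicalFacts.

Definition bar_word (k : fieldType) (P : finType) (A : graded_algebra k P)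
  (w : seq (int * A)) : Prop := forall p, p \in w -> bdeg p.1 p.2.

(** The interface between the Yoneda algebra and all later arguments. The rank does not decrease
    along basis elements of degree -1 and increases strictly along those of degree 0. Apart from
    multilinearity, the conditions on [b] concern homogeneous arguments, where [is_bar] determines
    it. *)
Record bar_facts (k : fieldType) (P : finType) (A : graded_algebra k P)
    (b : seq A -> A) (BB : bar_basis A) (rk : P -> nat) : Prop := BarFacts {
  bf_ee : forall i j, ga_e A i * ga_e A j = if i == j then ga_e A i else 0;
  bf_e1 : \sum_i ga_e A i = 1;
  bf_span : forall a : A, exists N : nat,
    a = \sum_(n < N) \sum_(x : idx BB (n%:Z - 1)) bcoord x a *: bvec x;
  bf_low : forall t, t < -1 -> idx BB t -> False;
  bf_hom : forall x : idx BB (-1), (rk (bsrc x) <= rk (btgt x))%N;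
  bf_ext : forall x : idx BB 0, (rk (bsrc x) < rk (btgt x))%N;
  bf_JJ : forall i (x y : idx BB (-1)),
    (forall j, x <> be BB j) -> (forall j, y <> be BB j) ->
    bcoord (be BB i) (bvec x * bvec y) = 0;
  bf_deg0 : forall t, bdeg t (0 : A);
  bf_deg_lin : forall t (c : k) (x y : A),
    bdeg t x -> bdeg t y -> bdeg t (c *: x + y);
  bf_lin : multilinear b;
  bf_deg : forall w, (0 < size w)%N -> bar_word w ->
    bdeg (\sum_(p <- w) p.1 + 1) (b (map snd w));
  bf_b1 : forall t x, bdeg t x -> b [:: x] = 0;
  bf_b2 : forall t t' x y, bdeg t x -> bdeg t' y ->
    b [:: x; y] = (-1) ^ (t + 1) *: (x * y);
  bf_unit : forall w, (3 <= size w)%N -> bar_word w ->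
    (exists j, ga_e A j \in map snd w) -> b (map snd w) = 0;
  bf_left : forall i t x w, bdeg t x -> bar_word w ->
    b (ga_e A i * x :: map snd w) = ga_e A i * b (x :: map snd w);
  bf_right : forall i t x w, bdeg t x -> bar_word w ->
    b (rcons (map snd w) (x * ga_e A i)) = b (rcons (map snd w) x) * ga_e A i;
  bf_mid : forall i u v t x t' y,
    bdeg t x -> bdeg t' y -> bar_word u -> bar_word v ->
    b (map snd u ++ x * ga_e A i :: y :: map snd v)
      = b (map snd u ++ x :: ga_e A i * y :: map snd v);
  bf_bar : forall w, (0 < size w)%N -> bar_word w ->
    let n := size w in
    let a := map snd w in
    \sum_(r < n.+1) \sum_(s < n.+1 | (0 < s)%N && (r + s <= n)%N)
      ((-1 : k) ^ (\sum_(p <- take r w) p.1)) *: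
        b (take r a ++ b (take s (drop r a)) :: drop (r + s)%N a) = 0 }.

(** * The bar construction *)

Section Signs.
Context {k : fieldType}.
Local Notation sgn z := ((-1 : k) ^ z).

Lemma sgnD (x y : int) : sgn (x + y) = sgn x * sgn y.
Proof. by apply: expfzDr; rewrite oppr_eq0 oner_eq0. Qed.

Lemma sgn_even (x : int) : sgn (2 * x) = 1.
Proof.
have -> : 2 * x = x + x by ring.
rewrite sgnD -expfzMl.
by rewrite mulrNN mulr1 exp1rz.
Qed.

Lemma sgn_sq (x : int) : sgn x * sgn x = 1.
Proof. by rewrite -sgnD -[RHS](sgn_even x); congr (_ ^ _); ring. Qed.

Lemma sgn_eq (x y z : int) : x - y = 2 * z -> sgn x = sgn y.
Proof. by move=> h; rewrite -[x](subrK y) h sgnD sgn_even mul1r. Qed.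
End Signs.

Section BarConstruction.
Context {k : fieldType} {P : finType} {A : graded_algebra k P}.
Context (m b : seq A -> A).
Hypothesis hm : strict_Ainfinity m.
Hypothesis hb : is_bar m b.
Hypothesis deg0 : forall z, ga_deg (g := A) z 0.
Hypothesis deg_lin : forall z (c : k) (x y : A),
  ga_deg z x -> ga_deg z y -> ga_deg z (c *: x + y).
Local Notation sgn z := ((-1 : k) ^ z).

(** The exponent of [is_bar], in a recursive form suited to concatenation. *)
Fixpoint bar_sign (w : seq (int * A)) : int :=
  match w with
  | [::] => 0
  | p :: w' => (size w')%:Z * p.1 + bar_sign w'
  end.

Lemma bar_signE (w : seq (int * A)) :
  \sum_(u < size w) ((size w).-1 - u)%N%:Z * (nth (0, 0) w u).1 = bar_sign w.
Proof.
elim: w => [|p w IH] /=; first by rewrite big_ord0.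
rewrite big_ord_recl /= subn0 -IH; congr (_ + _).
by apply: eq_bigr => u _; rewrite /bump /=; congr (_%:Z * _); lia.
Qed.

Lemma bar_sign_cat (u v : seq (int * A)) :
  bar_sign (u ++ v) = bar_sign u + (size v)%:Z * \sum_(p <- u) p.1 + bar_sign v.
Proof.
elim: u => [|p u IH] /=; first by rewrite big_nil mulr0 !add0r.
by rewrite IH big_cons size_cat PoszD; ring.
Qed.

Lemma barE (w : seq (int * A)) : (0 < size w)%N -> homogeneous_word w ->
  b (map snd w) = sgn (bar_sign w) *: m (map snd w).
Proof.
move=> w0 hw; rewrite -(hb.2 w w0 hw) bar_signE scalerA.
by rewrite sgn_sq scale1r.
Qed.

Lemma bar_inv (w : seq (int * A)) : (0 < size w)%N -> homogeneous_word w ->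
  m (map snd w) = sgn (bar_sign w) *: b (map snd w).
Proof. by move=> w0 hw; rewrite barE // scalerA sgn_sq scale1r. Qed.

Lemma multilinear_scale (f : seq A -> A) u v (c : k) x : multilinear f ->
  f (u ++ (c *: x) :: v) = c *: f (u ++ x :: v).
Proof.
move=> hf; have := hf u v 1 0 0; rewrite scale1r addr0 scale1r => h0.
have {h0}h0 : f (u ++ 0 :: v) = 0.
  by apply: (addrI (f (u ++ 0 :: v))); rewrite -h0 addr0.
by rewrite -[c *: x]addr0 hf h0 addr0.
Qed.

Lemma homogeneous_cat (u v : seq (int * A)) :
  homogeneous_word u -> homogeneous_word v -> homogeneous_word (u ++ v).
Proof. by move=> hu hv p; rewrite mem_cat => /orP[/hu|/hv]. Qed.

Lemma homogeneous_take r (w : seq (int * A)) :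
  homogeneous_word w -> homogeneous_word (take r w).
Proof. by move=> h p /mem_take /h. Qed.

Lemma homogeneous_drop r (w : seq (int * A)) :
  homogeneous_word w -> homogeneous_word (drop r w).
Proof. by move=> h p /mem_drop /h. Qed.

(** Compares one term of [stasheff] with the corresponding term for [b]: up to the factor [bar_sign]
    of the whole word, which is common to all terms, only the Koszul sign of the prefix remains. *)
Lemma bar_term (u v z : seq (int * A)) : (0 < size v)%N ->
  homogeneous_word u -> homogeneous_word v -> homogeneous_word z ->
  sgn ((size u + size v * size z)%N%:Z + (2 - (size v)%:Z) * \sum_(p <- u) p.1) *:
     m (map snd u ++ m (map snd v) :: map snd z)
  = (sgn (bar_sign (u ++ v ++ z)) * sgn (\sum_(p <- u) (p.1 + 1))) *:
     b (map snd u ++ b (map snd v) :: map snd z).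
Proof.
move=> v0 hu hv hz.
set d := \sum_(p <- v) p.1 + 2 - (size v)%:Z.
have hd : ga_deg d (m (map snd v)) by apply: ai_deg.
have hw : homogeneous_word (u ++ (d, m (map snd v)) :: z).
  apply: homogeneous_cat => // p; rewrite in_cons => /orP[/eqP ->|/hz] //.
have mapE c : map snd u ++ c :: map snd z = map snd (u ++ (d, c) :: z).
  by rewrite map_cat.
rewrite mapE bar_inv // -?mapE ?size_cat /= ?addnS //.
rewrite [in LHS](bar_inv v0 hv) (multilinear_scale _ _ _ _ (proj1 hb)) !scalerA.
congr (_ *: _); rewrite -!sgnD.
(* The two exponents differ by an even number; the witness is half the difference. *)
apply: (@sgn_eq _ _ _ ((1 - (size v)%:Z) * (\sum_(p <- u) p.1) + (size z)%:Z)).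
have -> : \sum_(p <- u) (p.1 + 1) = \sum_(p <- u) p.1 + (size u)%:Z.
  elim: (u) => [|p u' IH]; first by rewrite !big_nil.
  by rewrite !big_cons IH /= -addn1 PoszD; ring.
rewrite !bar_sign_cat /= /d !size_cat /= !PoszD PoszM -[(size z).+1]addn1 PoszD.
ring.
Qed.

(* The operations b_n satisfy the A-infinity relations with no other sign than
   the Koszul sign for the shifted degree. *)
Lemma bar_relation (w : seq (int * A)) : (0 < size w)%N -> homogeneous_word w ->
  let n := size w in
  let a := map snd w in
  \sum_(r < n.+1) \sum_(s < n.+1 | (0 < s)%N && (r + s <= n)%N)
    sgn (\sum_(p <- take r w) (p.1 + 1)) *:
      b (take r a ++ b (take s (drop r a)) :: drop (r + s)%N a) = 0.
Proof.
move=> w0 hw n a; have := ai_stasheff hm w0 hw; rewrite -/n -/a => H.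
rewrite -[RHS](scaler0 _ (sgn (bar_sign w))) -[in RHS]H scaler_sumr.
apply: eq_bigr => r _; rewrite scaler_sumr.
apply: eq_bigr => s /andP[s0 rs]; rewrite scalerA.
set u := take r w; set v := take s (drop r w); set z := drop (r + s) w.
have wE : w = u ++ v ++ z.
  by rewrite /u /v /z addnC -drop_drop !cat_take_drop.
have su : size u = r by rewrite size_take -/n; case: ltngtP rs => //; lia.
have sv : size v = s.
  by rewrite size_take size_drop -/n; case: ltngtP rs => //; lia.
have sz : size z = (n - r - s)%N by rewrite size_drop subnDA.
have v0 : (0 < size v)%N by rewrite sv.
have hu : homogeneous_word u by apply: homogeneous_take.
have hv : homogeneous_word v by apply/homogeneous_take/homogeneous_drop.
have hz : homogeneous_word z by apply: homogeneous_drop.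
have := bar_term v0 hu hv hz.
rewrite su sv sz -wE /a -!map_drop -!map_take -/u -/v -/z => E.
by rewrite -[in RHS]scalerA E scalerA mulrA sgn_sq mul1r.
Qed.

Definition unshift (w : seq (int * A)) : seq (int * A) :=
  [seq (p.1 + 1, p.2) | p <- w].

Lemma unshift_snd w : map snd (unshift w) = map snd w.
Proof. by rewrite -map_comp. Qed.

Lemma unshift_homogeneous w : bar_word w -> homogeneous_word (unshift w).
Proof. by move=> hw p /mapP[q /hw hq ->]. Qed.

Lemma unshift_size w : size (unshift w) = size w.
Proof. by rewrite size_map. Qed.

Lemma bar_word_cons t x (w : seq (int * A)) :
  bdeg t x -> bar_word w -> bar_word ((t, x) :: w).
Proof. by move=> hx hw p; rewrite in_cons => /orP[/eqP ->|/hw]. Qed.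

Lemma bar_word_cat (u v : seq (int * A)) :
  bar_word u -> bar_word v -> bar_word (u ++ v).
Proof. by move=> hu hv p; rewrite mem_cat => /orP[/hu|/hv]. Qed.

Lemma barwE (w : seq (int * A)) : (0 < size w)%N -> bar_word w ->
  b (map snd w) = sgn (bar_sign (unshift w)) *: m (map snd w).
Proof.
move=> w0 hw; rewrite -(unshift_snd w) barE ?unshift_size //.
exact: unshift_homogeneous.
Qed.

Lemma bar_sign_ext (w w' : seq (int * A)) :
  map fst w = map fst w' -> bar_sign w = bar_sign w'.
Proof.
elim: w w' => [|p w IH] [|p' w'] //= [-> h].
by rewrite (IH _ h) -(size_map fst w) h size_map.
Qed.

(** The sign relating [m] and [b] depends on the degrees alone, so an identity between values of [m]
    on words with the same degrees passes to [b]. *)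
Lemma barw_morph (w w' : seq (int * A)) (f : A -> A) :
  map fst w = map fst w' -> (0 < size w)%N -> bar_word w -> bar_word w' ->
  scalable f ->
  m (map snd w) = f (m (map snd w')) -> b (map snd w) = f (b (map snd w')).
Proof.
move=> ww' w0 hw hw' fs h.
have sw : size w = size w' by rewrite -(size_map fst w) ww' size_map.
rewrite !barwE -?sw // h fs; congr (sgn _ *: _).
apply: bar_sign_ext; rewrite -!map_comp.
by rewrite -[LHS]/(map ((fun z => z + 1) \o fst) w) map_comp ww' -map_comp.
Qed.

Section BarFacts.
Context (BB : bar_basis A) (rk : P -> nat).
Hypothesis ee : forall i j, ga_e A i * ga_e A j = if i == j then ga_e A i else 0.
Hypothesis e1 : \sum_i ga_e A i = 1.
Hypothesis deg_neg : forall z (x : A), z < 0 -> ga_deg z x -> x = 0.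
Hypothesis gspan : forall a : A, exists N (f : nat -> A),
  (forall n, ga_deg n%:Z (f n)) /\ a = \sum_(n < N) f n.
Hypothesis rk_hom : forall (a : A) s t,
  ga_deg 0 a -> ga_e A t * a = a -> a * ga_e A s = a -> a <> 0 ->
  (rk s <= rk t)%N.
Hypothesis rk_ext : forall (a : A) s t,
  ga_deg 1 a -> ga_e A t * a = a -> a * ga_e A s = a -> a <> 0 ->
  (rk s < rk t)%N.

Lemma bcoord0 t (x : idx BB t) : bcoord x 0 = 0.
Proof.
have := bcoord_lin x 1 0 0; rewrite scale1r addr0 mul1r.
by move=> h; apply: (addrI (bcoord x 0)); rewrite -h addr0.
Qed.

Lemma bcoordD t (x : idx BB t) u v : bcoord x (u + v) = bcoord x u + bcoord x v.
Proof. by have := bcoord_lin x 1 u v; rewrite scale1r mul1r. Qed.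

Lemma bcoordZ t (x : idx BB t) c u : bcoord x (c *: u) = c * bcoord x u.
Proof. by have := bcoord_lin x c u 0; rewrite bcoord0 !addr0. Qed.

Lemma bcoord_sum t (x : idx BB t) (I : Type) (r : seq I) (Q : pred I) F :
  bcoord x (\sum_(i <- r | Q i) F i) = \sum_(i <- r | Q i) bcoord x (F i).
Proof. by elim/big_rec2: _ => [|i y1 y2 _ <-]; rewrite ?bcoord0 ?bcoordD. Qed.

Lemma bvec_neq0 t (x : idx BB t) : bvec x <> 0.
Proof.
move=> h; have := bcoord_vec x x; rewrite h bcoord0 eqxx.
by move/eqP; rewrite eq_sym oner_eq0.
Qed.

Lemma deg_mul0 (x y : A) : ga_deg 0 x -> ga_deg 0 y -> ga_deg 0 (x * y).
Proof.
move=> dx dy.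
have hw : homogeneous_word [:: (0, x); (0, y)].
  by move=> p; rewrite !inE => /orP[/eqP ->|/eqP ->].
have := ai_deg hm (w := [:: (0, x); (0, y)]) isT hw.
by rewrite !big_cons big_nil /= (ai_m2 hm).
Qed.

Lemma be_inj : injective (be BB).
Proof.
move=> i j h; case: (eqVneq i j) => // ij.
have eij : ga_e A i = ga_e A j by rewrite -!(bvec_e BB) h.
have := ee i j; rewrite (negbTE ij) -{}eij ee eqxx => h0.
by case: (bvec_neq0 (x := be BB i)); rewrite bvec_e.
Qed.

(** After subtraction of the part along the basis of [J], the combination of the [e_j] that remains
    is radical. A nonzero coefficient at [i] would make [e_i] radical, but it is a nonzero
    idempotent. *)
Lemma radical_coord (a : A) i : radical a -> bcoord (be BB i) a = 0.
Proof.
move=> ra.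
have da : bdeg (-1) a by case: ra.
have rad0 : radical (0 : A).
  have := radical_mull deg_mul0 (deg0 0) ra; by rewrite mul0r.
have de j : ga_deg 0 (ga_e A j) by have := bvec_deg (be BB j); rewrite bvec_e.
have aE := @bvec_span _ _ _ BB _ _ da.
pose c j := bcoord (be BB j) a.
have radS : radical (\sum_j c j *: ga_e A j).
  have split : a = \sum_j c j *: ga_e A j
      + \sum_(x | [forall j, x != be BB j]) bcoord x a *: bvec x.
    rewrite [LHS]aE (bigID (fun x => [forall j, x != be BB j])) /= addrC.
    congr (_ + _).
    rewrite (eq_bigl (fun x => x \in [set be BB j | j : P]%SET)); last first.
      move=> x; rewrite negb_forall; apply/existsP/imsetP.
        by case=> j; rewrite negbK => /eqP ->; exists j.
      by case=> j _ ->; exists j; rewrite eqxx.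
    rewrite big_imset /=; last by move=> i1 i2 _ _; apply: be_inj.
    by apply: eq_big => // j _; rewrite bvec_e.
  have radJ : radical (\sum_(x | [forall j, x != be BB j]) bcoord x a *: bvec x).
    elim/big_rec: _ => // x y /forallP hx ry; apply: (radical_lin deg0 deg_lin deg_mul0) => //.
    by apply: bvec_J => j; apply/eqP.
  have -> : \sum_j c j *: ga_e A j
      = (-1) *: (\sum_(x | [forall j, x != be BB j]) bcoord x a *: bvec x) + a.
    by rewrite scaleN1r [in RHS]addrC; apply/esym/eqP; rewrite subr_eq -split.
  exact: (radical_lin deg0 deg_lin deg_mul0).
case: (eqVneq (c i) 0) => // ci.
have rei : radical (ga_e A i).
  have -> : ga_e A i = ((c i)^-1 *: ga_e A i) * \sum_j c j *: ga_e A j.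
    rewrite mulr_sumr (bigD1 i) //= big1 ?addr0.
      by rewrite -scalerAr -scalerAl scalerA divff // scale1r ee eqxx.
    by move=> j ji; rewrite -scalerAr -scalerAl ee eq_sym (negbTE ji) !scaler0.
  apply: radical_mull => //; first exact: deg_mul0.
  by rewrite -[_ *: _]addr0; apply: deg_lin.
have : ga_e A i = 0 by apply: (radical_idem rei); rewrite ?ee ?eqxx.
by rewrite -(bvec_e BB) => /bvec_neq0.
Qed.

Lemma bar_facts_of_Ainfinity : bar_facts b BB rk.
Proof.
split=> //.
- move=> a; have [N [f [df aE]]] := gspan a; exists N.
  have fE n : f n = \sum_(x : idx BB (n%:Z - 1)) bcoord x (f n) *: bvec x.
    by apply: bvec_span; rewrite /bdeg subrK.
  rewrite {1}aE; apply: eq_bigr => n _; rewrite {1}fE.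
  apply: eq_bigr => x _; congr (_ *: _).
  rewrite aE bcoord_sum (bigD1 n) //= big1 ?addr0 // => n' nn'.
  apply: (@bcoord_deg _ _ _ BB (n%:Z - 1) (n'%:Z - 1) x).
    by move/addIr/eqP; rewrite eqz_nat => /eqP/val_inj/esym/eqP; rewrite (negbTE nn').
  by rewrite /bdeg subrK.
- move=> t tl x; apply: (bvec_neq0 (x := x)); apply: (@deg_neg (t + 1)).
    by lia.
  exact: bvec_deg.
- move=> x; apply: (rk_hom (bvec_deg x)); rewrite ?bvec_l ?bvec_r //.
  exact: bvec_neq0.
- move=> x; apply: (rk_ext (bvec_deg x)); rewrite ?bvec_l ?bvec_r //.
  exact: bvec_neq0.
- move=> i x y _ hy; apply: radical_coord; apply: (radical_mull deg_mul0).
    exact: (bvec_deg x).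
  exact: bvec_J.
- by move=> t; apply: deg0.
- by move=> t c x y; apply: deg_lin.
- exact: (proj1 hb).
- move=> w w0 hw; rewrite barwE // -[_ *: _]addr0; apply: deg_lin => //.
  have hu := unshift_homogeneous hw.
  have := ai_deg hm (w := unshift w); rewrite unshift_size => /(_ w0 hu).
  rewrite unshift_snd /bdeg /unshift big_map /=.
  have -> : \sum_(p <- w) (p.1 + 1) = \sum_(p <- w) p.1 + (size w)%:Z.
    elim: (w) => [|p u' IH]; first by rewrite !big_nil.
    by rewrite !big_cons IH /= -addn1 PoszD; ring.
  by rewrite addrAC addrK -addrA.
- move=> t x dx; rewrite (@barwE [:: (t, x)]) ?(ai_m1 hm) ?scaler0 //=.
  exact: bar_word_cons.
- move=> t t' x y dx dy; rewrite (@barwE [:: (t, x); (t', y)]) //=.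
    by rewrite (ai_m2 hm) mul1r mul0r !addr0.
  by do 2!apply: bar_word_cons => //.
- move=> w w3 hw he; rewrite barwE ?(ai_unit hm) ?scaler0 ?size_map //.
  exact: leq_trans w3.
- move=> i t x w dx hw.
  have [_ _ hl _] := ai_morph hm.
  have dex : bdeg t (ga_e A i * x).
    have de := bvec_deg (be BB i); rewrite bvec_e in de.
    have he : homogeneous_word [:: (0, ga_e A i); (t + 1, x)].
      by move=> p; rewrite !inE => /orP[/eqP ->|/eqP ->].
    have := ai_deg hm (w := [:: (0, ga_e A i); (t + 1, x)]) isT he.
    by rewrite !big_cons big_nil /= (ai_m2 hm) add0r addr0 addrK.
  apply: (@barw_morph ((t, ga_e A i * x) :: w) ((t, x) :: w)) => //=;
    rewrite ?hl //; try exact: bar_word_cons.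
  by move=> c y /=; rewrite scalerAr.
- move=> i t x w dx hw.
  have [_ _ _ hr] := ai_morph hm.
  have dex : bdeg t (x * ga_e A i).
    have de := bvec_deg (be BB i); rewrite bvec_e in de.
    have he : homogeneous_word [:: (t + 1, x); (0, ga_e A i)].
      by move=> p; rewrite !inE => /orP[/eqP ->|/eqP ->].
    have := ai_deg hm (w := [:: (t + 1, x); (0, ga_e A i)]) isT he.
    by rewrite !big_cons big_nil /= (ai_m2 hm) !addr0 addrK.
  have rE y : rcons (map snd w) y = map snd (rcons w (t, y)).
    by rewrite map_rcons.
  have hwr y : bdeg t y -> bar_word (rcons w (t, y)).
    by move=> dy; rewrite -cats1; apply: bar_word_cat => //; apply: bar_word_cons.
  rewrite !rE.
  apply: (@barw_morph _ _ (fun y => y * ga_e A i)); rewrite ?map_rcons ?size_rcons //.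
  + exact: hwr.
  + exact: hwr.
  + by move=> c y /=; rewrite scalerAl.
  + by rewrite /= hr.
- move=> i u v t x t' y dx dy hu hv.
  have [_ hmid _ _] := ai_morph hm.
  have de := bvec_deg (be BB i); rewrite bvec_e in de.
  have dxe : bdeg t (x * ga_e A i).
    have he : homogeneous_word [:: (t + 1, x); (0, ga_e A i)].
      by move=> p; rewrite !inE => /orP[/eqP ->|/eqP ->].
    have := ai_deg hm (w := [:: (t + 1, x); (0, ga_e A i)]) isT he.
    by rewrite !big_cons big_nil /= (ai_m2 hm) !addr0 addrK.
  have dey : bdeg t' (ga_e A i * y).
    have he : homogeneous_word [:: (0, ga_e A i); (t' + 1, y)].
      by move=> p; rewrite !inE => /orP[/eqP ->|/eqP ->].
    have := ai_deg hm (w := [:: (0, ga_e A i); (t' + 1, y)]) isT he.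
    by rewrite !big_cons big_nil /= (ai_m2 hm) add0r addr0 addrK.
  have cE x1 y1 : map snd u ++ x1 :: y1 :: map snd v
      = map snd (u ++ (t, x1) :: (t', y1) :: v) by rewrite map_cat.
  have hc x1 y1 : bdeg t x1 -> bdeg t' y1 ->
      bar_word (u ++ (t, x1) :: (t', y1) :: v).
    by move=> *; apply: bar_word_cat => //; do 2!apply: bar_word_cons => //.
  rewrite !cE.
  apply: (@barw_morph _ _ id); rewrite ?map_cat ?size_cat //= ?addnS //.
  + exact: hc.
  + exact: hc.
- move=> w w0 hw n a.
  have := bar_relation (w := unshift w).
  rewrite unshift_size unshift_snd => /(_ w0 (unshift_homogeneous hw)) H.
  rewrite -[RHS]H; apply: eq_bigr => r _; apply: eq_bigr => s _.
  congr (_ *: _); rewrite /unshift -map_take big_map /=.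
  (* Passing through degrees in [A] and back adds 2 to the exponent for each letter. *)
  apply: (@sgn_eq _ _ _ (- (size (take r w))%:Z)).
  elim: (take r w) => [|p u IH]; first by rewrite !big_nil.
  rewrite !big_cons /= -[(size u).+1]addn1 PoszD.
  by rewrite opprD addrACA IH; ring.
Qed.
End BarFacts.
End BarConstruction.

(** * Formal sums of words *)

Section LinearFunctions.
Context {k : fieldType} {X Y : lmodType k} (f : X -> Y).
Hypothesis hf : linear f.

Lemma lin0 : f 0 = 0.
Proof. by have := hf (-1) 0 0; rewrite !scaleN1r oppr0 addr0 addNr. Qed.

Lemma linD x y : f (x + y) = f x + f y.
Proof. by rewrite -[x]scale1r hf !scale1r. Qed.

Lemma linZ c x : f (c *: x) = c *: f x.
Proof. by rewrite -[c *: x]addr0 hf lin0 addr0. Qed.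

Lemma linN x : f (- x) = - f x.
Proof. by rewrite -scaleN1r linZ scaleN1r. Qed.

Lemma lin_sum (I : Type) (r : seq I) (Q : pred I) (F : I -> X) :
  f (\sum_(i <- r | Q i) F i) = \sum_(i <- r | Q i) f (F i).
Proof. by elim/big_rec2: _ => [|i y1 y2 _ <-]; rewrite ?lin0 ?linD. Qed.
End LinearFunctions.

Lemma fsum_box (R : nmodType) (T : choiceType) (r : seq T) (f : T -> R) :
  uniq r -> (forall i, i \notin r -> f i = 0) ->
  \sum_(i \in [set: T]) f i = \sum_(i <- r) f i.
Proof.
move=> ur hf; rewrite (@fsbigE _ _ _ _ _ r) //.
  by apply: eq_bigl => i; rewrite in_setT.
by move=> i _; apply: hf.
Qed.

Section Words.
Context {I : finType}.

Fixpoint words (n : nat) : seq (seq I) :=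
  match n with
  | 0 => [:: [::]]
  | n'.+1 => [seq y :: w | y <- enum I, w <- words n']
  end.

Lemma size_words n w : w \in words n -> size w = n.
Proof.
elim: n w => [|n IH] w /=; first by rewrite inE => /eqP ->.
by case/allpairsP => -[y v] /= [_ /IH <- ->].
Qed.

Context {V : nmodType}.

Lemma big_words_S n (h : seq I -> V) :
  \sum_(w <- words n.+1) h w = \sum_y \sum_(w <- words n) h (y :: w).
Proof. by rewrite big_allpairs_dep /= big_enum. Qed.

Lemma big_words_cat m n (h : seq I -> V) :
  \sum_(w <- words (m + n)) h w
    = \sum_(u <- words m) \sum_(v <- words n) h (u ++ v).
Proof.
elim: m h => [|m IH] h; first by rewrite big_seq1.
rewrite addSn !big_words_S; apply: eq_bigr => y _.
by rewrite IH.
Qed.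
End Words.

(** Reindexing by [t = n - r - s]. It turns sums organised by word length, as in the A-infinity
    relations, into products of three geometric series; the vanishing of [h] makes the simplex and
    the cube interchangeable. *)
Lemma big_triple_antidiagonal (V : nmodType) (N : nat) (h : nat -> nat -> nat -> V) :
  (forall r s t, (N <= r + s + t)%N -> h r s t = 0) ->
  \sum_(n < N) \sum_(r < n.+1) \sum_(s < n.+1 | (r + s <= n)%N) h r s (n - r - s)%N
    = \sum_(r < N) \sum_(s < N) \sum_(t < N) h r s t.
Proof.
move=> h0.
have narrow n (g : nat -> V) (Q : pred nat) : (n < N)%N ->
    (forall i, Q i -> (i <= n)%N) ->
    \sum_(i < n.+1 | Q i) g i = \sum_(i < N | Q i) g i.
  move=> nN hQ; rewrite (big_ord_widen_cond N Q g) //.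
  by apply: eq_bigl => i; case: (boolP (Q i)) => //= /hQ; rewrite ltnS => ->.
transitivity (\sum_(n < N) \sum_(r < N) \sum_(s < N)
    if (r + s <= n)%N then h r s (n - r - s)%N else 0).
  apply: eq_bigr => n _.
  transitivity (\sum_(r < N | (r <= n)%N)
      \sum_(s < N) if (r + s <= n)%N then h r s (n - r - s)%N else 0).
    rewrite -(narrow n (fun r => \sum_(s < N)
      if (r + s <= n)%N then h r s (n - r - s)%N else 0) (fun r => r <= n)%N) //.
    rewrite [RHS](eq_bigl xpredT); last by move=> r; rewrite -ltnS ltn_ord.
    apply: eq_bigr => r _; rewrite -big_mkcond /=.
    rewrite -(narrow n (fun s => h r s (n - r - s)%N) (fun s => r + s <= n)%N) //.
    by move=> s; apply: leq_trans; apply: leq_addl.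
  rewrite [LHS]big_mkcond; apply: eq_bigr => r _; case: ifP => // rn.
  rewrite big1 // => s _; rewrite ifF //; apply: contraFF rn.
  exact/leq_trans/leq_addr.
rewrite exchange_big; apply: eq_bigr => r _.
rewrite exchange_big; apply: eq_bigr => s _; rewrite -big_mkcond /=.
have [rsN | Nrs] := leqP (r + s) N; last first.
  rewrite big1 => [|n rsn]; last by case: leqP rsn (ltn_ord n) => //; lia.
  rewrite big1 // => t _; apply: h0.
  exact: leq_trans (ltnW Nrs) (leq_addr _ _).
rewrite -(big_mkord (fun n => r + s <= n)%N
  (fun n => h r s (n - r - s)%N)).
rewrite (@big_cat_nat _ _ _ (r + s)%N) //= big_nat_cond big1 ?add0r; last first.
  by move=> n /andP[/andP[_ nrs]]; rewrite leqNgt nrs.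
rewrite big_nat_cond (eq_bigl (fun n => r + s <= n < N)%N); last first.
  by move=> n; case: (leqP (r + s) n) => //=; rewrite andbT.
rewrite -big_nat -[X in \sum_(X <= _ < _) _]add0n big_addn.
rewrite -(big_mkord xpredT (fun t => h r s t)).
rewrite (@big_cat_nat _ _ _ (N - (r + s))%N 0 N) ?leq_subr //=.
rewrite [X in _ + X]big_nat_cond [X in _ + X]big1 ?addr0; last first.
  by move=> t /andP[/andP[ht _] _]; apply: h0; lia.
by apply: eq_bigr => t _; congr (h _ _ _); lia.
Qed.

(* A formal sum of words with coefficients in X is handled through the values
   sum_i g(w_i) x_i that it takes at scalar-valued functions g of words. *)
Definition formal (k : fieldType) (A : Type) (X : Type) : Type :=
  (seq A -> k) -> X.

Section FormalSums.
Context {k : fieldType} {A : eqType}.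
Local Notation formal := (formal k A).

Definition fone {X : lmodType k} (m : X) : formal X := fun g => g [::] *: m.

(** The operator sum of the [v x (x) f x]: it prefixes a letter to the word and applies a map to the
    coefficient, so the first letter belongs to the map applied last. *)
Definition fcons {I : finType} (v : I -> A) {X Y : lmodType k}
    (f : I -> X -> Y) (S : formal X) : formal Y :=
  fun g => \sum_x f x (S (fun w => g (v x :: w))).

(* The sum of the geometric series of [fcons v f]; the bound K is irrelevant
   as soon as all products of K operators f vanish. *)
Definition fgeom (K : nat) {I : finType} (v : I -> A) {X : lmodType k}
    (f : I -> X -> X) (S : formal X) : formal X :=
  fun g => \sum_(i < K) iter i (fcons v f) S g.

Definition nilpotent {I : Type} {X : lmodType k} (f : I -> X -> X) (K : nat) :=
  forall w m, size w = K -> foldr f m w = 0.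

Section Letters.
Context {I : finType} (v : I -> A).

Section Maps.
Context {X Y : lmodType k} (f : I -> X -> Y).
Hypothesis hf : forall x, linear (f x).

Lemma fconsD (S S' : formal X) g :
  fcons v f (fun g => S g + S' g) g = fcons v f S g + fcons v f S' g.
Proof. by rewrite /fcons -big_split; apply: eq_bigr => x _; rewrite linD. Qed.

Lemma fconsN (S : formal X) g : fcons v f (fun g => - S g) g = - fcons v f S g.
Proof. by rewrite /fcons -sumrN; apply: eq_bigr => x _; rewrite linN. Qed.

Lemma fcons0 g : fcons v f (fun=> 0) g = 0.
Proof. by rewrite /fcons big1 // => x _; rewrite lin0. Qed.

Lemma fcons_sum (J : Type) (r : seq J) (Q : pred J) (S : J -> formal X) g :
  fcons v f (fun g => \sum_(j <- r | Q j) S j g) g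
    = \sum_(j <- r | Q j) fcons v f (S j) g.
Proof.
rewrite /fcons exchange_big; apply: eq_bigr => x _.
by rewrite lin_sum.
Qed.
End Maps.

Lemma fcons_addl {X Y : lmodType k} (f f' : I -> X -> Y) (S : formal X) g :
  fcons v (fun x m => f x m + f' x m) S g = fcons v f S g + fcons v f' S g.
Proof. by rewrite /fcons -big_split. Qed.

Lemma fcons_oppl {X Y : lmodType k} (f : I -> X -> Y) (S : formal X) g :
  fcons v (fun x m => - f x m) S g = - fcons v f S g.
Proof. by rewrite /fcons -sumrN. Qed.

Section Endo.
Context {X : lmodType k} (f : I -> X -> X).
Hypothesis hf : forall x, linear (f x).

Lemma foldr_linear w : linear (fun m => foldr f m w).
Proof. by elim: w => [|x w IH] //= c m m'; rewrite IH hf. Qed.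

Lemma fcons_iterE n (S : formal X) g :
  iter n (fcons v f) S g
    = \sum_(w <- words n) foldr f (S (fun z => g (map v w ++ z))) w.
Proof.
elim: n g => [|n IH] g; first by rewrite big_seq1.
rewrite big_words_S /= /fcons; apply: eq_bigr => x _.
by rewrite IH lin_sum.
Qed.

Lemma nilpotent_le K n : nilpotent f K -> (K <= n)%N -> nilpotent f n.
Proof.
move=> hK Kn w m sw; rewrite -(cat_take_drop K w) foldr_cat hK //.
by rewrite size_take sw; case: ltngtP Kn.
Qed.

Lemma fcons_iter_nil K (S : formal X) g : nilpotent f K ->
  iter K (fcons v f) S g = 0.
Proof.
move=> hK; rewrite fcons_iterE big_seq big1 // => w /size_words sw.
exact: hK.
Qed.

Context (K : nat).
Hypothesis hK : nilpotent f K.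

Lemma fgeom_fix (S : formal X) :
  fgeom K v f S = fun g => S g + fcons v f (fgeom K v f S) g.
Proof.
apply: funext => g; rewrite /fgeom fcons_sum //.
transitivity (\sum_(i < K.+1) iter i (fcons v f) S g).
  by rewrite big_ord_recr /= fcons_iter_nil ?addr0.
by rewrite big_ord_recl.
Qed.

(** The difference of two solutions is fixed by [fcons v f], which is nilpotent. Geometric series
    are identified below through their equation rather than by manipulating sums. *)
Lemma fgeom_unique (S Z : formal X) :
  (forall g, Z g = S g + fcons v f Z g) -> Z = fgeom K v f S.
Proof.
move=> hZ; pose D : formal X := fun g => Z g - fgeom K v f S g.
have D1 : fcons v f D = D.
  apply: funext => g; rewrite /D (fconsD hf Z (fun g => - _)) (fconsN hf).
  rewrite [in RHS]hZ [in RHS]fgeom_fix opprD addrACA subrr add0r.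
  by [].
have Dn n : iter n (fcons v f) D = D by elim: n => //= n ->.
apply: funext => g; apply/subr0_eq.
by rewrite -/(D g) -(Dn K) fcons_iter_nil.
Qed.

Lemma fgeomD (S S' : formal X) :
  fgeom K v f (fun g => S g + S' g)
    = fun g => fgeom K v f S g + fgeom K v f S' g.
Proof.
apply/esym/fgeom_unique => g.
rewrite [in LHS](fgeom_fix S) [in LHS](fgeom_fix S') addrACA; congr (_ + _).
by rewrite -fconsD.
Qed.

Lemma fgeomN (S : formal X) :
  fgeom K v f (fun g => - S g) = fun g => - fgeom K v f S g.
Proof.
apply/esym/fgeom_unique => g.
by rewrite [in LHS](fgeom_fix S) opprD -fconsN.
Qed.

Lemma fgeom0 : fgeom K v f (fun=> 0) = fun=> 0.
Proof. by apply/esym/fgeom_unique => g; rewrite fcons0 // addr0. Qed.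

End Endo.
End Letters.

Lemma fcons_sumtype {I J : finType} (v : I -> A) (v' : J -> A)
    {X Y : lmodType k} (f : I + J -> X -> Y) (S : formal X) g :
  fcons (fun y => match y with inl i => v i | inr j => v' j end) f S g
    = fcons v (fun i => f (inl i)) S g + fcons v' (fun j => f (inr j)) S g.
Proof. by rewrite /fcons big_sumType. Qed.

Section Support.
Context {X : lmodType k}.
Implicit Types (Q : X -> seq (int * A) -> Prop).

(* S is a sum of words with coefficients, where the words carry degrees and
   each pair of a coefficient and a word satisfies Q. *)
Definition formal_in Q (S : formal X) : Prop :=
  exists s : seq (X * seq (int * A)),
    (forall p, p \in s -> Q p.1 p.2) /\
    forall g, S g = \sum_(p <- s) g (map snd p.2) *: p.1.

Lemma formal_in_eq0 Q (S : formal X) g : formal_in Q S ->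
  (forall n w, Q n w -> g (map snd w) = 0) -> S g = 0.
Proof.
move=> [s [hs SE]] g0; rewrite SE big_seq big1 // => p /hs /g0 ->.
by rewrite scale0r.
Qed.

Lemma formal_in_fone Q (m : X) : Q m [::] -> formal_in Q (fone m).
Proof.
move=> h; exists [:: (m, [::])]; split=> [p|g]; last by rewrite big_seq1.
by rewrite inE => /eqP ->.
Qed.

Lemma formal_in0 Q : formal_in Q (fun=> 0).
Proof. by exists [::]; split=> // g; rewrite big_nil. Qed.

Lemma formal_inD Q (S S' : formal X) :
  formal_in Q S -> formal_in Q S' -> formal_in Q (fun g => S g + S' g).
Proof.
move=> [s [hs SE]] [s' [hs' SE']]; exists (s ++ s'); split=> [p|g].
  by rewrite mem_cat => /orP[/hs|/hs'].
by rewrite big_cat /= -SE -SE'.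
Qed.

Lemma formal_in_sum Q (J : Type) (r : seq J) (S : J -> formal X) :
  (forall j, formal_in Q (S j)) -> formal_in Q (fun g => \sum_(j <- r) S j g).
Proof.
move=> h; elim: r => [|j r IH].
  rewrite (_ : (fun g => _) = fun=> 0); first exact: formal_in0.
  by apply: funext => g; rewrite big_nil.
rewrite (_ : (fun g => _) = fun g => S j g + \sum_(i <- r) S i g).
  exact: formal_inD.
by apply: funext => g; rewrite big_cons.
Qed.
End Support.

Lemma formal_in_fcons {I : finType} (v : I -> A) (dg : I -> int)
    {X Y : lmodType k} (f : I -> X -> Y) (S : formal X) Q Q' :
  (forall x, linear (f x)) ->
  (forall x n w, Q n w -> f x n <> 0 -> Q' (f x n) ((dg x, v x) :: w)) ->
  formal_in Q S -> formal_in Q' (fcons v f S).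
Proof.
move=> hf QQ' [s [hs SE]].
pose s' := [seq (f x p.1, (dg x, v x) :: p.2) | x <- enum I, p <- s].
(* Terms with coefficient zero are dropped, since [Q'] is known only where [f x n <> 0]. *)
exists [seq p <- s' | p.1 != 0]; split=> [p|g].
  rewrite mem_filter => /andP[p0 /allpairsP[[x q] /= [hx hq pE]]].
  by move: p0; rewrite pE /= => /eqP p0; apply: QQ' => //; apply: hs.
rewrite big_filter big_mkcond big_allpairs_dep /= big_enum /fcons.
apply: eq_bigr => x _; rewrite SE lin_sum //.
apply: eq_bigr => p _; rewrite linZ //.
by case: eqP => //= ->; rewrite scaler0.
Qed.

Lemma formal_in_fgeom {I : finType} (v : I -> A) (dg : I -> int)
    {X : lmodType k} (f : I -> X -> X) K (S : formal X) Q :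
  (forall x, linear (f x)) ->
  (forall x n w, Q n w -> f x n <> 0 -> Q (f x n) ((dg x, v x) :: w)) ->
  formal_in Q S -> formal_in Q (fgeom K v f S).
Proof.
move=> hf hQ hS; rewrite /fgeom.
apply: (@formal_in_sum _ Q _ _ (fun i : 'I_K => iter i (fcons v f) S)) => i.
by elim: (i : nat) => //= n; apply: (formal_in_fcons hf hQ).
Qed.

Lemma fone_linear {X : lmodType k} g : linear (fun m : X => fone m g).
Proof.
by move=> c m m'; rewrite /fone scalerDr !scalerA; congr (_ *: _ + _); rewrite mulrC.
Qed.

Lemma fcons_linear {I : finType} (v : I -> A) {X Y Z : lmodType k}
    (f : I -> Y -> Z) (S : X -> formal Y) : (forall x, linear (f x)) ->
  (forall g, linear (fun m => S m g)) ->
  forall g, linear (fun m => fcons v f (S m) g).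
Proof.
move=> hf hS g c m m'; rewrite /fcons scaler_sumr -big_split.
by apply: eq_bigr => x _; rewrite hS hf.
Qed.

Lemma fgeom_linear {I : finType} (v : I -> A) {X Y : lmodType k}
    (f : I -> Y -> Y) K (S : X -> formal Y) : (forall x, linear (f x)) ->
  (forall g, linear (fun m => S m g)) ->
  forall g, linear (fun m => fgeom K v f (S m) g).
Proof.
move=> hf hS g c m m'; rewrite /fgeom scaler_sumr -big_split.
have H n g' : linear (fun m => iter n (fcons v f) (S m) g').
  by elim: n g' => //= n IH; apply: fcons_linear.
by apply: eq_bigr => i _; rewrite H.
Qed.
End FormalSums.

(** * A-infinity relations for operators *)

Section BarOperators.
Context {k : fieldType} {P : finType} {A : graded_algebra k P}.
Context {b : seq A -> A} {BB : bar_basis A} {rk : P -> nat}.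
Hypothesis G : bar_facts b BB rk.

(* The value of b at the empty word is irrelevant in the definitions; it is
   replaced by 0 here. *)
Definition gcoord t (y : idx BB t) (w : seq A) : k :=
  if w is [::] then 0 else bcoord y (b w).

Lemma b_zero_letter (u z : seq A) : b (u ++ 0 :: z) = 0.
Proof.
by have := multilinear_scale u z 0 0 (bf_lin G); rewrite !scale0r.
Qed.

Lemma gcoord_span t t0 (x : idx BB t) (u z : seq A) a : bdeg t0 a ->
  bcoord x (b (u ++ a :: z))
    = \sum_(y : idx BB t0) bcoord y a * gcoord x (u ++ bvec y :: z).
Proof.
move=> da; rewrite [in LHS](@bvec_span _ _ _ BB _ _ da).
have gE c : gcoord x (u ++ c :: z) = bcoord x (b (u ++ c :: z)) by case: (u).
under [RHS]eq_bigr do rewrite gE.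
elim/big_rec2: _ => [|y s c _ IH]; first by rewrite b_zero_letter bcoord0.
by rewrite (bf_lin G) bcoord_lin IH.
Qed.

Section Space.
Context {I : finType} (v : I -> A) (dg : I -> int).
Hypothesis hv : forall y, bdeg (dg y) (v y).
Hypothesis dg_le0 : forall y, dg y <= 0.
Context {U : lmodType k} (F : I -> U -> U).
Hypothesis hF : forall y, linear (F y).
Context (N : nat).
Hypothesis hN : nilpotent F N.

(** The coordinate along [y] of the sum of all [b_n] on words of letters, the letters acting on [m]
    at the same time. For a chain of twisted objects it contains the Maurer-Cartan expressions,
    [b_1^tw] and [b_2^tw] as matrix entries. *)
Definition mu_op t (y : idx BB t) (m : U) : U := fgeom N v F (fone m) (gcoord y).

(** The sign that a letter acquires when an operation of degree 1 is moved past it. *)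
Definition signed_op (y : I) (m : U) : U := (-1 : k) ^ (dg y) *: F y m.

Definition word_sign (w : seq I) : k := (-1) ^ (\sum_(y <- w) dg y).

Lemma foldr_signed w m : foldr signed_op m w = word_sign w *: foldr F m w.
Proof.
elim: w => [|y w IH] /=; first by rewrite /word_sign big_nil scale1r.
by rewrite IH /signed_op linZ // scalerA /word_sign big_cons sgnD.
Qed.

Lemma signed_linear y : linear (signed_op y).
Proof.
move=> c m m'; rewrite /signed_op hF scalerDr !scalerA; congr (_ *: _ + _).
by rewrite mulrC.
Qed.

Definition short_words : seq (seq I) := flatten [seq words n | n <- iota 0 N].

Lemma big_short_words (V : nmodType) (h : seq I -> V) :
  \sum_(w <- short_words) h w = \sum_(n < N) \sum_(w <- words n) h w.
Proof.
rewrite /short_words big_flatten big_map.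
by rewrite -(big_mkord xpredT (fun n => \sum_(w <- words n) h w)) /index_iota subn0.
Qed.

Lemma fgeom_words (f : I -> U -> U) (S : formal k A U) g :
  (forall y, linear (f y)) -> fgeom N v f S g
  = \sum_(w <- short_words) foldr f (S (fun z => g (map v w ++ z))) w.
Proof.
move=> hf; rewrite big_short_words; apply: eq_bigr => n _.
by rewrite fcons_iterE.
Qed.

Lemma fgeom_fone_words g m : fgeom N v F (fone m) g
  = \sum_(w <- short_words) g (map v w) *: foldr F m w.
Proof.
rewrite fgeom_words //; apply: eq_bigr => w _.
by rewrite /fone cats0 (linZ (foldr_linear hF w)).
Qed.

Lemma triple_expansion t g m :
  fgeom N v signed_op (fcons (@bvec _ _ _ BB t) (@mu_op t)
    (fgeom N v F (fone m))) g
  = \sum_(u <- short_words) \sum_(w <- short_words) \sum_(z <- short_words)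
      (word_sign u * \sum_(y : idx BB t)
        gcoord y (map v w) * g (map v u ++ bvec y :: map v z))
        *: foldr F m (u ++ w ++ z).
Proof.
have lF w := foldr_linear hF w.
rewrite fgeom_words; last exact: signed_linear.
apply: eq_bigr => u _; rewrite foldr_signed /fcons (lin_sum (lF u)).
rewrite (eq_bigr (fun y : idx BB t => \sum_(w <- short_words)
  \sum_(z <- short_words) (gcoord y (map v w)
    * g (map v u ++ bvec y :: map v z)) *: foldr F m (u ++ w ++ z))); last first.
  move=> y _; rewrite /mu_op !fgeom_fone_words (lin_sum (lF u)).
  apply: eq_bigr => w _.
  rewrite (linZ (lF u)) (lin_sum (lF w)) (lin_sum (lF u)) scaler_sumr.
  apply: eq_bigr => z _.
  by rewrite (linZ (lF w)) (linZ (lF u)) scalerA !foldr_cat.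
rewrite exchange_big scaler_sumr; apply: eq_bigr => w _.
rewrite exchange_big scaler_sumr; apply: eq_bigr => z _.
by rewrite -scaler_suml scalerA.
Qed.

Definition deg_word (w : seq I) : seq (int * A) := [seq (dg y, v y) | y <- w].

Lemma deg_word_bar w : bar_word (deg_word w).
Proof. by move=> p /mapP[y _ ->]; apply: hv. Qed.

Lemma deg_word_snd w : map snd (deg_word w) = map v w.
Proof. by rewrite -map_comp. Qed.

Lemma deg_word_sum w : \sum_(p <- deg_word w) p.1 = \sum_(y <- w) dg y.
Proof. by rewrite big_map. Qed.

Lemma deg_word_size w : size (deg_word w) = size w.
Proof. by rewrite size_map. Qed.

(** A term of the A-infinity relation; the empty middle word is excluded, as [0 < s] in
    [stasheff]. *)
Definition bar_split t (x : idx BB t) (u w z : seq I) : k :=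
  if w is [::] then 0
  else word_sign u * bcoord x (b (map v u ++ b (map v w) :: map v z)).

Lemma b_deg_word w : (0 < size w)%N ->
  bdeg (\sum_(y <- w) dg y + 1) (b (map v w)).
Proof.
move=> w0; rewrite -deg_word_sum -deg_word_snd; apply: (bf_deg G).
  by rewrite deg_word_size.
exact: deg_word_bar.
Qed.

(** Letters have degree at most 0, so the inner value has degree at most 1, and B vanishes below
    degree -1: three degrees remain. *)
Lemma bar_split_expand t (x : idx BB t) u w z :
  bar_split x u w z = word_sign u * (
    \sum_(y : idx BB (-1)) gcoord y (map v w) * gcoord x (map v u ++ bvec y :: map v z)
  + \sum_(y : idx BB 0) gcoord y (map v w) * gcoord x (map v u ++ bvec y :: map v z)
  + \sum_(y : idx BB 1) gcoord y (map v w) * gcoord x (map v u ++ bvec y :: map v z)).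
Proof.
case: w => [|y0 w] /=.
  by rewrite !big1 ?addr0 ?mulr0 // => y _; rewrite mul0r.
congr (_ * _).
have dw : bdeg (\sum_(y <- y0 :: w) dg y + 1) (b (map v (y0 :: w))).
  exact: b_deg_word.
have dle : \sum_(y <- y0 :: w) dg y + 1 <= 1.
  suff : \sum_(y <- y0 :: w) dg y <= 0 by lia.
  elim/big_rec: _ => // y s _ h; have := dg_le0 y; lia.
rewrite (gcoord_span _ _ _ dw) /=.
have hz (t' : int) : t' <> \sum_(y <- y0 :: w) dg y + 1 ->
   \sum_(y : idx BB t') bcoord y (b (v y0 :: [seq v i | i <- w])) *
     gcoord x ([seq v i | i <- u] ++ bvec y :: [seq v i | i <- z]) = 0.
  move=> ne; rewrite big1 // => y _; by rewrite (bcoord_deg y ne dw) mul0r.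
move: hz dle; clear dw; set d := (\sum_(y <- y0 :: w) dg y + 1).
clearbody d => hz dle.
have : d = 1 \/ d = 0 \/ d = -1 \/ d < -1 by lia.
case=> [dE|[dE|[dE|dlt]]]; try subst d.
- by rewrite (hz (-1)) // (hz 0) // !add0r.
- by rewrite (hz (-1)) // (hz 1) // add0r addr0.
- by rewrite (hz 0) // (hz 1) // !addr0.
- rewrite (hz 0) ?(hz 1) ?(hz (-1)) ?addr0; try by lia.
  by rewrite big1 // => y; case: (bf_low G dlt y).
Qed.

(** Regrouped by the word [u ++ w ++ z], the coefficients add up to the A-infinity relation on that
    word. *)
Lemma bar_split_sum t (x : idx BB t) m :
  \sum_(u <- short_words) \sum_(w <- short_words) \sum_(z <- short_words)
    bar_split x u w z *: foldr F m (u ++ w ++ z) = 0.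
Proof.
transitivity (\sum_(r < N) \sum_(s < N) \sum_(q < N)
   \sum_(u <- words r) \sum_(w <- words s) \sum_(z <- words q)
    bar_split x u w z *: foldr F m (u ++ w ++ z)).
  rewrite big_short_words; apply: eq_bigr => r _.
  rewrite (eq_bigr (fun u => \sum_(s < N) \sum_(q < N) \sum_(w <- words s)
     \sum_(z <- words q) bar_split x u w z *: foldr F m (u ++ w ++ z))).
    rewrite [LHS]exchange_big /=; apply: eq_bigr => s _; exact: exchange_big.
  move=> u _; rewrite big_short_words; apply: eq_bigr => s _.
  rewrite [RHS]exchange_big /=; apply: eq_bigr => w _; exact: big_short_words.
pose h r s q := \sum_(u <- words r) \sum_(w <- words s) \sum_(z <- words q)
    bar_split x u w z *: foldr F m (u ++ w ++ z).
rewrite -(@big_triple_antidiagonal _ N h); last first.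
  move=> r s q Nrsq; rewrite /h big_seq big1 // => u /size_words su.
  rewrite big_seq big1 // => w /size_words sw.
  rewrite big_seq big1 // => z /size_words sz.
  rewrite (nilpotent_le hN (n := (r + s + q)%N)) ?scaler0 //.
  by rewrite !size_cat su sw sz addnA.
rewrite big1 // => n _.
rewrite (eq_bigr (fun r : 'I_n.+1 => \sum_(s < n.+1 | (r + s <= n)%N)
   \sum_(w <- words n) bar_split x (take r w) (take s (drop r w)) (drop (r + s) w)
      *: foldr F m w)); last first.
  move=> r _; apply: eq_bigr => s; rewrite /h.
  move: (nat_of_ord n) (nat_of_ord r) (nat_of_ord s) => {r s}n r s rs.
  have nE : n = (r + (s + (n - r - s)))%N by lia.
  rewrite {2}nE big_words_cat big_seq [RHS]big_seq.
  apply: eq_bigr => u /size_words su.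
  rewrite big_words_cat big_seq [RHS]big_seq.
  apply: eq_bigr => w /size_words sw; apply: eq_bigr => z _.
  rewrite (take_size_cat _ su) (drop_size_cat _ su) (take_size_cat _ sw).
  by rewrite addnC -drop_drop (drop_size_cat _ su) (drop_size_cat _ sw).
rewrite (eq_bigr (fun r : 'I_n.+1 => \sum_(w <- words n) \sum_(s < n.+1 | (r + s <= n)%N)
   bar_split x (take r w) (take s (drop r w)) (drop (r + s) w)
      *: foldr F m w)); last by move=> r _; rewrite exchange_big.
rewrite exchange_big big_seq big1 // => w /size_words sw.
rewrite (eq_bigr (fun r : 'I_n.+1 => (\sum_(s < n.+1 | (r + s <= n)%N)
   bar_split x (take r w) (take s (drop r w)) (drop (r + s) w))
      *: foldr F m w)); last by move=> r _; rewrite scaler_suml.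
rewrite -scaler_suml.
move: (nat_of_ord n) sw => {}n; case: n => [|n] sw.
  rewrite big1 ?scale0r // => r _; rewrite big1 // => s _.
  by case: w sw => // _; rewrite /bar_split /= .
have w0 : (0 < size (deg_word w))%N by rewrite deg_word_size sw.
have := bf_bar G w0 (deg_word_bar (w := w)).
rewrite deg_word_size deg_word_snd sw /= => /(congr1 (bcoord x)).
rewrite bcoord0 bcoord_sum => H.
suff -> : \sum_(r < n.+2) \sum_(s < n.+2 | (r + s <= n.+1)%N)
   bar_split x (take r w) (take s (drop r w)) (drop (r + s) w) = 0.
  by rewrite scale0r.
rewrite -[RHS]H; apply: eq_bigr => r _; rewrite bcoord_sum.
rewrite (bigID (fun s : 'I_n.+2 => (0 < s)%N)) /= addrC big1 ?add0r.
  rewrite (eq_bigl (fun s : 'I_n.+2 => (0 < s)%N && (r + s <= n.+1)%N));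
    last by move=> s; rewrite andbC.
  apply: eq_bigr => s /andP[s0 rs]; rewrite bcoordZ.
  have := size_takel (s := drop r w) (n0 := s).
  rewrite size_drop sw => /(_ _) sE.
  have {}sE : size (take s (drop r w)) = s by apply: sE; lia.
  rewrite /bar_split -!map_drop -!map_take.
  case: (take s (drop r w)) sE s0 => [<-|y w' _ _] //.
  by rewrite /word_sign big_map.
move=> s /andP[_]; rewrite -leqNgt leqn0 => /eqP ->.
by rewrite take0.
Qed.

(** The relation splits according to the degree of the inner value; the two hypotheses leave the
    part of degree -1. *)
Lemma Ainf_operators t (x : idx BB t) m :
  (forall (y : idx BB 0) n, mu_op y n = 0) ->
  (forall (y : idx BB 1) n, mu_op y n = 0) ->
  fgeom N v signed_op (fcons (@bvec _ _ _ BB (-1)) (@mu_op (-1))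
    (fgeom N v F (fone m))) (gcoord x) = 0.
Proof.
move=> mu0 mu1.
pose Z (t' : int) := fgeom N v signed_op (fcons (@bvec _ _ _ BB t') (@mu_op t')
    (fgeom N v F (fone m))) (gcoord x).
have zero t' : (forall (y : idx BB t') n, mu_op y n = 0) -> Z t' = 0.
  move=> mut; rewrite /Z (_ : fcons _ _ _ = fun=> 0).
    rewrite fgeom_words; last exact: signed_linear.
    by rewrite big1 // => u _; rewrite (lin0 (foldr_linear signed_linear u)).
  by apply: funext => g; rewrite /fcons big1.
transitivity (Z (-1) + Z 0 + Z 1); first by rewrite (zero _ mu0) (zero _ mu1) !addr0.
rewrite -[RHS](bar_split_sum x m) /Z !triple_expansion -!big_split.
apply: eq_bigr => u _ /=.
rewrite -!big_split; apply: eq_bigr => w _ /=.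
rewrite -!big_split; apply: eq_bigr => z _ /=.
by rewrite bar_split_expand !mulrDr !scalerDl.
Qed.
End Space.
End BarOperators.

Lemma fcons_proj (k : fieldType) (A : eqType) (I : finType) (v : I -> A)
    (X Y X' Y' : lmodType k) (F : I -> X -> Y) (f : I -> X' -> Y')
    (p : Y -> Y') (q : X -> X') (S : formal k A X) g :
  linear p -> (forall x u, p (F x u) = f x (q u)) ->
  p (fcons v F S g) = fcons v f (fun g => q (S g)) g.
Proof. by move=> hp hpq; rewrite /fcons lin_sum //; apply: eq_bigr. Qed.

Lemma fcons_iter_sum (k : fieldType) (A : eqType) (I : finType) (v : I -> A)
    (X : lmodType k) (f : I -> X -> X) (J : Type) (r : seq J)
    (S : J -> formal k A X) n g : (forall x, linear (f x)) ->
  iter n (fcons v f) (fun g => \sum_(j <- r) S j g) g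
    = \sum_(j <- r) iter n (fcons v f) (S j) g.
Proof.
move=> hf; elim: n g => // n IH g.
rewrite [in LHS]iterS (_ : iter n _ _ = fun g => \sum_(j <- r) iter n (fcons v f) (S j) g).
  by rewrite fcons_sum.
exact: funext.
Qed.

Lemma fcons_iter0 (k : fieldType) (A : eqType) (I : finType) (v : I -> A)
    (X : lmodType k) (f : I -> X -> X) n : (forall x, linear (f x)) ->
  iter n (fcons v f) (fun _ : seq A -> k => 0 : X) = fun=> 0.
Proof.
by move=> hf; elim: n => //= n ->; apply: funext => g; apply: fcons0.
Qed.

(** * Twisted objects *)

Section TwistedOperations.
Context {k : fieldType} {P : finType} {A : graded_algebra k P}.
Context {b : seq A -> A} {BB : bar_basis A}.
Implicit Types X Y Z : smodule k P.
Local Notation bv := (@bvec _ _ _ BB _).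
Local Notation bad c t y m := (@b_ad _ _ _ b BB _ _ c t y m).

Definition ev X Y (c : adtensor BB X Y) (m : X) : formal k A Y :=
  fun g => \sum_(p <- expand c) g p.2 *: p.1 m.

Lemma ev_nil X (m : X) : ev (AdNil BB X) m = fone m.
Proof. by apply: funext => g; rewrite /ev big_seq1. Qed.

Lemma ev_cons X Y Z t (f : ad BB Y Z t) (c : adtensor BB X Y) m :
  (forall x, linear (f x)) -> ev (AdCons f c) m = fcons bv f (ev c m).
Proof.
move=> hf; apply: funext => g; rewrite /ev /fcons /= big_allpairs_dep /= big_enum /=.
by apply: eq_bigr => x _; rewrite lin_sum //; apply: eq_bigr => p _; rewrite linZ.
Qed.

Lemma ev_pow X Y (d : ad BB Y Y 0) n (c : adtensor BB X Y) m :
  (forall x, linear (d x)) -> ev (pow_l d n c) m = iter n (fcons bv d) (ev c m).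
Proof. by move=> hd; elim: n => //= n <-; rewrite ev_cons. Qed.

(** All words here contain the letter of [f], so the value at the empty word does not matter. *)
Lemma iter_gcoord X Y (d : ad BB Y Y 0) n t (f : ad BB X Y t) (S : formal k A X)
    t' (y : idx BB t') :
  iter n (fcons bv d) (fcons bv f S) (fun w => bcoord y (b w))
    = iter n (fcons bv d) (fcons bv f S) (gcoord (b := b) y).
Proof. by case: n. Qed.

Lemma nilpotent_of_filtration X (d : ad BB X X 0) :
  in_ad d -> finite_filtration d -> exists K, nilpotent d K.
Proof.
move=> hd [l [F [hF F0 Fl _ FS]]]; exists l => w m sw.
suff H u : (size u <= l)%N -> F (l - size u)%N (foldr d m u).
  by have := H w; rewrite sw subnn F0; apply.
elim: u => [|x u IH] /= su; first by rewrite subn0 Fl.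
apply: FS; first by lia.
by have := IH (ltnW su); congr F; lia.
Qed.

Lemma tw_delta_linear (X : tw_object b BB) x : linear (tw_delta X x).
Proof. by have [] := tw_in X x. Qed.

Lemma tw_nilpotent (X : tw_object b BB) : exists K, nilpotent (tw_delta X) K.
Proof. exact: (nilpotent_of_filtration (tw_in X) (tw_filtration X)). Qed.

Section Sums.
Context (K : nat).

Lemma iter_delta_ge (Z : tw_object b BB) (S : formal k A Z) n :
  nilpotent (tw_delta Z) K -> (K <= n)%N ->
  iter n (fcons bv (tw_delta Z)) S = fun=> 0.
Proof.
move=> hZ Kn; apply: funext => g; apply: fcons_iter_nil.
  exact: tw_delta_linear.
exact: nilpotent_le Kn.
Qed.

Lemma mc_geom X (d : ad BB X X 0) (y : idx BB 1) (m : X) :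
  (forall x, linear (d x)) -> nilpotent d K ->
  \sum_(s \in [set s : nat | (0 < s)%N])
    bad (pow_l d s (AdNil BB X)) 1 y m
  = fgeom K bv d (fone m) (gcoord (b := b) y).
Proof.
move=> hd hX.
have sE s : bad (pow_l d s (AdNil BB X)) 1 y m
    = iter s (fcons bv d) (fone m) (fun w => bcoord y (b w)).
  by rewrite -(ev_nil m) -ev_pow.
rewrite (@fsbigE _ _ _ _ _ (iota 1 K)) ?iota_uniq //; last 2 first.
- by move=> s /=; rewrite mem_iota => /andP[].
- move=> s /= s0; rewrite mem_iota s0 /= add1n ltnS -ltnNge => Ks.
  rewrite sE fcons_iter_nil //; exact: nilpotent_le (ltnW Ks).
rewrite big_seq_cond (eq_bigl (fun s => s \in iota 1 K)); last first.
  move=> s; rewrite mem_iota; case: ltnP => //= s0; rewrite ?andbF //.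
  by rewrite mem_set ?andbT.
rewrite -big_seq (eq_bigr _ (fun s _ => sE s)) -[X in iota 1 X]subn0 -(subSS 0 K) -/(index_iota 1 K.+1).
rewrite big_add1 /= big_mkord.
(* The range 1..K may be extended by 0, where [gcoord] is zero, and shortened by K, where nilpotency
   applies. *)
transitivity (\sum_(i < K.+1) iter i (fcons bv d) (fone m) (gcoord (b := b) y)).
  rewrite big_ord_recl /= /fone /= scale0r add0r.
  by apply: eq_bigr => -[[|s] hs] _.
by rewrite big_ord_recr /= fcons_iter_nil ?addr0.
Qed.

Lemma tw_mc_geom (X : tw_object b BB) (y : idx BB 1) (m : X) :
  nilpotent (tw_delta X) K ->
  fgeom K bv (tw_delta X) (fone m) (gcoord (b := b) y) = 0.
Proof. by move=> hX; rewrite -mc_geom ?tw_mc //; apply: tw_delta_linear. Qed.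

Lemma b1_twE (X Y : tw_object b BB) t (f : ad BB X Y t) y m :
  nilpotent (tw_delta X) K -> nilpotent (tw_delta Y) K ->
  (forall x, linear (f x)) ->
  b1_tw f y m = fgeom K bv (tw_delta Y)
    (fcons bv f (fgeom K bv (tw_delta X) (fone m))) (gcoord (b := b) y).
Proof.
move=> hX hY hf; have lX := @tw_delta_linear X; have lY := @tw_delta_linear Y.
rewrite /b1_tw.
have sE i : bad (pow_l (tw_delta Y) i.2
           (AdCons f (pow_l (tw_delta X) i.1 (AdNil BB X)))) (t + 1) y m
    = iter i.2 (fcons bv (tw_delta Y)) (fcons bv f
        (iter i.1 (fcons bv (tw_delta X)) (fone m))) (gcoord (b := b) y).
  rewrite -iter_gcoord -(ev_nil m) -(ev_pow i.1) // -ev_cons //.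
  by rewrite -ev_pow.
(* Outside the box of side [K], one of the two powers of the structure maps vanishes. *)
rewrite (fsum_box (r := [seq (i, j) | i <- iota 0 K, j <- iota 0 K])); last 2 first.
- by apply: allpairs_uniq; rewrite ?iota_uniq // => -[? ?] [? ?].
- move=> [i j] hij; rewrite sE /=.
  case: (ltnP j K) => hj; last by rewrite iter_delta_ge.
  case: (ltnP i K) => hi; last first.
    rewrite (@iter_delta_ge X) // (_ : fcons bv f _ = fun=> 0).
      by rewrite fcons_iter0.
    by apply: funext => g; apply: fcons0.
  by case/negP: hij; apply/allpairsP; exists (i, j); rewrite !mem_iota.
rewrite big_allpairs_dep /= exchange_big /=.
have iotaE (V : nmodType) (h : nat -> V) : \sum_(i <- iota 0 K) h i = \sum_(i < K) h i.
  by rewrite -(big_mkord xpredT h) /index_iota subn0.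
rewrite iotaE; apply: eq_bigr => j _; rewrite iotaE.
rewrite (_ : fcons bv f _ = fun g => \sum_(i < K) fcons bv f
   (iter i (fcons bv (tw_delta X)) (fone m)) g); last first.
  by apply: funext => g; rewrite /fgeom fcons_sum.
by rewrite fcons_iter_sum //; apply: eq_bigr => i _; exact: (sE (i : nat, j : nat)).
Qed.

Lemma b2_twE (X0 X1 X2 : tw_object b BB) (f2 : ad BB X1 X2 (-1))
    (f1 : ad BB X0 X1 (-1)) y m :
  nilpotent (tw_delta X0) K -> nilpotent (tw_delta X1) K ->
  nilpotent (tw_delta X2) K ->
  (forall x, linear (f1 x)) -> (forall x, linear (f2 x)) ->
  b2_tw f2 f1 y m = fgeom K bv (tw_delta X2) (fcons bv f2
    (fgeom K bv (tw_delta X1) (fcons bv f1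
      (fgeom K bv (tw_delta X0) (fone m))))) (gcoord (b := b) y).
Proof.
move=> h0 h1 h2 hf1 hf2; have lX := @tw_delta_linear.
rewrite /b2_tw.
have sE i : bad (pow_l (tw_delta X2) i.2 (AdCons f2 (pow_l (tw_delta X1) i.1.2
           (AdCons f1 (pow_l (tw_delta X0) i.1.1 (AdNil BB X0)))))) (-1) y m
    = iter i.2 (fcons bv (tw_delta X2)) (fcons bv f2
       (iter i.1.2 (fcons bv (tw_delta X1)) (fcons bv f1
        (iter i.1.1 (fcons bv (tw_delta X0)) (fone m))))) (gcoord (b := b) y).
  rewrite -iter_gcoord -(ev_nil m) -(ev_pow i.1.1) // -ev_cons //.
  by rewrite -(ev_pow i.1.2) // -ev_cons // -ev_pow.
pose r := [seq (i, j) | i <- iota 0 K, j <- iota 0 K].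
have rU : uniq r by apply: allpairs_uniq; rewrite ?iota_uniq // => -[? ?] [? ?].
rewrite (fsum_box (r := [seq (i, j) | i <- r, j <- iota 0 K])); last 2 first.
- by apply: allpairs_uniq; rewrite ?iota_uniq // => -[? ?] [? ?].
- move=> [[i j] l] hij; rewrite sE /=.
  have iter0 (X Y : tw_object b BB) (f : ad BB X Y (-1)) n (S : formal k A X) :
      (forall x, linear (f x)) -> S = (fun=> 0) ->
      iter n (fcons bv (tw_delta Y)) (fcons bv f S) = fun=> 0.
    move=> hf ->; rewrite (_ : fcons bv f _ = fun=> 0) ?fcons_iter0 //.
    by apply: funext => g; apply: fcons0.
  case: (ltnP l K) => hl; last by rewrite iter_delta_ge.
  case: (ltnP j K) => hj; last by rewrite iter0 // iter_delta_ge.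
  case: (ltnP i K) => hi; last by rewrite iter0 // iter0 // iter_delta_ge.
  case/negP: hij; apply/allpairsP; exists ((i, j), l); rewrite !mem_iota; split=> //=.
  by apply/allpairsP; exists (i, j); rewrite !mem_iota.
rewrite big_allpairs_dep /= exchange_big /=.
have iotaE (V : nmodType) (h : nat -> V) : \sum_(i <- iota 0 K) h i = \sum_(i < K) h i.
  by rewrite -(big_mkord xpredT h) /index_iota subn0.
rewrite iotaE; apply: eq_bigr => l _.
rewrite big_allpairs_dep /= exchange_big /= iotaE.
rewrite (_ : fcons bv f2 _ = fun g => \sum_(j < K) \sum_(i < K) fcons bv f2
   (iter j (fcons bv (tw_delta X1)) (fcons bv f1
     (iter i (fcons bv (tw_delta X0)) (fone m)))) g); last first.
  apply: funext => g.
  rewrite (_ : fgeom K bv (tw_delta X1) _ = fun g => \sum_(j < K) \sum_(i < K)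
    iter j (fcons bv (tw_delta X1)) (fcons bv f1
     (iter i (fcons bv (tw_delta X0)) (fone m))) g); last first.
    apply: funext => g'; apply: eq_bigr => j _; rewrite -fcons_iter_sum //.
    by congr (iter _ _ _ g'); apply: funext => g''; rewrite /fgeom fcons_sum.
  by rewrite fcons_sum //; apply: eq_bigr => j _; rewrite fcons_sum.
rewrite fcons_iter_sum //; apply: eq_bigr => j _.
rewrite fcons_iter_sum // iotaE; apply: eq_bigr => i _.
exact: (sE ((i : nat, j : nat), l : nat)).
Qed.
End Sums.
End TwistedOperations.

(** * Chains of four objects *)

Section Chain.
Context {k : fieldType} {P : finType} {A : graded_algebra k P}.
Context {BB : bar_basis A} {X0 X1 X2 X3 : lmodType k}.
Context (d0 : idx BB 0 -> X0 -> X0) (d1 : idx BB 0 -> X1 -> X1).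
Context (d2 : idx BB 0 -> X2 -> X2) (d3 : idx BB 0 -> X3 -> X3).
Local Notation bv := (@bvec _ _ _ BB _).

Definition letter : finType := (idx BB 0 + idx BB (-1))%type.

Definition letter_vec (y : letter) : A :=
  match y with inl x => bvec x | inr c => bvec c end.

Definition letter_deg (y : letter) : int :=
  match y with inl _ => 0 | inr _ => -1 end.

Definition chain_space : lmodType k := (X0 * X1 * X2 * X3)%type.

Definition pr0 (u : chain_space) : X0 := u.1.1.1.
Definition pr1 (u : chain_space) : X1 := u.1.1.2.
Definition pr2 (u : chain_space) : X2 := u.1.2.
Definition pr3 (u : chain_space) : X3 := u.2.

(** Block matrices: letters of degree 0 are diagonal, letters of degree -1 move every factor to the
    next one. Four factors are what associativity of three composable morphisms takes. *)
Definition chain_op (t0 : idx BB (-1) -> X0 -> X1) (t1 : idx BB (-1) -> X1 -> X2)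
    (t2 : idx BB (-1) -> X2 -> X3) (y : letter) (u : chain_space) : chain_space :=
  match y with
  | inl x => (d0 x (pr0 u), d1 x (pr1 u), d2 x (pr2 u), d3 x (pr3 u))
  | inr c => (0, t0 c (pr0 u), t1 c (pr1 u), t2 c (pr2 u))
  end.

Hypothesis hd0 : forall x, linear (d0 x).
Hypothesis hd1 : forall x, linear (d1 x).
Hypothesis hd2 : forall x, linear (d2 x).
Hypothesis hd3 : forall x, linear (d3 x).

Lemma pr0_linear : linear pr0. Proof. by []. Qed.
Lemma pr1_linear : linear pr1. Proof. by []. Qed.
Lemma pr2_linear : linear pr2. Proof. by []. Qed.
Lemma pr3_linear : linear pr3. Proof. by []. Qed.

Lemma chain_spaceP (u v : chain_space) : pr0 u = pr0 v -> pr1 u = pr1 v ->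
  pr2 u = pr2 v -> pr3 u = pr3 v -> u = v.
Proof.
rewrite /pr0 /pr1 /pr2 /pr3.
by case: u v => [[[? ?] ?] ?] [[[? ?] ?] ?] /= -> -> -> ->.
Qed.

Section Maps.
Context (t0 : idx BB (-1) -> X0 -> X1) (t1 : idx BB (-1) -> X1 -> X2).
Context (t2 : idx BB (-1) -> X2 -> X3).
Hypothesis ht0 : forall x, linear (t0 x).
Hypothesis ht1 : forall x, linear (t1 x).
Hypothesis ht2 : forall x, linear (t2 x).
Local Notation op := (chain_op t0 t1 t2).

Lemma chain_op_linear y : linear (op y).
Proof.
case: y => x c u v; apply: chain_spaceP => /=;
  rewrite ?hd0 ?hd1 ?hd2 ?hd3 ?ht0 ?ht1 ?ht2 //.
by rewrite -[LHS]/(0 : X0) -[RHS]/(c *: (0 : X0) + 0) scaler0 addr0.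
Qed.

(** One stage of [chain_nilpotent]. [Good] says that the preceding components vanish; then [p] turns
    letters of degree 0 into [d] and is killed by the others. *)
Lemma foldr_proj (X : lmodType k) (p : chain_space -> X) (d : idx BB 0 -> X -> X)
    (Good : chain_space -> Prop) K w u :
  (forall x, linear (d x)) -> nilpotent d K ->
  (forall y u, Good u -> Good (op y u)) ->
  (forall x u, Good u -> p (op (inl x) u) = d x (p u)) ->
  (forall c u, Good u -> p (op (inr c) u) = 0) ->
  size w = K -> Good u -> Good (foldr op u w) /\ p (foldr op u w) = 0.
Proof.
move=> hd dK hG hl hr sw gu.
have gw w' : Good (foldr op u w') by elim: w' => //= y w' /hG.
split=> //; suff H w' : (exists w0 : seq (idx BB 0),
    size w0 = size w' /\ p (foldr op u w') = foldr d (p u) w0)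
    \/ p (foldr op u w') = 0.
  by case: (H w) => // -[w0 [s0 ->]]; apply: dK; rewrite s0.
elim: w' => [|y w' IH] /=; first by left; exists [::].
case: y => x; last by right; apply: hr.
rewrite hl //; case: IH => [[w0 [s0 ->]]|->]; last by right; rewrite lin0.
by left; exists (x :: w0); rewrite /= s0.
Qed.

(** Every block of [K] letters kills one more component, hence four blocks. *)
Lemma chain_nilpotent K : nilpotent d0 K -> nilpotent d1 K ->
  nilpotent d2 K -> nilpotent d3 K -> nilpotent op (K + (K + (K + K))).
Proof.
move=> n0 n1 n2 n3 w u sw.
rewrite -(cat_take_drop K w) -(cat_take_drop K (drop K w)).
rewrite -(cat_take_drop K (drop K (drop K w))) !foldr_cat !drop_drop.
set w0 := drop _ w; set w1 := take K _; set w2 := take K _; set w3 := take K w.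
have s0 : size w0 = K by rewrite size_drop sw; lia.
have s1 : size w1 = K by rewrite size_takel // size_drop sw; lia.
have s2 : size w2 = K by rewrite size_takel // size_drop sw; lia.
have s3 : size w3 = K by rewrite size_takel // sw; lia.
have [_ e0] := foldr_proj (p := pr0) (Good := fun=> True) (u := u) hd0 n0
  (fun _ _ _ => I) (fun _ _ _ => erefl) (fun _ _ _ => erefl) s0 I.
set u1 := foldr op u w0 in e0 *.
have [g1 e1] := foldr_proj (p := pr1) (Good := fun u => pr0 u = 0) (u := u1) hd1 n1
  (fun y u (h : pr0 u = 0) => match y return pr0 (op y u) = 0 with
     | inl x => etrans (congr1 (d0 x) h) (lin0 (hd0 x)) | inr _ => erefl end)
  (fun _ _ _ => erefl)
  (fun c u (h : pr0 u = 0) => etrans (congr1 (t0 c) h) (lin0 (ht0 c))) s1 e0.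
set u2 := foldr op u1 w1 in g1 e1 *.
have [[g2 g2'] e2] := foldr_proj (p := pr2) (Good := fun u => pr0 u = 0 /\ pr1 u = 0)
  (u := u2) hd2 n2
  (fun y u => fun '(conj h h') => match y return pr0 (op y u) = 0 /\ pr1 (op y u) = 0 with
     | inl x => conj (etrans (congr1 (d0 x) h) (lin0 (hd0 x)))
                     (etrans (congr1 (d1 x) h') (lin0 (hd1 x)))
     | inr c => conj erefl (etrans (congr1 (t0 c) h) (lin0 (ht0 c))) end)
  (fun _ _ _ => erefl)
  (fun c u => fun '(conj h h') => etrans (congr1 (t1 c) h') (lin0 (ht1 c))) s2 (conj g1 e1).
set u3 := foldr op u2 w2 in g2 g2' e2 *.
have H3 y u' : [/\ pr0 u' = 0, pr1 u' = 0 & pr2 u' = 0] ->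
    [/\ pr0 (op y u') = 0, pr1 (op y u') = 0 & pr2 (op y u') = 0].
  case: y => x [h0 h1 h2]; split=> //.
  - exact: etrans (congr1 (d0 x) h0) (lin0 (hd0 x)).
  - exact: etrans (congr1 (d1 x) h1) (lin0 (hd1 x)).
  - exact: etrans (congr1 (d2 x) h2) (lin0 (hd2 x)).
  - exact: etrans (congr1 (t0 x) h0) (lin0 (ht0 x)).
  - exact: etrans (congr1 (t1 x) h1) (lin0 (ht1 x)).
have [[? ? ?] e3] := foldr_proj (p := pr3)
  (Good := fun u => [/\ pr0 u = 0, pr1 u = 0 & pr2 u = 0]) (u := u3) hd3 n3 H3
  (fun _ _ _ => erefl)
  (fun c u => fun '(And3 _ _ h) => etrans (congr1 (t2 c) h) (lin0 (ht2 c))) s3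
  (And3 g2 g2' e2).
exact: chain_spaceP.
Qed.

Context (N K : nat).
Hypothesis hN : nilpotent op N.
Hypothesis n0 : nilpotent d0 K.
Hypothesis n1 : nilpotent d1 K.
Hypothesis n2 : nilpotent d2 K.
Hypothesis n3 : nilpotent d3 K.

Lemma fcons_letter (X Y : lmodType k) (f : letter -> X -> Y) (S : formal k A X) g :
  fcons letter_vec f S g = fcons bv (fun x => f (inl x)) S g
                           + fcons bv (fun c => f (inr c)) S g.
Proof. exact: fcons_sumtype. Qed.

Variable S : formal k A chain_space.
Local Notation R := (fgeom N letter_vec op S).

(** The equation of the geometric series is block triangular: each component solves the equation of
    its own structure map, with the preceding component as a source term. *)
Lemma pr0_fgeom : (fun g => pr0 (R g)) = fgeom K bv d0 (fun g => pr0 (S g)).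
Proof.
apply: fgeom_unique => // g.
rewrite [in LHS](fgeom_fix _ chain_op_linear hN) (linD pr0_linear); congr (_ + _).
rewrite fcons_letter (linD pr0_linear).
rewrite (fcons_proj (f := d0) (q := pr0) _ _ _ pr0_linear) //.
by rewrite [X in _ + X]lin_sum // big1 ?addr0.
Qed.

Lemma pr1_fgeom : (fun g => pr1 (R g))
  = fgeom K bv d1 (fun g => pr1 (S g) + fcons bv t0 (fun g => pr0 (R g)) g).
Proof.
apply: fgeom_unique => // g.
rewrite [in LHS](fgeom_fix _ chain_op_linear hN) (linD pr1_linear) -addrA; congr (_ + _).
rewrite fcons_letter (linD pr1_linear) addrC; congr (_ + _).
  exact: (fcons_proj _ _ _ pr1_linear).
exact: (fcons_proj _ _ _ pr1_linear).
Qed.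

Lemma pr2_fgeom : (fun g => pr2 (R g))
  = fgeom K bv d2 (fun g => pr2 (S g) + fcons bv t1 (fun g => pr1 (R g)) g).
Proof.
apply: fgeom_unique => // g.
rewrite [in LHS](fgeom_fix _ chain_op_linear hN) (linD pr2_linear) -addrA; congr (_ + _).
rewrite fcons_letter (linD pr2_linear) addrC; congr (_ + _).
  exact: (fcons_proj _ _ _ pr2_linear).
exact: (fcons_proj _ _ _ pr2_linear).
Qed.

Lemma pr3_fgeom : (fun g => pr3 (R g))
  = fgeom K bv d3 (fun g => pr3 (S g) + fcons bv t2 (fun g => pr2 (R g)) g).
Proof.
apply: fgeom_unique => // g.
rewrite [in LHS](fgeom_fix _ chain_op_linear hN) (linD pr3_linear) -addrA; congr (_ + _).
rewrite fcons_letter (linD pr3_linear) addrC; congr (_ + _).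
  exact: (fcons_proj _ _ _ pr3_linear).
exact: (fcons_proj _ _ _ pr3_linear).
Qed.
End Maps.

Lemma signed_chain_op t0 t1 t2 :
  signed_op letter_deg (chain_op t0 t1 t2)
  = chain_op (fun c m => - t0 c m) (fun c m => - t1 c m) (fun c m => - t2 c m).
Proof.
apply: funext => -[x|c]; apply: funext => u; rewrite /signed_op /=.
  by rewrite expr0z scale1r.
have -> : (-1 : k) ^ (-1) = -1 by rewrite exprN1 invrN1.
rewrite scaleN1r; apply: chain_spaceP => //=.
by rewrite -[LHS]/(- (0 : X0)) oppr0.
Qed.
End Chain.

Lemma fconsDf (k : fieldType) (A : eqType) (I : finType) (v : I -> A)
    (X Y : lmodType k) (f : I -> X -> Y) (S S' : formal k A X) :
  (forall x, linear (f x)) ->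
  fcons v f (fun g => S g + S' g) = fun g => fcons v f S g + fcons v f S' g.
Proof. by move=> hf; apply: funext => g; apply: fconsD. Qed.

Section TwistedCategory.
Context {k : fieldType} {P : finType} {A : graded_algebra k P}.
Context {b : seq A -> A} {BB : bar_basis A} {rk : P -> nat}.
Hypothesis G : bar_facts b BB rk.
Local Notation bv := (@bvec _ _ _ BB _).
Local Notation gcoord y := (@gcoord _ _ _ b BB _ y).

Definition graded_word (D : int) (w : seq (int * A)) : Prop :=
  bar_word w /\ \sum_(p <- w) p.1 = D.

Lemma graded_word_cons D t (x : idx BB t) w :
  graded_word D w -> graded_word (t + D) ((t, bvec x) :: w).
Proof.
move=> [hw <-]; split; last by rewrite big_cons.
by apply: bar_word_cons => //; apply: bvec_deg.
Qed.

Lemma gcoord_deg t (y : idx BB t) D w :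
  graded_word D w -> t <> D + 1 -> gcoord y (map snd w) = 0.
Proof.
move=> [hw <-] ht; case: w hw ht => [|p w] hw ht //=.
have := bf_deg G (w := p :: w) isT hw.
exact: bcoord_deg.
Qed.

Definition graded (X : lmodType k) D (S : formal k A X) : Prop :=
  formal_in (fun _ w => graded_word D w) S.

Lemma graded_fone (X : lmodType k) (m : X) : graded 0 (fone m).
Proof. by apply: formal_in_fone; split=> //; rewrite big_nil. Qed.

Lemma graded_fcons (X Y : lmodType k) t (f : idx BB t -> X -> Y) D S :
  (forall x, linear (f x)) -> graded D S -> graded (t + D) (fcons bv f S).
Proof.
move=> hf; apply: (formal_in_fcons (dg := fun=> t)) => // x n w hw _.
exact: graded_word_cons.
Qed.

Lemma graded_fgeom (X : lmodType k) (f : idx BB 0 -> X -> X) K D S :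
  (forall x, linear (f x)) -> graded D S -> graded D (fgeom K bv f S).
Proof.
move=> hf; apply: (formal_in_fgeom (dg := fun=> 0)) => // x n w hw _.
by rewrite -[D]add0r; apply: graded_word_cons.
Qed.

Lemma graded_eq0 (X : lmodType k) D (S : formal k A X) t (y : idx BB t) :
  graded D S -> t <> D + 1 -> S (gcoord y) = 0.
Proof. by move=> hS ht; apply: (formal_in_eq0 hS) => n w hw; apply: gcoord_deg ht. Qed.

Lemma letter_vec_deg (y : letter (BB := BB)) : bdeg (letter_deg y) (letter_vec y).
Proof. by case: y => x; apply: bvec_deg. Qed.

Lemma letter_deg_le0 (y : letter (BB := BB)) : letter_deg y <= 0.
Proof. by case: y. Qed.

Lemma common_nilpotent (X0 X1 X2 X3 : tw_object b BB) : exists K,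
  [/\ nilpotent (tw_delta X0) K, nilpotent (tw_delta X1) K,
      nilpotent (tw_delta X2) K & nilpotent (tw_delta X3) K].
Proof.
have [K0 h0] := tw_nilpotent X0; have [K1 h1] := tw_nilpotent X1.
have [K2 h2] := tw_nilpotent X2; have [K3 h3] := tw_nilpotent X3.
exists (K0 + K1 + K2 + K3)%N.
by split; [apply: nilpotent_le h0 _ | apply: nilpotent_le h1 _
  | apply: nilpotent_le h2 _ | apply: nilpotent_le h3 _]; lia.
Qed.

Section FourObjects.
Context (X0 X1 X2 X3 : tw_object b BB).
Context (t0 : ad BB X0 X1 (-1)) (t1 : ad BB X1 X2 (-1)) (t2 : ad BB X2 X3 (-1)).
Hypothesis ht0 : forall x, linear (t0 x).
Hypothesis ht1 : forall x, linear (t1 x).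
Hypothesis ht2 : forall x, linear (t2 x).
Context (K : nat).
Hypothesis n0 : nilpotent (tw_delta X0) K.
Hypothesis n1 : nilpotent (tw_delta X1) K.
Hypothesis n2 : nilpotent (tw_delta X2) K.
Hypothesis n3 : nilpotent (tw_delta X3) K.

Let l0 := @tw_delta_linear _ _ _ _ _ X0.
Let l1 := @tw_delta_linear _ _ _ _ _ X1.
Let l2 := @tw_delta_linear _ _ _ _ _ X2.
Let l3 := @tw_delta_linear _ _ _ _ _ X3.
Local Notation d0 := (tw_delta X0).
Local Notation d1 := (tw_delta X1).
Local Notation d2 := (tw_delta X2).
Local Notation d3 := (tw_delta X3).
Local Notation op := (chain_op d0 d1 d2 d3 t0 t1 t2).
Let N := (K + (K + (K + K)))%N.
Let hop := chain_op_linear l0 l1 l2 l3 ht0 ht1 ht2.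
Let hN : nilpotent op N := chain_nilpotent l0 l1 l2 l3 ht0 ht1 ht2 n0 n1 n2 n3.
Local Notation R u := (fgeom N (@letter_vec _ _ _ BB) op (fone u)).

Lemma chain_fone0 u : (fun g => pr0 (R u g)) = fgeom K bv d0 (fone (pr0 u)).
Proof. exact: (pr0_fgeom l0 l1 l2 l3 ht0 ht1 ht2 hN n0 (fone u)). Qed.

Lemma chain_fone1 u : (fun g => pr1 (R u g)) = fun g =>
  fgeom K bv d1 (fone (pr1 u)) g
  + fgeom K bv d1 (fcons bv t0 (fgeom K bv d0 (fone (pr0 u)))) g.
Proof.
rewrite (pr1_fgeom l0 l1 l2 l3 ht0 ht1 ht2 hN n1 (fone u)) chain_fone0.
by rewrite -fgeomD.
Qed.

Lemma chain_fone2 u : (fun g => pr2 (R u g)) = fun g =>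
  fgeom K bv d2 (fone (pr2 u)) g
  + (fgeom K bv d2 (fcons bv t1 (fgeom K bv d1 (fone (pr1 u)))) g
  + fgeom K bv d2 (fcons bv t1 (fgeom K bv d1 (fcons bv t0
       (fgeom K bv d0 (fone (pr0 u)))))) g).
Proof.
rewrite (pr2_fgeom l0 l1 l2 l3 ht0 ht1 ht2 hN n2 (fone u)) chain_fone1.
by rewrite fgeomD // fconsDf // fgeomD.
Qed.

Lemma chain_fone3 u : (fun g => pr3 (R u g)) = fun g =>
  fgeom K bv d3 (fone (pr3 u)) g
  + (fgeom K bv d3 (fcons bv t2 (fgeom K bv d2 (fone (pr2 u)))) g
  + (fgeom K bv d3 (fcons bv t2 (fgeom K bv d2 (fcons bv t1
       (fgeom K bv d1 (fone (pr1 u)))))) g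
  + fgeom K bv d3 (fcons bv t2 (fgeom K bv d2 (fcons bv t1
       (fgeom K bv d1 (fcons bv t0 (fgeom K bv d0 (fone (pr0 u)))))))) g)).
Proof.
rewrite (pr3_fgeom l0 l1 l2 l3 ht0 ht1 ht2 hN n3 (fone u)) chain_fone2.
by rewrite fgeomD // fconsDf // fgeomD // fconsDf // fgeomD.
Qed.

Lemma graded_T0 (X : tw_object b BB) (m : X) :
  graded 0 (fgeom K bv (tw_delta X) (fone m)).
Proof. by apply: graded_fgeom; [apply: tw_delta_linear | apply: graded_fone]. Qed.

Lemma graded_step (X Y : tw_object b BB) (t : ad BB X Y (-1)) D S :
  (forall x, linear (t x)) -> graded D S ->
  graded (-1 + D) (fgeom K bv (tw_delta Y) (fcons bv t S)).
Proof.
by move=> ht hS; apply: graded_fgeom; [apply: tw_delta_linear | apply: graded_fcons].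
Qed.

Hypothesis c0 : forall y m, b1_tw t0 y m = 0.
Hypothesis c1 : forall y m, b1_tw t1 y m = 0.
Hypothesis c2 : forall y m, b1_tw t2 y m = 0.

Local Notation mu := (mu_op (b := b) (BB := BB) (@letter_vec _ _ _ BB) op N).

(** A word with [j] letters taken from the [t_i] has degree [-j], so [b] sends it to degree [1 - j]
    and its coordinates in other degrees vanish. The same count gives [zero1], [zero2] and
    [zero3]. *)
Let zero0 (X : tw_object b BB) t (y : idx BB t) (m : X) : t <> 1 ->
  fgeom K bv (tw_delta X) (fone m) (gcoord y) = 0.
Proof. by move=> ht; apply: (graded_eq0 y (graded_T0 m)). Qed.

Let zero1 (X Y : tw_object b BB) (s : ad BB X Y (-1)) t (y : idx BB t) (m : X) :
  (forall x, linear (s x)) -> t <> 0 ->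
  fgeom K bv (tw_delta Y) (fcons bv s (fgeom K bv (tw_delta X) (fone m))) (gcoord y) = 0.
Proof.
by move=> hs ht; apply: (graded_eq0 y (graded_step hs (graded_T0 m))).
Qed.

Let zero2 (X Y Z : tw_object b BB) (s : ad BB X Y (-1)) (s' : ad BB Y Z (-1))
    t (y : idx BB t) (m : X) :
  (forall x, linear (s x)) -> (forall x, linear (s' x)) -> t <> -1 ->
  fgeom K bv (tw_delta Z) (fcons bv s' (fgeom K bv (tw_delta Y) (fcons bv s
    (fgeom K bv (tw_delta X) (fone m))))) (gcoord y) = 0.
Proof.
move=> hs hs' ht.
by apply: (graded_eq0 y (graded_step hs' (graded_step hs (graded_T0 m)))).
Qed.

Let zero3 t (y : idx BB t) (m : X0) : t <> -2 ->
  fgeom K bv d3 (fcons bv t2 (fgeom K bv d2 (fcons bv t1 (fgeom K bv d1 (fcons bv t0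
    (fgeom K bv d0 (fone m))))))) (gcoord y) = 0.
Proof.
move=> ht; apply: (graded_eq0 y (graded_step ht2 (graded_step ht1
  (graded_step ht0 (graded_T0 m))))).
exact: ht.
Qed.

(** Degree 1 selects the words without any [t_i]: what is left is the Maurer-Cartan equation of each
    object. *)
Lemma mu_degree1 (y : idx BB 1) u : mu y u = 0.
Proof.
apply: chain_spaceP; rewrite /mu_op.
- by rewrite -[LHS]/((fun g => pr0 (R u g)) _) chain_fone0 tw_mc_geom.
- rewrite -[LHS]/((fun g => pr1 (R u g)) _) chain_fone1.
  by rewrite tw_mc_geom // zero1 // addr0.
- rewrite -[LHS]/((fun g => pr2 (R u g)) _) chain_fone2.
  by rewrite tw_mc_geom // zero1 // zero2 // !addr0.
- rewrite -[LHS]/((fun g => pr3 (R u g)) _) chain_fone3.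
  by rewrite tw_mc_geom // zero1 // zero2 // zero3 // !addr0.
Qed.

(** Degree 0 selects the words with exactly one [t_i]: the cocycle conditions. *)
Lemma mu_degree0 (y : idx BB 0) u : mu y u = 0.
Proof.
apply: chain_spaceP; rewrite /mu_op.
- by rewrite -[LHS]/((fun g => pr0 (R u g)) _) chain_fone0 zero0.
- rewrite -[LHS]/((fun g => pr1 (R u g)) _) chain_fone1 zero0 // add0r.
  by rewrite -(b1_twE (t := -1) y _ n0 n1 ht0) c0.
- rewrite -[LHS]/((fun g => pr2 (R u g)) _) chain_fone2 zero0 // zero2 //.
  by rewrite -(b1_twE (t := -1) y _ n1 n2 ht1) c1 !addr0.
- rewrite -[LHS]/((fun g => pr3 (R u g)) _) chain_fone3 zero0 // zero2 // zero3 //.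
  by rewrite -(b1_twE (t := -1) y _ n2 n3 ht2) c2 !addr0.
Qed.

Lemma mu_degreeN1 (y : idx BB (-1)) u :
  [/\ pr0 (mu y u) = 0, pr1 (mu y u) = 0, pr2 (mu y u) = b2_tw t1 t0 y (pr0 u)
    & pr3 (mu y u) = b2_tw t2 t1 y (pr1 u)].
Proof.
rewrite /mu_op; split.
- by rewrite -[LHS]/((fun g => pr0 (R u g)) _) chain_fone0 zero0.
- by rewrite -[LHS]/((fun g => pr1 (R u g)) _) chain_fone1 zero0 // zero1 // addr0.
- rewrite -[LHS]/((fun g => pr2 (R u g)) _) chain_fone2 zero0 // zero1 // !add0r.
  by rewrite -(b2_twE y _ n0 n1 n2 ht0 ht1).
- rewrite -[LHS]/((fun g => pr3 (R u g)) _) chain_fone3 zero0 // zero1 // zero3 //.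
  by rewrite -(b2_twE y _ n1 n2 n3 ht1 ht2) !add0r addr0.
Qed.

Local Notation Z u := (fcons bv (fun y : idx BB (-1) => mu y) (R u)).
Local Notation op' := (chain_op d0 d1 d2 d3 (fun c m => - t0 c m)
  (fun c m => - t1 c m) (fun c m => - t2 c m)).

Let lt0 x : linear (fun m => - t0 x m).
Proof. by move=> c m m'; rewrite ht0 opprD scalerN. Qed.
Let lt1 x : linear (fun m => - t1 x m).
Proof. by move=> c m m'; rewrite ht1 opprD scalerN. Qed.
Let lt2 x : linear (fun m => - t2 x m).
Proof. by move=> c m m'; rewrite ht2 opprD scalerN. Qed.

Let hN' : nilpotent op' N := chain_nilpotent l0 l1 l2 l3 lt0 lt1 lt2 n0 n1 n2 n3.

Lemma Z_components u :
  [/\ (fun g => pr0 (Z u g)) = fun=> 0, (fun g => pr1 (Z u g)) = fun=> 0,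
      (fun g => pr2 (Z u g)) = fcons bv (b2_tw t1 t0) (fun g => pr0 (R u g))
    & (fun g => pr3 (Z u g)) = fcons bv (b2_tw t2 t1) (fun g => pr1 (R u g))].
Proof.
split; apply: funext => g.
- rewrite /fcons (lin_sum pr0_linear) big1 // => x _.
  by have [] := mu_degreeN1 x (R u (fun w => g (bvec x :: w))).
- rewrite /fcons (lin_sum pr1_linear) big1 // => x _.
  by have [] := mu_degreeN1 x (R u (fun w => g (bvec x :: w))).
- apply: (fcons_proj _ _ _ pr2_linear) => x u'.
  by have [] := mu_degreeN1 x u'.
- apply: (fcons_proj _ _ _ pr3_linear) => x u'.
  by have [] := mu_degreeN1 x u'.
Qed.

Lemma Ainf_chain t (x : idx BB t) u :
  fgeom N (@letter_vec _ _ _ BB) op' (Z u) (gcoord x) = 0.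
Proof.
rewrite -signed_chain_op.
apply: (Ainf_operators G letter_vec_deg letter_deg_le0 hop hN).
  by move=> y n; apply: mu_degree0.
by move=> y n; apply: mu_degree1.
Qed.

(** Evaluated at a vector of [X0], component 2 becomes [b1_tw] of the product and component 3 the
    difference of the two bracketings; the minus sign is that of the signed letters. *)
Lemma chain_last u : let W := fgeom N (@letter_vec _ _ _ BB) op' (Z u) in
  (fun g => pr2 (W g)) = fgeom K bv d2 (fcons bv (b2_tw t1 t0)
     (fgeom K bv d0 (fone (pr0 u)))) /\
  (fun g => pr3 (W g)) = fgeom K bv d3 (fun g =>
     fcons bv (b2_tw t2 t1) (fun g => pr1 (R u g)) g
     - fcons bv t2 (fun g => pr2 (W g)) g).
Proof.
move=> W; have [z0 z1 z2 z3] := Z_components u.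
have w0 : (fun g => pr0 (W g)) = fun=> 0.
  by rewrite (pr0_fgeom l0 l1 l2 l3 lt0 lt1 lt2 hN' n0) z0 fgeom0.
have w1 : (fun g => pr1 (W g)) = fun=> 0.
  rewrite (pr1_fgeom l0 l1 l2 l3 lt0 lt1 lt2 hN' n1) -/W w0.
  have -> : (fun g => pr1 (Z u g) + fcons bv (fun c m => - t0 c m) (fun=> 0) g)
      = fun=> 0.
    by apply: funext => g; rewrite (congr1 (fun S => S g) z1) fcons0 ?addr0.
  by rewrite fgeom0.
split.
  rewrite (pr2_fgeom l0 l1 l2 l3 lt0 lt1 lt2 hN' n2) -/W w1.
  congr (fgeom _ _ _ _); apply: funext => g.
  by rewrite (congr1 (fun S => S g) z2) fcons0 ?addr0 // chain_fone0.
rewrite (pr3_fgeom l0 l1 l2 l3 lt0 lt1 lt2 hN' n3) -/W.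
congr (fgeom _ _ _ _); apply: funext => g.
by rewrite (congr1 (fun S => S g) z3) fcons_oppl.
Qed.

End FourObjects.
End TwistedCategory.

(** * Paths and unit parts *)

Section Paths.
Context {k : fieldType} {P : finType} {A : graded_algebra k P}.
Context {b : seq A -> A} {BB : bar_basis A} {rk : P -> nat}.
Hypothesis G : bar_facts b BB rk.
Local Notation bv := (@bvec _ _ _ BB _).
Local Notation gco y := (@gcoord _ _ _ b BB _ y).
Local Notation e := (@ga_e _ _ A).

Lemma e_bvec j t (x : idx BB t) : e j * bvec x = if j == btgt x then bvec x else 0.
Proof.
by rewrite -{1}(bvec_l x) mulrA (bf_ee G); case: eqP => [->|]; rewrite ?bvec_l ?mul0r.
Qed.

Lemma bvec_mule j t (x : idx BB t) : bvec x * e j = if bsrc x == j then bvec x else 0.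
Proof.
by rewrite -{1}(bvec_r x) -mulrA (bf_ee G); case: eqP; rewrite ?bvec_r ?mulr0.
Qed.

Lemma bcoord_neq0 t t' (y : idx BB t) (x : idx BB t') :
  bcoord y (bvec x) <> 0 -> btgt x = btgt y /\ bsrc x = bsrc y.
Proof.
have [tt'|/eqP tt'] := eqVneq t t'; last by rewrite (bcoord_deg y tt' (bvec_deg x)).
subst t'; rewrite bcoord_vec; by case: eqP => [->|].
Qed.

Lemma bcoord_span t (y : idx BB t) a (h : A -> A) :
  linear h -> exists N, bcoord y (h a)
  = \sum_(n < N) \sum_(x : idx BB (n%:Z - 1)) bcoord x a * bcoord y (h (bvec x)).
Proof.
move=> hh; have [N aE] := bf_span G a; exists N.
rewrite {1}aE (lin_sum hh) bcoord_sum; apply: eq_bigr => n _.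
rewrite (lin_sum hh) bcoord_sum; apply: eq_bigr => x _.
by rewrite (linZ hh) bcoordZ.
Qed.

Lemma bcoord_mull t (y : idx BB t) j a : j <> btgt y -> bcoord y (e j * a) = 0.
Proof.
move=> jy; have hl : linear (fun a => e j * a) by move=> c u v; rewrite mulrDr scalerAr.
have [N ->] := bcoord_span y a hl; rewrite big1 // => n _; rewrite big1 // => x _.
rewrite e_bvec; case: eqP => [jx|_]; last by rewrite bcoord0 mulr0.
case: (eqVneq (bcoord y (bvec x)) 0) => [->|/eqP /bcoord_neq0 [xy _]]; first by rewrite mulr0.
by case: jy; rewrite jx.
Qed.

Lemma bcoord_mulr t (y : idx BB t) j a : j <> bsrc y -> bcoord y (a * e j) = 0.
Proof.
move=> jy; have hl : linear (fun a => a * e j) by move=> c u v; rewrite mulrDl scalerAl.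
have [N ->] := bcoord_span y a hl; rewrite big1 // => n _; rewrite big1 // => x _.
rewrite bvec_mule; case: eqP => [jx|_]; last by rewrite bcoord0 mulr0.
case: (eqVneq (bcoord y (bvec x)) 0) => [->|/eqP /bcoord_neq0 [_ xy]]; first by rewrite mulr0.
by case: jy; rewrite -jx.
Qed.

Lemma be_ends i : btgt (be BB i) = i /\ bsrc (be BB i) = i.
Proof.
have h1 : bvec (be BB i) <> 0 by apply: bvec_neq0.
have e1 := e_bvec i (be BB i); have e2 := bvec_mule i (be BB i).
rewrite bvec_e (bf_ee G) eqxx in e1; rewrite bvec_e (bf_ee G) eqxx in e2.
rewrite bvec_e in h1.
by split; [move: e1; case: eqP | move: e2; case: eqP].
Qed.

Lemma tgt_be i : btgt (be BB i) = i. Proof. by have [] := be_ends i. Qed.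
Lemma src_be i : bsrc (be BB i) = i. Proof. by have [] := be_ends i. Qed.

Definition count0 (w : seq (int * A)) : nat := count (fun p => p.1 == 0) w.

(** A word from [i] to [j], read from right to left. Composability inside the word is kept only
    through its effect on ranks: every letter of degree 0 costs at least one. *)
Definition path_word (i j : P) (w : seq (int * A)) : Prop :=
  [/\ bar_word w,
      if w is p :: _ then e j * p.2 = p.2 else j = i,
      if w is p :: w' then (last p w').2 * e i = (last p w').2 else True
    & (rk i + count0 w <= rk j)%N].

Definition path_from (X : smodule k P) (i : P) (n : X) (w : seq (int * A)) : Prop :=
  exists2 j, sm_e X j n = n & path_word i j w.

Lemma path_fone (X : smodule k P) i (m : X) :
  sm_e X i m = m -> path_from i m [::].
Proof. by exists i => //; split=> //; rewrite addn0. Qed.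

Lemma sm_e_id (X : smodule k P) i (m : X) : sm_e X i (sm_e X i m) = sm_e X i m.
Proof. by rewrite sm_orth eqxx. Qed.

Lemma in_ad_tgt (X Y : smodule k P) t (f : ad BB X Y t) x n : in_ad f ->
  sm_e Y (btgt x) (f x n) = f x n.
Proof. by move=> hf; rewrite (proj2 (hf x) n) sm_e_id -(proj2 (hf x) n). Qed.

Lemma in_ad_src (X Y : smodule k P) t (f : ad BB X Y t) x n : in_ad f ->
  f x (sm_e X (bsrc x) n) = f x n.
Proof. by move=> hf; rewrite [LHS](proj2 (hf x)) sm_e_id -(proj2 (hf x)). Qed.

Lemma in_ad_src0 (X Y : smodule k P) t (f : ad BB X Y t) x n j : in_ad f ->
  bsrc x <> j -> f x (sm_e X j n) = 0.
Proof.
move=> hf xj; rewrite -in_ad_src // sm_orth ifN; last exact/eqP.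
exact: (lin0 (proj1 (hf x))).
Qed.

Lemma path_fcons (X Y : smodule k P) t (f : ad BB X Y t) i x n w : in_ad f ->
  (forall x : idx BB t, (rk (bsrc x) + (t == 0) <= rk (btgt x))%N) ->
  path_from i n w -> f x n <> 0 -> path_from i (f x n) ((t, bvec x) :: w).
Proof.
move=> hf hrk [j jn [hw hhead hlast hcount]] fn.
have xj : bsrc x = j.
  by apply: contrapT => xj; apply: fn; rewrite -jn (in_ad_src0 n hf xj).
exists (btgt x); first exact: in_ad_tgt.
split.
- by apply: bar_word_cons => //; apply: bvec_deg.
- exact: bvec_l.
- case: w hw hhead hlast {hcount} => [|p w] _ //= ji _.
  by rewrite -ji -xj bvec_r.
- move: (hrk x) hcount; rewrite /count0 /= xj addnCA => h1 h2.
  apply: leq_trans h1; rewrite [leqRHS]addnC leq_add2l.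
  exact: h2.
Qed.

Lemma rank_hom (x : idx BB (-1)) : (rk (bsrc x) + (-1 == 0 :> int) <= rk (btgt x))%N.
Proof. by rewrite addn0; apply: (bf_hom G). Qed.

Lemma rank_ext (x : idx BB 0) : (rk (bsrc x) + (0 == 0 :> int) <= rk (btgt x))%N.
Proof. by rewrite addn1; apply: (bf_ext G). Qed.

Lemma gcoord_tgt t (y : idx BB t) i j w :
  path_word i j w -> gco y (map snd w) <> 0 -> btgt y = j.
Proof.
case: w => [|p w] // [hw hhead _ _] h; apply: contrapT => yj; apply: h => /=.
have hw' : bar_word w by move=> q qw; apply: hw; rewrite in_cons qw orbT.
have dp := hw p (mem_head _ _).
rewrite -hhead (bf_left G j dp hw') bcoord_mull //.
exact: nesym.
Qed.

Lemma gcoord_src t (y : idx BB t) i j w :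
  path_word i j w -> gco y (map snd w) <> 0 -> bsrc y = i.
Proof.
case/lastP: w => [|w p] // [hw _ hlast _] h; apply: contrapT => yi; apply: h.
have hw' : bar_word w by move=> q qw; apply: hw; rewrite mem_rcons in_cons qw orbT.
have dp : bdeg p.1 p.2 by apply: hw; rewrite mem_rcons mem_head.
have {}hlast : p.2 * e i = p.2.
  by case: w hlast {hw hw'} => [|q w] //=; rewrite last_rcons.
have -> : gco y (map snd (rcons w p)) = bcoord y (b (rcons (map snd w) p.2)).
  by rewrite map_rcons; case: (map _ _).
rewrite -hlast (bf_right G i dp hw') bcoord_mulr //.
exact: nesym.
Qed.

Lemma path_tgt (X : smodule k P) i (S : formal k A X) t (y : idx BB t) :
  formal_in (path_from i) S -> sm_e X (btgt y) (S (gco y)) = S (gco y).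
Proof.
move=> [s [hs ->]]; rewrite linear_sum big_seq [RHS]big_seq.
apply: eq_bigr => p /hs [j jn pw]; rewrite linearZ /=.
case: (eqVneq (gco y (map snd p.2)) 0) => [->|/eqP h]; first by rewrite !scale0r.
by rewrite (gcoord_tgt pw h) jn.
Qed.

Lemma path_src (X : smodule k P) i (S : formal k A X) t (y : idx BB t) :
  formal_in (path_from i) S -> bsrc y <> i -> S (gco y) = 0.
Proof.
move=> hS yi; apply: (formal_in_eq0 hS) => n w [j _ pw].
by apply: contrapT => /(gcoord_src pw).
Qed.

(** A coordinate on [e_l] sees only words from [l] to [l], and the rank inequality leaves no room
    there for a letter of degree 0. *)
Lemma path_loop (X : smodule k P) i (S : formal k A X) l :
  formal_in (fun n w => path_from i n w /\ (0 < count0 w)%N) S ->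
  S (gco (be BB l)) = 0.
Proof.
move=> hS; apply: (formal_in_eq0 hS) => n w [[j _ pw] w0].
apply: contrapT => h; have := gcoord_tgt pw h; have := gcoord_src pw h.
rewrite tgt_be src_be => li lj; case: pw => _ _ _; rewrite -li -lj; lia.
Qed.

Lemma path_fgeom (X : smodule k P) (d : ad BB X X 0) i K S : in_ad d ->
  formal_in (@path_from X i) S -> formal_in (@path_from X i) (fgeom K bv d S).
Proof.
move=> hd; apply: (formal_in_fgeom (dg := fun=> 0)); first by move=> x; have [] := hd x.
by move=> x n w; apply: path_fcons => //; apply: rank_ext.
Qed.

Lemma path_fcons_hom (X Y : smodule k P) (f : ad BB X Y (-1)) i S : in_ad f ->
  formal_in (@path_from X i) S -> formal_in (@path_from Y i) (fcons bv f S).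
Proof.
move=> hf; apply: (formal_in_fcons (dg := fun=> -1)); first by move=> x; have [] := hf x.
by move=> x n w; apply: path_fcons => //; apply: rank_hom.
Qed.

(** Words remember where they start and end, so a coordinate at [y] sees only the component of [m]
    at the source of [y] and lands at its target. *)
Lemma in_ad_of_paths (X Y : smodule k P) t (S : X -> formal k A Y) :
  (forall g, linear (fun m => S m g)) ->
  (forall i m, formal_in (@path_from Y i) (S (sm_e X i m))) ->
  in_ad (fun y m => S m (gco y) : Y) (BB := BB) (t := t).
Proof.
move=> hl hp y; split; first exact: hl.
move=> m; rewrite (path_tgt y (hp (bsrc y) m)).
rewrite {1}[m](sm_sum (s := X)) (lin_sum (hl _)) (bigD1 (bsrc y)) //= big1 ?addr0 //.
move=> i /eqP iy; rewrite (path_src (i := i)) //; exact: nesym.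
Qed.

Lemma in_ad_linear (X Y : smodule k P) t (f : ad BB X Y t) x :
  in_ad f -> linear (f x).
Proof. by case/(_ x). Qed.

Lemma b2_tw_in (X0 X1 X2 : tw_object b BB) (f2 : ad BB X1 X2 (-1))
    (f1 : ad BB X0 X1 (-1)) : in_ad f1 -> in_ad f2 -> in_ad (b2_tw f2 f1).
Proof.
move=> h1 h2; have [K [n0 n1 n2 _]] := common_nilpotent X0 X1 X2 X2.
have l1 x := in_ad_linear x h1; have l2 x := in_ad_linear x h2.
have ld := @tw_delta_linear _ _ _ b BB.
pose S (m : X0) := fgeom K bv (tw_delta X2) (fcons bv f2 (fgeom K bv (tw_delta X1)
   (fcons bv f1 (fgeom K bv (tw_delta X0) (fone m))))).
have -> : b2_tw f2 f1 = fun y m => S m (gco y).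
  by apply: funext => y; apply: funext => m; apply: b2_twE.
apply: in_ad_of_paths => [g | i m].
  do 2!(apply: fgeom_linear => // ?; apply: fcons_linear => // ?).
  by apply: fgeom_linear => // ?; apply: fone_linear.
do 2!(apply: path_fgeom; [exact: tw_in|apply: path_fcons_hom => //]).
apply: path_fgeom; first exact: tw_in.
exact/formal_in_fone/path_fone/sm_e_id.
Qed.

Lemma b2_tw_cocycle (X0 X1 X2 : tw_object b BB) (t1 : ad BB X1 X2 (-1))
    (t0 : ad BB X0 X1 (-1)) :
  tw_cocycle t1 -> tw_cocycle t0 -> tw_cocycle (b2_tw t1 t0).
Proof.
move=> [i1 c1] [i0 c0]; have i10 := b2_tw_in i0 i1; split=> // y m.
have [K [n0 n1 n2 _]] := common_nilpotent X0 X1 X2 X2.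
(* The chain is completed by a zero morphism; component 2 of the relation involves only [t0] and
   [t1]. *)
pose t2 : ad BB X2 X2 (-1) := fun _ _ => 0.
have l2 x : linear (t2 x) by move=> c u v; rewrite scaler0 addr0.
have c2 z n : b1_tw t2 z n = 0.
  rewrite (b1_twE z n n2 n2 l2) (_ : fcons bv t2 _ = fun=> 0).
    by rewrite fgeom0 //; apply: tw_delta_linear.
  by apply: funext => g; rewrite /fcons big1.
pose u : chain_space (X0 := X0) (X1 := X1) (X2 := X2) (X3 := X2) := (m, 0, 0, 0).
have l0 x := in_ad_linear x i0; have l1 x := in_ad_linear x i1.
rewrite (b1_twE y m n0 n2 (fun x => in_ad_linear x i10)).
have [W2 _] := chain_last G l0 l1 l2 n0 n1 n2 n2 u.
rewrite -[LHS]/((fgeom K bv (tw_delta X2) (fcons bv (b2_tw t1 t0)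
     (fgeom K bv (tw_delta X0) (fone (pr0 u))))) (gco y)) -W2.
by rewrite (Ainf_chain G l0 l1 l2 n0 n1 n2 n2 c0 c1 c2 y u).
Qed.

Lemma b2_tw_assoc (X0 X1 X2 X3 : tw_object b BB) (t2 : ad BB X2 X3 (-1))
    (t1 : ad BB X1 X2 (-1)) (t0 : ad BB X0 X1 (-1)) :
  tw_cocycle t2 -> tw_cocycle t1 -> tw_cocycle t0 ->
  b2_tw t2 (b2_tw t1 t0) = b2_tw (b2_tw t2 t1) t0.
Proof.
move=> [i2 c2] [i1 c1] [i0 c0].
have i10 := b2_tw_in i0 i1; have i21 := b2_tw_in i1 i2.
have [K [n0 n1 n2 n3]] := common_nilpotent X0 X1 X2 X3.
have l0 x := in_ad_linear x i0; have l1 x := in_ad_linear x i1.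
have l2 x := in_ad_linear x i2; have l10 x := in_ad_linear x i10.
have l21 x := in_ad_linear x i21.
have ld := @tw_delta_linear _ _ _ b BB.
apply: funext => y; apply: funext => m.
pose u : chain_space (X0 := X0) (X1 := X1) (X2 := X2) (X3 := X3) := (m, 0, 0, 0).
have [W2 W3] := chain_last G l0 l1 l2 n0 n1 n2 n3 u.
have := Ainf_chain G l0 l1 l2 n0 n1 n2 n3 c0 c1 c2 y u.
move/(congr1 (fun w => pr3 w)); rewrite -[LHS]/((fun g => pr3 (_ g)) (gco y)).
rewrite W3 W2 (chain_fone1 l0 l1 l2 n0 n1 n2 n3).
have -> : fone (pr1 u) = (fun=> 0) :> formal k A X1.
  by apply: funext => g; rewrite /fone scaler0.
rewrite fgeom0 // (_ : (fun g => 0 + _) = fgeom K bv (tw_delta X1)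
   (fcons bv t0 (fgeom K bv (tw_delta X0) (fone (pr0 u))))); last first.
  by apply: funext => g; rewrite add0r.
rewrite fgeomD // fgeomN // -!b2_twE //.
by move/subr0_eq.
Qed.
End Paths.

Section UnitParts.
Context {k : fieldType} {P : finType} {A : graded_algebra k P}.
Context {b : seq A -> A} {BB : bar_basis A} {rk : P -> nat}.
Hypothesis G : bar_facts b BB rk.
Local Notation bv := (@bvec _ _ _ BB _).
Local Notation gco y := (@gcoord _ _ _ b BB _ y).
Local Notation e := (@ga_e _ _ A).
Implicit Types X Y Z : smodule k P.

Definition is_be (x : idx BB (-1)) : bool := [exists i, x == be BB i].

Definition e_part X Y (f : ad BB X Y (-1)) : ad BB X Y (-1) :=
  fun x m => if is_be x then f x m else 0.

Definition J_part X Y (f : ad BB X Y (-1)) : ad BB X Y (-1) :=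
  fun x m => if is_be x then 0 else f x m.

Definition e_sum X Y (f : ad BB X Y (-1)) (m : X) : Y := \sum_i f (be BB i) m.

Lemma is_be_be i : is_be (be BB i).
Proof. by apply/existsP; exists i. Qed.

Lemma is_beP x : reflect (exists i, x = be BB i) (is_be x).
Proof. by apply: (iffP existsP) => -[i /eqP xi]; exists i => //; apply/eqP. Qed.

Lemma be_injective : injective (be BB).
Proof. by move=> i j ij; rewrite -(tgt_be G i) ij (tgt_be G). Qed.

Lemma sum_is_be (V : nmodType) (F : idx BB (-1) -> V) :
  \sum_x (if is_be x then F x else 0) = \sum_i F (be BB i).
Proof.
rewrite -big_mkcond (eq_bigl (fun x => x \in [set be BB i | i : P]%SET)); last first.
  by move=> x; apply/is_beP/imsetP => [[i ->]|[i _ ->]]; exists i => //.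
rewrite big_imset /=; last by move=> i j _ _; apply: be_injective.
exact: eq_bigl.
Qed.

Lemma e_part_J_part X Y (f : ad BB X Y (-1)) :
  f = fun x m => e_part f x m + J_part f x m.
Proof.
apply: funext => x; apply: funext => m; rewrite /e_part /J_part.
by case: ifP; rewrite ?addr0 ?add0r.
Qed.

Lemma e_part_in X Y (f : ad BB X Y (-1)) : in_ad f -> in_ad (e_part f).
Proof.
move=> hf x; rewrite /e_part; case: (is_be x); first exact: hf.
by split=> [|m]; [move=> c u v; rewrite scaler0 addr0 | rewrite (linear0 (sm_e Y _))].
Qed.

Lemma J_part_in X Y (f : ad BB X Y (-1)) : in_ad f -> in_ad (J_part f).
Proof.
move=> hf x; rewrite /J_part; case: (is_be x); last exact: hf.
by split=> [|m]; [move=> c u v; rewrite scaler0 addr0 | rewrite (linear0 (sm_e Y _))].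
Qed.

Definition sized (n : nat) (w : seq (int * A)) : Prop :=
  bar_word w /\ (n <= size w)%N.

(** With three letters or more, such words are killed by strict unitality. The size bound is what is
    tracked through the geometric series. *)
Definition unit_sized (n : nat) (w : seq (int * A)) : Prop :=
  sized n w /\ exists j, e j \in map snd w.

Lemma sized_cons n t (x : idx BB t) w :
  sized n w -> sized n.+1 ((t, bvec x) :: w).
Proof.
by case=> hw nw; split=> //; apply: bar_word_cons => //; apply: bvec_deg.
Qed.

Lemma unit_sized_cons n t (x : idx BB t) w :
  unit_sized n w -> unit_sized n.+1 ((t, bvec x) :: w).
Proof.
case=> hw [j hj]; split; first exact: sized_cons.
by exists j; rewrite in_cons hj orbT.
Qed.

Lemma unit_sized_eq0 (X : lmodType k) (S : formal k A X) t (y : idx BB t) :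
  formal_in (fun _ => unit_sized 3) S -> S (gco y) = 0.
Proof.
move=> hS; apply: (formal_in_eq0 hS) => _ w [[hw w3] he].
have := bf_unit G w3 hw he; case: w {hw w3 he} => // p w /= ->.
exact: bcoord0.
Qed.

Section Closure.
Context (X Y : lmodType k) (t : int) (f : idx BB t -> X -> Y).
Hypothesis hf : forall x, linear (f x).

Lemma sized_fcons n S : formal_in (fun _ => sized n) S ->
  formal_in (fun _ => sized n.+1) (fcons bv f S).
Proof. by apply: (formal_in_fcons (dg := fun=> t)) => // *; apply: sized_cons. Qed.

Lemma unit_fcons n S : formal_in (fun _ => unit_sized n) S ->
  formal_in (fun _ => unit_sized n.+1) (fcons bv f S).
Proof. by apply: (formal_in_fcons (dg := fun=> t)) => // *; apply: unit_sized_cons. Qed.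
End Closure.

Lemma unit_e_part X Y (f : ad BB X Y (-1)) n S : in_ad f ->
  formal_in (fun _ => sized n) S ->
  formal_in (fun _ => unit_sized n.+1) (fcons bv (e_part f) S).
Proof.
move=> /e_part_in hf; apply: (formal_in_fcons (dg := fun=> -1)).
  by move=> x; have [] := hf x.
move=> x m w hw; rewrite /e_part; case: ifP => // /is_beP[i ->] _.
by split; [apply: sized_cons | exists i; rewrite /= bvec_e mem_head].
Qed.

Lemma sized_fgeom n (X : lmodType k) (d : idx BB 0 -> X -> X) K S :
  (forall x, linear (d x)) -> formal_in (fun _ => sized n) S ->
  formal_in (fun _ => sized n) (fgeom K bv d S).
Proof.
move=> hd; apply: (formal_in_fgeom (dg := fun=> 0)) => // x m w hw _.
by have [hw' nw] := sized_cons x hw; split=> //; apply: ltnW.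
Qed.

Lemma unit_fgeom n (X : lmodType k) (d : idx BB 0 -> X -> X) K S :
  (forall x, linear (d x)) -> formal_in (fun _ => unit_sized n) S ->
  formal_in (fun _ => unit_sized n) (fgeom K bv d S).
Proof.
move=> hd; apply: (formal_in_fgeom (dg := fun=> 0)) => // x m w hw _.
by have [[hw' nw] ?] := unit_sized_cons x hw; split=> //; split=> //; apply: ltnW.
Qed.

Lemma sized_fone (X : lmodType k) (m : X) : formal_in (fun _ => sized 0) (fone m).
Proof. exact: formal_in_fone. Qed.

Lemma gcoord_pair t t' t'' (y : idx BB t) (x : idx BB t') (x' : idx BB t'') :
  gco y [:: bvec x; bvec x'] = (-1) ^ (t' + 1) * bcoord y (bvec x * bvec x').
Proof. by rewrite /gcoord (bf_b2 G (bvec_deg x) (bvec_deg x')) bcoordZ. Qed.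

Lemma e_sum_tgt X Y Z (f : ad BB Y Z (-1)) t (h : ad BB X Y t) y m :
  in_ad f -> in_ad h -> e_sum f (h y m) = f (be BB (btgt y)) (h y m).
Proof.
move=> hf hh; rewrite /e_sum (bigD1 (btgt y)) //= big1 ?addr0 // => i /eqP iy.
rewrite -(in_ad_tgt y m hh); apply: (in_ad_src0 _ hf).
by rewrite (src_be G).
Qed.

Lemma e_sum_src X Y Z (f : ad BB X Y (-1)) t (h : ad BB Y Z t) y m :
  in_ad f -> in_ad h -> h y (e_sum f m) = h y (f (be BB (bsrc y)) m).
Proof.
move=> hf hh; rewrite /e_sum (lin_sum (in_ad_linear y hh)) (bigD1 (bsrc y)) //=.
rewrite big1 ?addr0 // => i /eqP iy.
rewrite -(in_ad_tgt (be BB i) m hf); apply: (in_ad_src0 _ hh).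
by rewrite (tgt_be G); apply: nesym.
Qed.

Lemma left_unit X Y Z (f : ad BB Y Z (-1)) t (h : ad BB X Y t) (y : idx BB t) m :
  in_ad f -> in_ad h ->
  fcons bv (e_part f) (fcons bv h (fone m)) (gco y) = e_sum f (h y m).
Proof.
move=> hf hh; rewrite (e_sum_tgt _ _ hf hh).
have -> : fcons bv (e_part f) (fcons bv h (fone m)) (gco y)
   = \sum_x if is_be x then f x (fcons bv h (fone m) (fun w => gco y (bvec x :: w))) else 0.
  by [].
rewrite sum_is_be (bigD1 (btgt y)) //= big1 ?addr0 => [|i /eqP iy].
  congr (f _ _); rewrite /fcons (bigD1 y) //= big1 ?addr0 => [|x /eqP xy].
    rewrite /fone (bf_b2 G (bvec_deg _) (bvec_deg _)) expr0z scale1r bvec_e bvec_l.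
    by rewrite bcoord_vec eqxx scale1r.
  rewrite /fone (bf_b2 G (bvec_deg _) (bvec_deg _)) expr0z scale1r bvec_e (e_bvec G).
  case: eqP => _; last by rewrite bcoord0 scale0r (lin0 (in_ad_linear x hh)).
  rewrite bcoord_vec (_ : (y == x) = false) ?scale0r ?(lin0 (in_ad_linear x hh)) //.
  exact/eqP/nesym.
rewrite /fcons big1 ?(lin0 (in_ad_linear _ hf)) // => x _.
rewrite /fone (bf_b2 G (bvec_deg _) (bvec_deg _)) expr0z scale1r bvec_e.
by rewrite (bcoord_mull G _ iy) scale0r (lin0 (in_ad_linear x hh)).
Qed.

(** The sign is that of [b_2] with a unit on the right. For [t = 0] it produces the minus sign of
    the commutator in [b1_tw_split]; for [t = -1] it is trivial. *)
Lemma right_unit X Y Z (f : ad BB X Y (-1)) t (h : ad BB Y Z t) (y : idx BB t) m :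
  in_ad f -> in_ad h ->
  fcons bv h (fcons (@bvec _ _ _ BB _) (e_part f) (fone m)) (gco y)
    = (-1) ^ (t + 1) *: h y (e_sum f m).
Proof.
move=> hf hh; rewrite (e_sum_src _ _ hf hh).
have gE (x : idx BB t) i : gco y [:: bvec x; bvec (be BB i)]
    = (-1) ^ (t + 1) * (if bsrc x == i then (y == x)%:R else 0).
  rewrite gcoord_pair bvec_e (bvec_mule G); case: eqP => _; last by rewrite bcoord0.
  by rewrite bcoord_vec.
have sumE (x : idx BB t) : fcons (@bvec _ _ _ BB _) (e_part f) (fone m)
      (fun w => gco y (bvec x :: w))
   = ((-1) ^ (t + 1) * (y == x)%:R) *: f (be BB (bsrc x)) m.
  transitivity (\sum_x' if is_be x' then
      f x' (gco y [:: bvec x; bvec x'] *: m) else 0); first by [].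
  rewrite sum_is_be (bigD1 (bsrc x)) //= big1 ?addr0 => [|i ix].
    by rewrite -/(gco y [:: bvec x; bvec (be BB (bsrc x))]) gE eqxx
      (linZ (in_ad_linear _ hf)).
  rewrite -/(gco y [:: bvec x; bvec (be BB i)]) gE eq_sym (negbTE ix) mulr0 scale0r.
  exact: (lin0 (in_ad_linear _ hf)).
rewrite [LHS]/fcons (bigD1 y) //= big1 ?addr0 => [|x xy].
  by rewrite sumE eqxx mulr1 (linZ (in_ad_linear y hh)).
rewrite sumE eq_sym (negbTE xy) mulr0 scale0r.
exact: (lin0 (in_ad_linear x hh)).
Qed.

(** By strict unitality a unit letter survives only in words of two letters, that is, next to a
    single structure map of [X] or of [Y]. *)
Lemma b1_tw_split (X Y : tw_object b BB) (f : ad BB X Y (-1)) (x : idx BB 0) m :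
  in_ad f -> b1_tw f x m
  = e_sum f (tw_delta X x m) - tw_delta Y x (e_sum f m) + b1_tw (J_part f) x m.
Proof.
move=> hf; have he := e_part_in hf; have hJ := J_part_in hf.
have [K [nX nY _ _]] := common_nilpotent X Y Y Y.
have lf y := in_ad_linear y hf; have le y := in_ad_linear y he.
have lJ y := in_ad_linear y hJ; have ld := @tw_delta_linear _ _ _ b BB.
rewrite !(b1_twE (t := -1) _ _ nX nY) //.
pose R : formal k A X := fgeom K bv (tw_delta X) (fone m).
have RE : R = fun g => fone m g + fcons bv (tw_delta X) R g by apply: fgeom_fix.
rewrite -/R [X in fcons bv X R]e_part_J_part.
have -> : fcons bv (fun x m => e_part f x m + J_part f x m) R
    = fun g => fcons bv (e_part f) R g + fcons bv (J_part f) R g.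
  by apply: funext => g; rewrite fcons_addl.
rewrite fgeomD //; congr (_ + _).
pose Q := fcons bv (e_part f) R; pose T := fgeom K bv (tw_delta Y) Q.
have TE : T = fun g => Q g + fcons bv (tw_delta Y) T g by apply: fgeom_fix.
have QE : Q = fun g => fcons bv (e_part f) (fone m) g
    + fcons bv (e_part f) (fcons bv (tw_delta X) R) g.
  by rewrite /Q {1}RE fconsDf.
have sR : formal_in (fun _ => sized 0) R by apply: sized_fgeom => //; apply: sized_fone.
have uQ : formal_in (fun _ => unit_sized 1) Q by apply: unit_e_part.
have uT : formal_in (fun _ => unit_sized 1) T by apply: unit_fgeom.
rewrite -/Q -/T {1}TE {1}QE.
have -> : fcons bv (e_part f) (fone m) (gco x) = 0.
  rewrite /fcons big1 // => y _; rewrite /fone /= (bf_b1 G (bvec_deg y)) bcoord0 scale0r.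
  exact: lin0.
have -> : fcons bv (e_part f) (fcons bv (tw_delta X) R) (gco x) = e_sum f (tw_delta X x m).
  rewrite {1}RE fconsDf // fconsDf // (left_unit x m hf (tw_in X)).
  rewrite [X in _ + X](@unit_sized_eq0 _ _ _ x) ?addr0 //.
  by apply: unit_e_part => //; apply: sized_fcons => //; apply: sized_fcons.
rewrite add0r; congr (_ + _).
rewrite {1}TE fconsDf // [X in _ + X](@unit_sized_eq0 _ _ _ x) ?addr0; last first.
  by apply: unit_fcons => //; apply: unit_fcons.
rewrite {1}QE fconsDf // [X in _ + X](@unit_sized_eq0 _ _ _ x) ?addr0; last first.
  by apply: unit_fcons => //; apply: unit_e_part => //; apply: sized_fcons.
by rewrite (right_unit x m hf (tw_in Y)) add0r expr1z scaleN1r.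
Qed.

Section Products.
Context (X0 X1 X2 : tw_object b BB) (f2 : ad BB X1 X2 (-1)) (f1 : ad BB X0 X1 (-1)).
Hypothesis h1 : in_ad f1.
Hypothesis h2 : in_ad f2.

Lemma b2_tw_e_part y m : b2_tw (e_part f2) f1 y m = e_sum f2 (f1 y m).
Proof.
have [K [n0 n1 n2 _]] := common_nilpotent X0 X1 X2 X2.
have he := e_part_in h2; have ld := @tw_delta_linear _ _ _ b BB.
have l1 x := in_ad_linear x h1; have le x := in_ad_linear x he.
rewrite (b2_twE _ _ n0 n1 n2) //.
pose R : formal k A X0 := fgeom K bv (tw_delta X0) (fone m).
have RE : R = fun g => fone m g + fcons bv (tw_delta X0) R g by apply: fgeom_fix.
pose S1 := fgeom K bv (tw_delta X1) (fcons bv f1 R).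
have S1E : S1 = fun g => fcons bv f1 R g + fcons bv (tw_delta X1) S1 g by apply: fgeom_fix.
have sR : formal_in (fun _ => sized 0) R by apply: sized_fgeom => //; apply: sized_fone.
have sS1 : formal_in (fun _ => sized 1) S1 by apply: sized_fgeom => //; apply: sized_fcons.
rewrite -/R -/S1 (fgeom_fix _ (ld X2) n2).
rewrite [X in _ + X](@unit_sized_eq0 _ _ _ y) ?addr0; last first.
  by apply: unit_fcons => //; apply: unit_fgeom => //; apply: unit_e_part.
rewrite S1E fconsDf // [X in _ + X](@unit_sized_eq0 _ _ _ y) ?addr0; last first.
  by apply: unit_e_part => //; apply: sized_fcons.
rewrite {1}RE fconsDf // fconsDf // (left_unit y m h2 h1).
rewrite (@unit_sized_eq0 _ _ _ y) ?addr0 //.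
by apply: unit_e_part => //; apply: sized_fcons => //; apply: sized_fcons.
Qed.

Lemma b2_tw_part_e y m : b2_tw f2 (e_part f1) y m = f2 y (e_sum f1 m).
Proof.
have [K [n0 n1 n2 _]] := common_nilpotent X0 X1 X2 X2.
have he := e_part_in h1; have ld := @tw_delta_linear _ _ _ b BB.
have l2 x := in_ad_linear x h2; have le x := in_ad_linear x he.
rewrite (b2_twE _ _ n0 n1 n2) //.
pose R : formal k A X0 := fgeom K bv (tw_delta X0) (fone m).
have RE : R = fun g => fone m g + fcons bv (tw_delta X0) R g by apply: fgeom_fix.
pose S1 := fgeom K bv (tw_delta X1) (fcons bv (e_part f1) R).
have S1E : S1 = fun g => fcons bv (e_part f1) R g + fcons bv (tw_delta X1) S1 g.
  exact: fgeom_fix.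
have sR : formal_in (fun _ => sized 0) R by apply: sized_fgeom => //; apply: sized_fone.
have uS1 : formal_in (fun _ => unit_sized 1) S1.
  by apply: unit_fgeom => //; apply: unit_e_part.
rewrite -/R -/S1 (fgeom_fix _ (ld X2) n2).
rewrite [X in _ + X](@unit_sized_eq0 _ _ _ y) ?addr0; last first.
  by apply: unit_fcons => //; apply: unit_fgeom => //; apply: unit_fcons.
rewrite S1E fconsDf // [X in _ + X](@unit_sized_eq0 _ _ _ y) ?addr0; last first.
  by apply: unit_fcons => //; apply: unit_fcons.
rewrite {1}RE fconsDf // fconsDf // (right_unit y m h1 h2) expr0z scale1r.
rewrite (@unit_sized_eq0 _ _ _ y) ?addr0 //.
by apply: unit_fcons => //; apply: unit_e_part => //; apply: sized_fcons.
Qed.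
End Products.

Lemma b2_tw_addl (X0 X1 X2 : tw_object b BB) (f2 f2' : ad BB X1 X2 (-1))
    (f1 : ad BB X0 X1 (-1)) y m : in_ad f1 -> in_ad f2 -> in_ad f2' ->
  b2_tw (fun x n => f2 x n + f2' x n) f1 y m = b2_tw f2 f1 y m + b2_tw f2' f1 y m.
Proof.
move=> h1 h2 h2'; have [K [n0 n1 n2 _]] := common_nilpotent X0 X1 X2 X2.
have ld := @tw_delta_linear _ _ _ b BB.
have l1 x := in_ad_linear x h1; have l2 x := in_ad_linear x h2.
have l2' x := in_ad_linear x h2'.
have lD x : linear (fun n => f2 x n + f2' x n).
  by move=> c u v; rewrite l2 l2' scalerDr addrACA.
rewrite !(b2_twE _ _ n0 n1 n2) //.
have -> : fcons bv (fun x n => f2 x n + f2' x n) =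
   fun S g => fcons bv f2 S g + fcons bv f2' S g.
  by apply: funext => S; apply: funext => g; apply: fcons_addl.
by rewrite fgeomD.
Qed.

Lemma b2_tw_addr (X0 X1 X2 : tw_object b BB) (f2 : ad BB X1 X2 (-1))
    (f1 f1' : ad BB X0 X1 (-1)) y m : in_ad f2 -> in_ad f1 -> in_ad f1' ->
  b2_tw f2 (fun x n => f1 x n + f1' x n) y m = b2_tw f2 f1 y m + b2_tw f2 f1' y m.
Proof.
move=> h2 h1 h1'; have [K [n0 n1 n2 _]] := common_nilpotent X0 X1 X2 X2.
have ld := @tw_delta_linear _ _ _ b BB.
have l1 x := in_ad_linear x h1; have l2 x := in_ad_linear x h2.
have l1' x := in_ad_linear x h1'.
have lD x : linear (fun n => f1 x n + f1' x n).
  by move=> c u v; rewrite l1 l1' scalerDr addrACA.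
rewrite !(b2_twE _ _ n0 n1 n2) //.
have -> : fcons bv (fun x n => f1 x n + f1' x n) =
   fun S g => fcons bv f1 S g + fcons bv f1' S g.
  by apply: funext => S; apply: funext => g; apply: fcons_addl.
by rewrite fgeomD // fconsDf // fgeomD.
Qed.

(** The first term already contains the product of the two unit parts, hence [J_part f2] in the
    second. *)
Lemma b2_tw_split (X0 X1 X2 : tw_object b BB) (f2 : ad BB X1 X2 (-1))
    (f1 : ad BB X0 X1 (-1)) y m : in_ad f1 -> in_ad f2 ->
  b2_tw f2 f1 y m = e_sum f2 (f1 y m) + J_part f2 y (e_sum f1 m)
                    + b2_tw (J_part f2) (J_part f1) y m.
Proof.
move=> h1 h2; have he := e_part_in h2; have hJ := J_part_in h2.
have he1 := e_part_in h1; have hJ1 := J_part_in h1.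
rewrite {1}[f2]e_part_J_part b2_tw_addl // b2_tw_e_part // -addrA; congr (_ + _).
by rewrite {1}[f1]e_part_J_part b2_tw_addr // b2_tw_part_e.
Qed.

Lemma path_fcons_ext (X Y : smodule k P) (d : ad BB X Y 0) i S : in_ad d ->
  formal_in (@path_from _ _ A rk X i) S ->
  formal_in (fun n w => @path_from _ _ A rk Y i n w /\ (0 < count0 w)%N) (fcons bv d S).
Proof.
move=> hd; apply: (formal_in_fcons (dg := fun=> 0)); first by move=> x; have [] := hd x.
by move=> x n w hw hn; split=> //; apply: path_fcons hw hn => //; apply: (rank_ext G).
Qed.

Lemma loop_fcons (X Y : smodule k P) t (d : ad BB X Y t) i S : in_ad d ->
  (forall x : idx BB t, (rk (bsrc x) + (t == 0) <= rk (btgt x))%N) ->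
  formal_in (fun n w => @path_from _ _ A rk X i n w /\ (0 < count0 w)%N) S ->
  formal_in (fun n w => @path_from _ _ A rk Y i n w /\ (0 < count0 w)%N) (fcons bv d S).
Proof.
move=> hd hr; apply: (formal_in_fcons (dg := fun=> t)); first by move=> x; have [] := hd x.
move=> x n w [hw w0] hn; split; first exact: path_fcons hw hn.
by rewrite /count0 /= addn_gt0 w0 orbT.
Qed.

(* Words of at least three letters contain an element of Ext^1, so that the
   directedness of the system excludes a loop; products of two elements of J
   are in J. *)
Lemma b2_tw_J_be (X0 X1 X2 : tw_object b BB) (f2 : ad BB X1 X2 (-1))
    (f1 : ad BB X0 X1 (-1)) i m : in_ad f1 -> in_ad f2 ->
  b2_tw (J_part f2) (J_part f1) (be BB i) m = 0.
Proof.
move=> h1 h2; have hJ2 := J_part_in h2; have hJ1 := J_part_in h1.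
have [K [n0 n1 n2 _]] := common_nilpotent X0 X1 X2 X2.
have ld := @tw_delta_linear _ _ _ b BB.
have l1 x := in_ad_linear x hJ1; have l2 x := in_ad_linear x hJ2.
rewrite -(in_ad_src (be BB i) m (b2_tw_in G hJ1 hJ2)) (src_be G).
set n := sm_e _ i m.
have pn : @path_from _ _ A rk _ i n [::] by apply/path_fone/sm_e_id.
rewrite (b2_twE _ _ n0 n1 n2) //.
pose R : formal k A X0 := fgeom K bv (tw_delta X0) (fone n).
have RE : R = fun g => fone n g + fcons bv (tw_delta X0) R g by apply: fgeom_fix.
pose S1 := fgeom K bv (tw_delta X1) (fcons bv (J_part f1) R).
have S1E : S1 = fun g => fcons bv (J_part f1) R g + fcons bv (tw_delta X1) S1 g.
  exact: fgeom_fix.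
have pR : formal_in (@path_from _ _ A rk X0 i) R.
  by apply: (path_fgeom G) => //; [apply: tw_in | apply: formal_in_fone].
have pS1 : formal_in (@path_from _ _ A rk X1 i) S1.
  by apply: (path_fgeom G); [apply: tw_in | apply: (path_fcons_hom G)].
have pS2 : formal_in (@path_from _ _ A rk X2 i)
    (fgeom K bv (tw_delta X2) (fcons bv (J_part f2) S1)).
  by apply: (path_fgeom G); [apply: tw_in | apply: (path_fcons_hom G)].
rewrite -/R -/S1 (fgeom_fix _ (ld X2) n2).
rewrite [X in _ + X](path_loop G i (path_fcons_ext (tw_in X2) pS2)) addr0.
rewrite S1E fconsDf // [X in _ + X](path_loop G i (loop_fcons hJ2 (rank_hom G)
   (path_fcons_ext (tw_in X1) pS1))) addr0.
rewrite {1}RE fconsDf // fconsDf // [X in _ + X](path_loop G i (loop_fcons hJ2 (rank_hom G)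
   (loop_fcons hJ1 (rank_hom G) (path_fcons_ext (tw_in X0) pR)))) addr0.
rewrite /fcons big1 // => x _; rewrite /J_part; case: ifPn => // /is_beP xJ.
rewrite big1 ?(lin0 (in_ad_linear x h2)) // => x' _; case: ifPn => // /is_beP xJ'.
rewrite /fone -/(gco (be BB i) [:: bvec x; bvec x']) gcoord_pair (bf_JJ G).
- by rewrite mulr0 scale0r (lin0 (in_ad_linear x' h1)).
- by move=> j xj; apply: xJ; exists j.
- by move=> j xj; apply: xJ'; exists j.
Qed.

End UnitParts.

(** * Actions of the tensor algebra *)

Section EndomorphismAlgebra.
Context {k : fieldType} {U : lmodType k} (u0 : U).

(* Endomorphisms form a nonzero algebra only in the presence of a nonzero
   vector, on which the type is made to depend. *)
Definition endo_pred (_ : u0 <> 0) : {pred U -> U} := fun f => `[< linear f >].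

Context (hU : u0 <> 0).

Lemma endo_pred_closed : submod_closed (endo_pred hU).
Proof.
split; first by apply/asboolP => c u v; rewrite scaler0 addr0.
move=> a f g /asboolP hf /asboolP hg; apply/asboolP => c u v.
rewrite -[LHS]/(a *: f (c *: u + v) + g (c *: u + v)).
rewrite hf hg -[RHS]/(c *: (a *: f u + g u) + (a *: f v + g v)).
by rewrite !scalerDr !scalerA mulrC addrACA.
Qed.

HB.instance Definition _ :=
  GRing.isSubmodClosed.Build k (U -> U) (endo_pred hU) endo_pred_closed.

Definition endo : Type := {f : U -> U | f \in endo_pred hU}.
HB.instance Definition _ := SubChoice.on endo.
HB.instance Definition _ := [SubChoice_isSubLmodule of endo by <:].

Definition endo_fun (f : endo) : U -> U := val f.

Lemma endo_linear (f : endo) : linear (endo_fun f).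
Proof. by case: f => f hf; apply/asboolP. Qed.

Lemma endoP (f g : endo) : endo_fun f = endo_fun g -> f = g.
Proof. exact: val_inj. Qed.

Lemma endo_one_subproof : (@id U) \in endo_pred hU.
Proof. by apply/asboolP. Qed.

Lemma endo_mul_subproof (f g : endo) : (endo_fun f \o endo_fun g) \in endo_pred hU.
Proof. by apply/asboolP => c u v; rewrite /= !endo_linear. Qed.

Definition endo_one : endo :=
  exist (fun f => f \in endo_pred hU) id endo_one_subproof.
Definition endo_mul (f g : endo) : endo :=
  exist (fun f => f \in endo_pred hU) _ (endo_mul_subproof f g).

Lemma endo_mulA : associative endo_mul. Proof. by move=> f g h; apply: endoP. Qed.
Lemma endo_mul1 : left_id endo_one endo_mul. Proof. by move=> f; apply: endoP. Qed.
Lemma endo_1mul : right_id endo_one endo_mul. Proof. by move=> f; apply: endoP. Qed.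
Lemma endo_mulDl : left_distributive endo_mul +%R.
Proof. by move=> f g h; apply: endoP. Qed.
Lemma endo_mulDr : right_distributive endo_mul +%R.
Proof.
move=> f g h; apply: endoP; apply: funext => u.
by rewrite [LHS](linD (endo_linear f)).
Qed.
Lemma endo_one_neq0 : endo_one != 0.
Proof.
apply/eqP => h; apply: hU.
by rewrite -[u0]/(endo_fun endo_one u0) h.
Qed.

HB.instance Definition _ := GRing.Zmodule_isNzRing.Build endo
  endo_mulA endo_mul1 endo_1mul endo_mulDl endo_mulDr endo_one_neq0.

Lemma endo_scaleAl (c : k) (f g : endo) : c *: (f * g) = (c *: f) * g.
Proof. exact: endoP. Qed.
HB.instance Definition _ := GRing.Lmodule_isLalgebra.Build k endo endo_scaleAl.

Lemma endo_scaleAr (c : k) (f g : endo) : c *: (f * g) = f * (c *: g).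
Proof.
apply: endoP; apply: funext => u.
by rewrite [RHS](linZ (endo_linear f)).
Qed.
HB.instance Definition _ := GRing.Lalgebra_isAlgebra.Build k endo endo_scaleAr.

Definition endo_alg : algType k := endo.

Lemma endo_ofP (f : U -> U) : linear f -> exists g : endo_alg, endo_fun g = f.
Proof.
move=> hf; have hf' : f \in endo_pred hU by apply/asboolP.
by exists (exist _ f hf').
Qed.

Lemma endo_addE (f g : endo_alg) u : endo_fun (f + g) u = endo_fun f u + endo_fun g u.
Proof. by []. Qed.

Lemma endo_scaleE c (f : endo_alg) u : endo_fun (c *: f) u = c *: endo_fun f u.
Proof. by []. Qed.

Lemma endo_mulE (f g : endo_alg) u : endo_fun (f * g) u = endo_fun f (endo_fun g u).
Proof. by []. Qed.

End EndomorphismAlgebra.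

Record linear_action (k : fieldType) (T : algType k) (U : lmodType k)
    (Phi : T -> U -> U) : Prop := LinearAction {
  la_linl : forall u, linear (fun x => Phi x u);
  la_linr : forall x, linear (Phi x);
  la_one : forall u, Phi 1 u = u;
  la_mul : forall x y u, Phi (x * y) u = Phi x (Phi y u) }.

(** The universal property, applied to the endomorphism algebra of [U]. *)
Lemma tensor_action (k : fieldType) (P : finType) (V : lmodType k) (W : set V)
    (l r : P -> V -> V) (T : tensor_algebra W l r) (U : smodule k P)
    (q : V -> U -> U) :
  (forall (c : k) x y, W x -> W y -> W (c *: x + y)) ->
  (forall i x, W x -> W (l i x) /\ W (r i x)) ->
  (forall x, W x -> linear (q x)) ->
  (forall c x y u, W x -> W y -> q (c *: x + y) u = c *: q x u + q y u) ->
  (forall i x u, W x -> q (l i x) u = sm_e U i (q x u)) ->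
  (forall i x u, W x -> q (r i x) u = q x (sm_e U i u)) ->
  exists Phi : T -> U -> U,
    [/\ linear_action Phi, forall i u, Phi (ta_e T i) u = sm_e U i u
      & forall x u, W x -> Phi (ta_in T x) u = q x u].
Proof.
move=> Wlin Wlr ql qr hl hr.
(* On the zero space endomorphisms do not form an [algType]; there every map is an action. *)
have [[u0 hU]|hU] := pselect (exists u : U, u <> 0); last first.
  have U0 (u v : U) : u = v.
    by transitivity (0 : U); [|symmetry]; apply: contrapT => h; apply: hU; eexists; exact: h.
  exists (fun _ u => u); split=> [|i u|x u _]; try exact: U0.
  by split=> [u c x y|x c u v|u|x y u]; apply: U0.
have /choice [qe qeE] := fun i => endo_ofP hU (linearP (sm_e U i)).
have /choice [qi qiE] : forall x, exists g : endo_alg hU, W x -> endo_fun g = q x.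
  move=> x; have [Wx|Wx] := pselect (W x); last by exists 0.
  by have [g gE] := endo_ofP hU (ql x Wx); exists g.
have [] := @ta_universal _ _ _ _ _ _ T (endo_alg hU) qe qi.
  split.
  - move=> i j; apply: endoP; apply: funext => u; rewrite endo_mulE !qeE sm_orth.
    by case: eqP => [->|]; rewrite ?qeE.
  - apply: endoP; apply: funext => u.
    transitivity (\sum_i endo_fun (qe i) u).
      by elim/big_rec2: _ => // i y f _ <-.
    by rewrite [RHS](sm_sum u); apply: eq_bigr => i _; rewrite qeE.
  - move=> c x y Wx Wy; apply: endoP; apply: funext => u.
    have Wxy := Wlin c _ _ Wx Wy.
    by rewrite qiE // endo_addE endo_scaleE !qiE // qr.
  - move=> i x Wx; have [Wl Wr] := Wlr i _ Wx.
    by split; apply: endoP; apply: funext => u; rewrite endo_mulE !qiE // qeE ?hl ?hr.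
move=> phi [phie phii _]; exists (fun x => endo_fun (phi x)).
split.
- split=> [u c x y|x|u|x y u].
  + by rewrite linearP.
  + exact: endo_linear.
  + by rewrite rmorph1.
  + by rewrite rmorphM.
- by move=> i u; rewrite phie qeE.
- by move=> x u Wx; rewrite phii // qiE.
Qed.

(** * The dual basis of B *)

Section DualBasis.
Context {k : fieldType} {P : finType} {A : graded_algebra k P}.
Context {b : seq A -> A} {BB : bar_basis A} {rk : P -> nat}.
Hypothesis G : bar_facts b BB rk.
Local Notation e := (@ga_e _ _ A).

Lemma bcoord_mule_be i a : bcoord (be BB i) (a * e i) = bcoord (be BB i) a.
Proof.
rewrite -{2}[a]mulr1 -(bf_e1 G) mulr_sumr bcoord_sum (bigD1 i) //= big1 ?addr0 //.
by move=> j /eqP ji; rewrite (bcoord_mulr G) // (src_be G).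
Qed.

Lemma bcoord_emul t (x : idx BB t) a : bcoord x (e (btgt x) * a) = bcoord x a.
Proof.
rewrite -{2}[a]mul1r -(bf_e1 G) mulr_suml bcoord_sum (bigD1 (btgt x)) //= big1 ?addr0 //.
by move=> j /eqP ji; rewrite (bcoord_mull G).
Qed.

Lemma bcoord_e i j : bcoord (be BB i) (e j) = (i == j)%:R.
Proof.
rewrite -(bvec_e BB) bcoord_vec; congr (_%:R); congr nat_of_bool.
by apply/eqP/eqP => [/(be_injective G)|->].
Qed.

Lemma in_S_coord a : in_S a -> a = \sum_i bcoord (be BB i) a *: e i.
Proof.
move=> [c ->]; apply: eq_bigr => i _; congr (_ *: _).
rewrite bcoord_sum (bigD1 i) //= big1 ?addr0 => [|j ji].
  by rewrite bcoordZ bcoord_e eqxx mulr1.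
by rewrite bcoordZ bcoord_e eq_sym (negbTE ji) mulr0.
Qed.

Lemma in_S_mull (a : A) i : in_S a -> e i * a = bcoord (be BB i) a *: e i.
Proof.
move=> /in_S_coord {1}->; rewrite mulr_sumr (bigD1 i) //= big1 ?addr0 => [|j ji].
  by rewrite -scalerAr (bf_ee G) eqxx.
by rewrite -scalerAr (bf_ee G) eq_sym (negbTE ji) scaler0.
Qed.

Lemma bvec_mulS t (x : idx BB t) a : in_S a ->
  bvec x * a = bcoord (be BB (bsrc x)) a *: bvec x.
Proof. by move=> ha; rewrite -{1}(bvec_r x) -mulrA in_S_mull // -scalerAr bvec_r. Qed.

Lemma in_S_lin c (x y : A) : in_S x -> in_S y -> in_S (c *: x + y).
Proof.
move=> [d ->] [d' ->]; exists (fun i => c * d i + d' i).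
rewrite scaler_sumr -big_split; apply: eq_bigr => i _.
by rewrite scalerDl scalerA.
Qed.

Lemma in_S0 : in_S (0 : A).
Proof. by exists (fun=> 0); rewrite big1 // => i _; rewrite scale0r. Qed.

Lemma in_S_sum (I : Type) (r : seq I) (Q : pred I) (F : I -> A) :
  (forall i, Q i -> in_S (F i)) -> in_S (\sum_(i <- r | Q i) F i).
Proof.
move=> h; elim/big_rec: _ => [|i x /h hi hx]; first exact: in_S0.
by rewrite -[F i]scale1r; apply: in_S_lin.
Qed.

Lemma in_S_e i : in_S (e i).
Proof.
exists (fun j => (i == j)%:R); rewrite (bigD1 i) //= big1 ?addr0 ?eqxx ?scale1r //.
by move=> j ji; rewrite eq_sym (negbTE ji) scale0r.
Qed.

Lemma in_S1 : in_S (1 : A).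
Proof. by rewrite -(bf_e1 G); apply: in_S_sum => i _; apply: in_S_e. Qed.

Lemma in_S_scale c (x : A) : in_S x -> in_S (c *: x).
Proof. by move=> hx; rewrite -[_ *: _]addr0; apply: in_S_lin => //; apply: in_S0. Qed.

Lemma in_S_mule (a : A) i : in_S a -> in_S (a * e i).
Proof.
move=> [c ->]; rewrite mulr_suml; apply: in_S_sum => j _.
rewrite -scalerAl (bf_ee G); case: eqP => _; last by rewrite scaler0; apply: in_S0.
exact/in_S_scale/in_S_e.
Qed.

Section Action.
Context (X : smodule k P).

Lemma s_actD s s' (m : X) : s_act BB (s + s') m = s_act BB s m + s_act BB s' m.
Proof.
by rewrite /s_act -big_split; apply: eq_bigr => i _; rewrite bcoordD scalerDl.
Qed.

Lemma s_actZ c s (m : X) : s_act BB (c *: s) m = c *: s_act BB s m.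
Proof.
by rewrite /s_act scaler_sumr; apply: eq_bigr => i _; rewrite bcoordZ scalerA.
Qed.

Lemma s_act0 (m : X) : s_act BB 0 m = 0.
Proof. by rewrite /s_act big1 // => i _; rewrite bcoord0 scale0r. Qed.

Lemma s_act_sum (I : Type) (r : seq I) (Q : pred I) (F : I -> A) (m : X) :
  s_act BB (\sum_(i <- r | Q i) F i) m = \sum_(i <- r | Q i) s_act BB (F i) m.
Proof. by elim/big_rec2: _ => [|i y1 y2 _ <-]; rewrite ?s_act0 ?s_actD. Qed.

Lemma s_act_linear s : linear (@s_act _ _ _ BB X s).
Proof.
move=> c u v; rewrite /s_act scaler_sumr -big_split; apply: eq_bigr => i _.
by rewrite linearP scalerDr !scalerA mulrC.
Qed.

Lemma s_act_e i (m : X) : s_act BB (e i) m = sm_e X i m.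
Proof.
rewrite /s_act (bigD1 i) //= big1 ?addr0 => [|j ji]; first by rewrite bcoord_e eqxx scale1r.
by rewrite bcoord_e (negbTE ji) scale0r.
Qed.

Lemma s_act1 (m : X) : s_act BB 1 m = m.
Proof.
rewrite -(bf_e1 G) s_act_sum [RHS](sm_sum (s := X)).
by apply: eq_bigr => i _; rewrite s_act_e.
Qed.

Lemma sm_e_s_act i s (m : X) : sm_e X i (s_act BB s m) = bcoord (be BB i) s *: sm_e X i m.
Proof.
rewrite /s_act linear_sum (bigD1 i) //= big1 ?addr0 => [|j ji].
  by rewrite linearZ /= sm_e_id.
by rewrite linearZ /= sm_orth eq_sym (negbTE ji) scaler0.
Qed.

Lemma s_act_mule i s (m : X) : s_act BB (s * e i) m = sm_e X i (s_act BB s m).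
Proof.
rewrite sm_e_s_act /s_act (bigD1 i) //= big1 ?addr0 => [|j /eqP ji].
  by rewrite bcoord_mule_be.
by rewrite (bcoord_mulr G) ?scale0r // (src_be G); apply: nesym.
Qed.
End Action.

Lemma linear_ext (f g : A -> A) : linear f -> linear g ->
  (forall t (x : idx BB t), f (bvec x) = g (bvec x)) -> f = g.
Proof.
move=> hf hg fg; apply: funext => a; have [N ->] := bf_span G a.
rewrite (lin_sum hf) (lin_sum hg); apply: eq_bigr => n _.
rewrite (lin_sum hf) (lin_sum hg); apply: eq_bigr => x _.
by rewrite (linZ hf) (linZ hg) fg.
Qed.

Lemma dual_deg_lin n (c : k) (al al' : A -> A) :
  dual_deg n al -> dual_deg n al' -> dual_deg n (c *: al + al').
Proof.
move=> [l1 e1 s1 d1] [l2 e2 s2 d2]; split.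
- move=> d u v; rewrite -[LHS]/(c *: al (d *: u + v) + al' (d *: u + v)) l1 l2.
  rewrite -[RHS]/(d *: (c *: al u + al' u) + (c *: al v + al' v)).
  by rewrite !scalerDr !scalerA mulrC addrACA.
- move=> i a; rewrite -[LHS]/(c *: al (e i * a) + al' (e i * a)) e1 e2.
  by rewrite -[RHS]/(e i * (c *: al a + al' a)) mulrDr scalerAr.
- by move=> a; apply: in_S_lin.
- move=> t a ht da; rewrite -[LHS]/(c *: al a + al' a) (d1 t) // (d2 t) //.
  by rewrite scaler0 addr0.
Qed.

Lemma dual_deg0 n : dual_deg n (0 : A -> A).
Proof.
split.
- by move=> c u v; rewrite scaler0 addr0.
- by move=> i a; rewrite mulr0.
- by move=> a; apply: in_S0.
- by [].
Qed.

Lemma bdeg_mule t i (a : A) : bdeg t a -> bdeg t (a * e i).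
Proof.
move=> da; rewrite [a](@bvec_span _ _ _ BB _ _ da) mulr_suml.
elim/big_rec: _ => [|x y _ hy]; first exact: (bf_deg0 G).
rewrite -scalerAl (bvec_mule G); case: eqP => _; last by rewrite scaler0 add0r.
by apply: (bf_deg_lin G) => //; apply: bvec_deg.
Qed.

Lemma dual_deg_l n i (al : A -> A) : dual_deg n al -> dual_deg n (dual_l i al).
Proof.
move=> [l1 e1 s1 d1]; split; rewrite /dual_l.
- by move=> c u v; rewrite l1 mulrDl scalerAl.
- by move=> j a; rewrite e1 mulrA.
- by move=> a; apply: in_S_mule.
- by move=> t a ht da; rewrite (d1 t) // mul0r.
Qed.

Lemma dual_deg_r n i (al : A -> A) : dual_deg n al -> dual_deg n (dual_r i al).
Proof.
move=> [l1 e1 s1 d1]; split; rewrite /dual_r.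
- by move=> c u v; rewrite mulrDl -scalerAl l1.
- by move=> j a; rewrite -mulrA e1.
- by [].
- by move=> t a ht da; apply: (d1 t _ ht); apply: bdeg_mule.
Qed.

Lemma dual_J_lin (c : k) (al al' : A -> A) :
  dual_J al -> dual_J al' -> dual_J (c *: al + al').
Proof.
move=> [h1 z1] [h2 z2]; split; first exact: dual_deg_lin.
by move=> i; rewrite -[LHS]/(c *: al (e i) + al' (e i)) z1 z2 scaler0 addr0.
Qed.

Lemma gen_space_lin (c : k) (al al' : A -> A) :
  gen_space al -> gen_space al' -> gen_space (c *: al + al').
Proof.
move=> [x0 [x1 [h0 h1 ->]]] [y0 [y1 [g0 g1 ->]]].
exists (c *: x0 + y0), (c *: x1 + y1); split.
- exact: dual_deg_lin.
- exact: dual_J_lin.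
apply: funext => a; rewrite -[LHS]/(c *: (x0 a + x1 a) + (y0 a + y1 a)).
by rewrite scalerDr addrACA.
Qed.

Lemma gen_space_lr i (al : A -> A) :
  gen_space al -> gen_space (dual_l i al) /\ gen_space (dual_r i al).
Proof.
move=> [x0 [x1 [h0 [h1 z1] ->]]]; split.
  exists (dual_l i x0), (dual_l i x1); split.
  - exact: dual_deg_l.
  - by split; [apply: dual_deg_l | move=> j; rewrite /dual_l z1 mul0r].
  - by apply: funext => a; rewrite /dual_l mulrDl.
exists (dual_r i x0), (dual_r i x1); split.
- exact: dual_deg_r.
- split; first exact: dual_deg_r.
  move=> j; rewrite /dual_r (bf_ee G); case: eqP => _ //.
  by rewrite (lin0 _) //; case: h1.
- by [].
Qed.

Lemma kept_gen_space (al : A -> A) : kept al -> gen_space al.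
Proof.
case=> h; [exists al, 0 | exists 0, al]; split=> //.
- by split; [apply: dual_deg0 | ].
- by apply: funext => a; rewrite [RHS]addr0.
- exact: dual_deg0.
- by apply: funext => a; rewrite [RHS]add0r.
Qed.

Lemma kept_linear (al : A -> A) : kept al -> linear al.
Proof. by case=> [[]|[[]]]. Qed.

Lemma kept_in_S (al : A -> A) a : kept al -> in_S (al a).
Proof. by case=> [[_ _ h _]|[[_ _ h _] _]]. Qed.

Lemma killed_dual (al : A -> A) : killed al -> exists n, dual_deg n al.
Proof. by case=> [[n _ h]|[i [h _ _]]]; [exists n | exists 1]. Qed.

Lemma gen_space_linear (al : A -> A) : gen_space al -> linear al.
Proof.
move=> [x0 [x1 [[l0 _ _ _] [[l1 _ _ _] _] ->]]] c u v.
by rewrite l0 l1 scalerDr addrACA.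
Qed.

(** The dual basis vector. Functionals are linear over [S] on the left, which places the value at
    the target. *)
Definition dvec t (x : idx BB t) : A -> A := fun a => bcoord x a *: e (btgt x).

Lemma dvec_dual t (x : idx BB t) : dual_deg (- t) (dvec x).
Proof.
split; rewrite /dvec.
- by move=> c u v; rewrite bcoord_lin scalerDl scalerA.
- move=> i a; rewrite -scalerAr (bf_ee G).
  case: (eqVneq i (btgt x)) => [->|/eqP ix]; first by rewrite bcoord_emul.
  by rewrite (bcoord_mull G) // scale0r scaler0.
- by move=> a; apply/in_S_scale/in_S_e.
- by move=> t' a; rewrite opprK => ht da; rewrite (bcoord_deg x _ da) ?scale0r //; apply: nesym.
Qed.

Lemma dvec_J (x : idx BB (-1)) : ~~ is_be x -> dual_J (dvec x).
Proof.
move=> hx; split; first by have := dvec_dual x.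
move=> i; rewrite /dvec -(bvec_e BB) bcoord_vec; case: eqP => [xi|_]; last by rewrite scale0r.
by move: hx; rewrite xi is_be_be.
Qed.

Lemma dvec_kept0 (x : idx BB 0) : dual_deg 0 (dvec x).
Proof. by have := dvec_dual x. Qed.

Definition dual_coeff t (x : idx BB t) (al : A -> A) : k :=
  bcoord (be BB (btgt x)) (al (bvec x)).

Lemma dual_value n (al : A -> A) t (x : idx BB t) : dual_deg n al ->
  al (bvec x) = dual_coeff x al *: e (btgt x).
Proof. by move=> [_ he hS _]; rewrite -{1}(bvec_l x) he in_S_mull. Qed.

Lemma dual_expand t (al : A -> A) : dual_deg (- t) al ->
  al = \sum_(x : idx BB t) dual_coeff x al *: dvec x.
Proof.
move=> hal; have [hl _ _ hd] := hal.
have sumE a : (\sum_(x : idx BB t) dual_coeff x al *: dvec x) a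
    = \sum_(x : idx BB t) (dual_coeff x al * bcoord x a) *: e (btgt x).
  rewrite fct_sumE; apply: eq_bigr => x _.
  by rewrite -[LHS]/(dual_coeff x al *: dvec x a) /dvec scalerA.
apply: linear_ext => //.
  move=> c u v; rewrite !sumE scaler_sumr -big_split; apply: eq_bigr => x _.
  by rewrite bcoord_lin mulrDr scalerDl mulrCA /= scalerA.
move=> t' x; rewrite sumE; have [tt'|/eqP tt'] := eqVneq t' t.
  subst t'; rewrite (bigD1 x) //= big1 ?addr0 => [|y yx].
    by rewrite bcoord_vec eqxx mulr1 (dual_value _ hal).
  by rewrite bcoord_vec (negbTE yx) mulr0 scale0r.
rewrite (hd t') ?opprK //; last exact: bvec_deg.
by rewrite big1 // => y _; rewrite (bcoord_deg y (nesym tt') (bvec_deg x)) mulr0 scale0r.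
Qed.
End DualBasis.

(** * Evaluating elements of the tensor algebra *)

Section TensorAction.
Context {k : fieldType} {P : finType} {A : graded_algebra k P}.
Context {b : seq A -> A} {BB : bar_basis A} {rk : P -> nat}.
Hypothesis G : bar_facts b BB rk.
Local Notation gco y := (@gcoord _ _ _ b BB _ y).
Local Notation e := (@ga_e _ _ A).
Context (T : tensor_algebra (@gen_space _ _ A) (@dual_l _ _ A) (@dual_r _ _ A)).
Context {U : smodule k P} (F : letter (BB := BB) -> U -> U).
Hypothesis hF0 : in_ad (fun x : idx BB 0 => F (inl x)).
Hypothesis hF1 : in_ad (fun x : idx BB (-1) => F (inr x)).
Hypothesis hFe : forall i u, F (inr (be BB i)) u = 0.

(** The formula of [Psi], over letters of both degrees at once. *)
Definition gen_op (al : A -> A) (u : U) : U :=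
  \sum_(y : letter (BB := BB)) s_act BB (al (letter_vec y)) (F y u).

Definition lsrc (y : letter (BB := BB)) : P :=
  match y with inl x => bsrc x | inr x => bsrc x end.

Lemma letter_op_linear y : linear (F y).
Proof. by case: y => x; [have [] := hF0 x | have [] := hF1 x]. Qed.

Lemma letter_op_src y i u : F y (sm_e U i u) = if lsrc y == i then F y u else 0.
Proof.
case: y => x /=; case: eqP => [<-|xi].
- exact: (in_ad_src x u hF0).
- exact: (in_ad_src0 u hF0).
- exact: (in_ad_src x u hF1).
- exact: (in_ad_src0 u hF1).
Qed.

Lemma letter_mule y i : letter_vec y * e i = if lsrc y == i then letter_vec y else 0.
Proof. by case: y => x; apply: (bvec_mule G). Qed.

Lemma letter_mulS y a : in_S a ->
  letter_vec y * a = bcoord (be BB (lsrc y)) a *: letter_vec y.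
Proof. by case: y => x; apply: (bvec_mulS G). Qed.

Lemma letter_op_s_act y s u :
  F y (s_act BB s u) = bcoord (be BB (lsrc y)) s *: F y u.
Proof.
rewrite /s_act (lin_sum (letter_op_linear y)) (bigD1 (lsrc y)) //= big1 ?addr0.
  by rewrite (linZ (letter_op_linear y)) letter_op_src eqxx.
move=> i iy; rewrite (linZ (letter_op_linear y)) letter_op_src eq_sym (negbTE iy).
exact: scaler0.
Qed.

Definition action_of (Phi : T -> U -> U) : Prop :=
  [/\ linear_action Phi, forall i u, Phi (ta_e T i) u = sm_e U i u
    & forall al u, gen_space al -> Phi (ta_in T al) u = gen_op al u].

Lemma action_exists : exists Phi : T -> U -> U, action_of Phi.
Proof.
apply: tensor_action.
- exact: gen_space_lin.
- by move=> i x; apply: (gen_space_lr G).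
- move=> al _ c u v; rewrite /gen_op scaler_sumr -big_split; apply: eq_bigr => y _.
  by rewrite letter_op_linear s_act_linear.
- move=> c x y u _ _; rewrite /gen_op scaler_sumr -big_split; apply: eq_bigr => z _.
  by rewrite -[(c *: x + y) _]/(c *: x _ + y _) s_actD s_actZ.
- move=> i x u _; rewrite /gen_op linear_sum; apply: eq_bigr => z _.
  by rewrite /dual_l (s_act_mule G).
- move=> i x u Wx; rewrite /gen_op; apply: eq_bigr => z _.
  rewrite /dual_r letter_mule letter_op_src; case: eqP => // _.
  by rewrite (lin0 (gen_space_linear Wx)) s_act0 (lin0 (s_act_linear _)).
Qed.

Context (Phi : T -> U -> U).
Hypothesis hPhi : action_of Phi.

Let Phi_lin : linear_action Phi. Proof. by case: hPhi. Qed.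

Lemma theta_in_S (ws : seq (A -> A)) a : (forall al, al \in ws -> forall a, in_S (al a)) ->
  in_S (theta ws a).
Proof.
case: ws => [|al ws] hws; first exact: (in_S1 G).
case: a => [|a0 a]; first exact: (in_S1 G).
by apply: hws; rewrite mem_head.
Qed.

(** The scalar in [S] left by the inner factors passes through a letter to multiply that letter on
    the right: this is the nesting of [theta]. *)
Lemma action_word (ws : seq (A -> A)) u : (forall al, al \in ws -> kept al) ->
  Phi (tword T ws) u = \sum_(w <- words (size ws))
    s_act BB (theta ws (map (@letter_vec _ _ _ BB) w)) (foldr F u w).
Proof.
elim: ws => [|al ws IH] hws.
  by rewrite /tword big_nil big_seq1 /= (la_one Phi_lin) (s_act1 G).
have hws' al' : al' \in ws -> kept al' by move=> h; apply: hws; rewrite in_cons h orbT.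
have hal : kept al by apply: hws; rewrite mem_head.
rewrite /tword big_cons -/(tword T ws) (la_mul Phi_lin) IH // big_words_S.
have [_ _ ->] := hPhi; last exact: kept_gen_space.
apply: eq_bigr => y _; rewrite (lin_sum (letter_op_linear y)).
rewrite (lin_sum (s_act_linear _)); apply: eq_bigr => w _ /=.
have hS : in_S (theta ws (map (@letter_vec _ _ _ BB) w)).
  by apply: theta_in_S => al' /hws' h a; apply: kept_in_S.
rewrite letter_op_s_act letter_mulS // (linZ (kept_linear hal)) s_actZ.
by rewrite (linZ (s_act_linear _)).
Qed.

Definition kept_letter (y : letter (BB := BB)) : bool :=
  match y with inl _ => true | inr x => ~~ is_be x end.

Lemma foldr_unkept w u : ~~ all kept_letter w -> foldr F u w = 0.
Proof.
elim: w => //= y w IH; rewrite negb_and => /orP[|/IH ->]; last first.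
  exact: (lin0 (letter_op_linear y)).
by case: y => //= x; rewrite negbK => /is_beP[i ->]; apply: hFe.
Qed.

Lemma killed_letter al y : killed al -> kept_letter y -> al (letter_vec y) = 0.
Proof.
case: y => x hal hx; case: hal => [[n n0 [_ _ _ hd]]|[i [[_ _ _ hd] _ hJ]]].
- apply: (hd 0); last exact: (bvec_deg x). by move=> /eqP; lia.
- by apply: (hd 0); last exact: (bvec_deg x).
- apply: (hd (-1)); last exact: (bvec_deg x). by move=> /eqP; lia.
- by apply: hJ; apply: bvec_J => j xj; move: hx; rewrite /= xj is_be_be.
Qed.

Lemma theta_killed (ws : seq (A -> A)) w :
  (forall al, al \in ws -> (killed `|` kept) al) -> size w = size ws ->
  all kept_letter w -> ~~ all (fun al => `[< kept al >]) ws ->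
  theta ws (map (@letter_vec _ _ _ BB) w) = 0.
Proof.
elim: ws w => [|al ws IH] [|y w] //= hws [sw] /andP[hy hw].
have hws' al' : al' \in ws -> (killed `|` kept) al'.
  by move=> h; apply: hws; rewrite in_cons h orbT.
have hal := hws al (mem_head _ _).
have lal : linear al.
  by case: hal => [/killed_dual [n []]|/kept_linear].
have SS : in_S (theta ws (map (@letter_vec _ _ _ BB) w)).
  apply: theta_in_S => al' /hws' [/killed_dual [n [_ _ + _]]|h a]; first by apply.
  exact: kept_in_S.
rewrite negb_and => /orP[/asboolP hnk|/IH -> //]; last by rewrite mulr0 lin0.
case: hal => // hk; rewrite letter_mulS // (linZ lal) (killed_letter hk hy).
exact: scaler0.
Qed.

Local Notation lv := (@letter_vec _ _ _ BB).

(** The projection is mirrored on letters: those of the units act by zero, and a killed factor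
    vanishes on all the others. So the terms dropped by [pi] would contribute nothing anyway. *)
Lemma action_pi_word n phi (ws : seq (seq (A -> A))) u :
  tau (killed `|` kept) setT n phi ws ->
  Phi (pi_word T ws) u = \sum_(w <- words n) s_act BB (phi (map lv w)) (foldr F u w).
Proof.
move=> [hws htau]; rewrite /pi_word.
have -> : Phi (\sum_(w <- ws | all (fun al => `[< kept al >]) w) tword T w) u
   = \sum_(w <- ws | all (fun al => `[< kept al >]) w) Phi (tword T w) u.
  exact: (lin_sum (la_linl Phi_lin u)).
rewrite big_seq_cond (eq_bigr (fun ws' => \sum_(w <- words n)
    s_act BB (theta ws' (map lv w)) (foldr F u w))); last first.
  move=> ws' /andP[/hws [sw _] /allP hk]; rewrite action_word ?sw //.
  by move=> al /hk /asboolP.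
rewrite exchange_big big_seq [RHS]big_seq; apply: eq_bigr => w /size_words sw.
rewrite -s_act_sum.
have [hw|hw] := boolP (all kept_letter w); last first.
  by rewrite foldr_unkept // !(lin0 (s_act_linear _)).
congr (s_act BB _ _); rewrite -(htau (map lv w)) ?size_map //.
rewrite -big_seq_cond [RHS](bigID (fun ws' => all (fun al => `[< kept al >]) ws')) /=.
rewrite [X in _ + X]big_seq_cond [X in _ + X]big1 ?addr0 // => ws' /andP[/hws [sw' hk] nk].
by apply: theta_killed => //; rewrite sw sw'.
Qed.

Lemma action_words0 n phi (ws : seq (seq (A -> A))) u :
  (forall c u, F (inr c) u = 0) ->
  tau (dual_deg 0) (bdeg 0) n phi ws ->
  Phi (\sum_(w <- ws) tword T w) u
    = \sum_(w <- words n) s_act BB (phi (map lv w)) (foldr F u w).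
Proof.
move=> hF [hws htau].
rewrite (lin_sum (la_linl Phi_lin u)) big_seq (eq_bigr (fun ws' => \sum_(w <- words n)
    s_act BB (theta ws' (map lv w)) (foldr F u w))); last first.
  move=> ws' /hws [sw hk]; rewrite action_word ?sw //.
  by move=> al /hk; left.
rewrite exchange_big big_seq [RHS]big_seq; apply: eq_bigr => w /size_words sw.
rewrite -s_act_sum -big_seq.
have [hw|hw] := boolP (all (fun y : letter (BB := BB) => if y is inl _ then true else false) w).
  congr (s_act BB _ _); rewrite -(htau (map lv w)) ?size_map //.
  by move=> a /mapP[y yw ->]; have := allP hw y yw; case: y {yw} => // x _; apply: (bvec_deg x).
suff -> : foldr F u w = 0 by rewrite !(lin0 (s_act_linear _)).
elim: w hw {sw} => //= y w IH; rewrite negb_and => /orP[|/IH ->]; last first.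
  exact: (lin0 (letter_op_linear y)).
by case: y.
Qed.

(** Expanding [al] in the dual basis reduces the action of [al] composed with [b] to coordinates of
    powers of [fcons]. *)
Lemma words_dual t (al : A -> A) n u : dual_deg (- t) al -> (0 < n)%N ->
  \sum_(w <- words n) s_act BB (al (b (map lv w))) (foldr F u w)
  = \sum_(x : idx BB t) dual_coeff x al *:
      sm_e U (btgt x) (iter n (fcons lv F) (fone u) (gco x)).
Proof.
move=> hal n0.
rewrite (eq_bigr (fun w => \sum_(x : idx BB t) dual_coeff x al *:
    (bcoord x (b (map lv w)) *: sm_e U (btgt x) (foldr F u w)))); last first.
  move=> w _; rewrite {1}(dual_expand G hal) fct_sumE s_act_sum.
  apply: eq_bigr => x _; rewrite -[(_ *: dvec x) _]/(_ *: dvec x _) s_actZ.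
  by rewrite /dvec s_actZ (s_act_e G).
rewrite exchange_big; apply: eq_bigr => x _; rewrite -scaler_sumr; congr (_ *: _).
rewrite (fcons_iterE _ letter_op_linear) linear_sum big_seq [RHS]big_seq.
apply: eq_bigr => w /size_words sw; rewrite /fone cats0.
rewrite (linZ (foldr_linear letter_op_linear w)) linearZ /=.
by case: w sw n0 => // <-.
Qed.

Definition dual_sum t (al : A -> A) N u : U :=
  \sum_(x : idx BB t) dual_coeff x al *:
    sm_e U (btgt x) (fgeom N lv F (fone u) (gco x)).

Definition dual_term t (al : A -> A) u n : U :=
  \sum_(x : idx BB t) dual_coeff x al *:
    sm_e U (btgt x) (iter n (fcons lv F) (fone u) (gco x)).

Lemma dual_sumE t (al : A -> A) N u :
  dual_sum t al N u = \sum_(0 <= n < N) dual_term t al u n.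
Proof.
rewrite big_mkord /dual_sum /dual_term exchange_big; apply: eq_bigr => x _.
by rewrite -scaler_sumr /fgeom linear_sum.
Qed.

Lemma dual_term0 t (al : A -> A) u : dual_term t al u 0 = 0.
Proof.
by rewrite /dual_term big1 // => x _; rewrite /= /fone scale0r linear0 scaler0.
Qed.

Lemma dual_term1 t (al : A -> A) u : dual_term t al u 1 = 0.
Proof.
rewrite /dual_term big1 // => x _ /=.
rewrite /fcons big1 ?linear0 ?scaler0 // => z _; rewrite /fone /=.
have -> : b [:: letter_vec z] = 0 by case: z => z; apply: (bf_b1 G (bvec_deg z)).
by rewrite bcoord0 scale0r (lin0 (letter_op_linear z)).
Qed.

Lemma dual_term_ge t (al : A -> A) u N n : nilpotent F N -> (N <= n)%N ->
  dual_term t al u n = 0.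
Proof.
move=> hN Nn; rewrite /dual_term big1 // => x _.
have -> : iter n (fcons lv F) (fone u) (gco x) = 0.
  by apply: fcons_iter_nil; [apply: letter_op_linear | apply: nilpotent_le Nn].
by rewrite linear0 scaler0.
Qed.

(** [pi_d] is truncated at some [M], the geometric series at [N] by nilpotency. Terms beyond either
    bound vanish, so both sums are compared with the one up to [N + M]. *)
Lemma action_pi_d t (al : A -> A) (y : T) u N : dual_deg (- t) al -> nilpotent F N ->
  pi_d b (T := T) al y -> Phi y u = dual_sum t al N u.
Proof.
move=> hal hN [ws [M [htau hz ->]]].
pose E := dual_term t al u.
have EE n : (0 < n)%N -> Phi (pi_word T (ws n)) u = E n.
  by move=> n0; rewrite (action_pi_word _ (htau n n0)) (words_dual _ hal).
have EN n : (N <= n)%N -> E n = 0 by apply: dual_term_ge.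
have EM n : (0 < n)%N -> (M <= n)%N -> E n = 0.
  by move=> n0 Mn; rewrite -EE // hz // (lin0 (la_linl Phi_lin u)).
rewrite (lin_sum (la_linl Phi_lin u)) dual_sumE.
transitivity (\sum_(0 <= n < N + M) E n); last first.
  rewrite (@big_cat_nat _ _ _ N) ?leq_addr //= [X in _ + X]big_nat_cond.
  by rewrite [X in _ + X]big1 ?addr0 // => n /andP[/andP[/EN -> _] _].
case: M hz EM => [|M] hz EM.
  rewrite big_geq // big_nat_cond big1 // => -[|n] _; first exact: dual_term0.
  exact: EM.
rewrite [RHS](@big_cat_nat _ _ _ M.+1) ?leq_addl //= [X in _ + X]big_nat_cond.
rewrite [X in _ = _ + X]big1 ?addr0; last first.
  move=> n /andP[/andP[Mn _] _]; apply: EM => //; exact: leq_trans Mn.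
rewrite [RHS]big_ltn // [E 0]dual_term0 add0r big_nat_cond [RHS]big_nat_cond.
by apply: eq_bigr => n /andP[/andP[n0 _] _]; apply: EE.
Qed.

Lemma action_beta t (al : A -> A) (y : T) u N : dual_deg (- t) al -> nilpotent F N ->
  (forall c u, F (inr c) u = 0) -> beta b (T := T) al y ->
  Phi y u = dual_sum t al N u.
Proof.
move=> hal hN hF [ws [M [htau hz ->]]].
pose E := dual_term t al u.
have EE n : (1 < n)%N -> Phi (\sum_(w <- ws n) tword T w) u = E n.
  move=> n1; rewrite (action_words0 _ hF (htau n n1)) (words_dual _ hal) //.
  exact: ltnW.
have EN n : (N <= n)%N -> E n = 0 by apply: dual_term_ge.
have EM n : (1 < n)%N -> (M <= n)%N -> E n = 0.
  by move=> n0 Mn; rewrite -EE // hz // (lin0 (la_linl Phi_lin u)).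
rewrite (lin_sum (la_linl Phi_lin u)) dual_sumE.
transitivity (\sum_(0 <= n < N + M) E n); last first.
  rewrite (@big_cat_nat _ _ _ N) ?leq_addr //= [X in _ + X]big_nat_cond.
  by rewrite [X in _ + X]big1 ?addr0 // => n /andP[/andP[/EN -> _] _].
(* The sum defining [beta] starts at 2; the missing term of length 1 vanishes because [b_1] does. *)
have [M1|M1] := leqP M 1.
  rewrite big_geq; last by lia.
  rewrite big_nat_cond big1 // => -[|[|n]] _; [exact: dual_term0|exact: dual_term1|].
  by apply: EM => //; lia.
rewrite [RHS](@big_cat_nat _ _ _ M) ?leq_addl //= [X in _ + X]big_nat_cond.
rewrite [X in _ = _ + X]big1 ?addr0; last first.
  by move=> n /andP[/andP[Mn _] _]; apply: EM => //; lia.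
rewrite [RHS]big_ltn; last by lia.
rewrite [E 0]dual_term0 add0r [RHS]big_ltn // [E 1]dual_term1 add0r.
rewrite big_nat_cond [RHS]big_nat_cond.
by apply: eq_bigr => n /andP[/andP[n0 _] _]; apply: EE.
Qed.
End TensorAction.

Section SingleAction.
Context {k : fieldType} {P : finType} {A : graded_algebra k P}.
Context {b : seq A -> A} {BB : bar_basis A} {rk : P -> nat}.
Hypothesis G : bar_facts b BB rk.
Local Notation bv := (@bvec _ _ _ BB _).
Local Notation lv := (@letter_vec _ _ _ BB).
Context (T : tensor_algebra (@gen_space _ _ A) (@dual_l _ _ A) (@dual_r _ _ A)).
Implicit Types X Y : smodule k P.

Lemma zero_in_ad X Y t : in_ad (fun (_ : idx BB t) (_ : X) => 0 : Y).
Proof.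
by move=> x; split=> [c u v|m]; [rewrite /= scaler0 addr0 | rewrite (linear0 (sm_e Y _))].
Qed.

Definition single_op X (d : ad BB X X 0) (y : letter (BB := BB)) (m : X) : X :=
  match y with inl x => d x m | inr _ => 0 end.

Context {X : smodule k P} (d : ad BB X X 0).
Hypothesis hd : in_ad d.

Let ld x : linear (d x). Proof. by have [] := hd x. Qed.

Lemma single_op_linear y : linear (single_op d y).
Proof.
case: y => x; first exact: (ld x).
by move=> c u v; rewrite /= scaler0 addr0.
Qed.

Lemma single_nilpotent K : nilpotent d K -> nilpotent (single_op d) K.
Proof.
move=> hK w m sw.
have H w' : (exists w0, size w0 = size w' /\ foldr (single_op d) m w' = foldr d m w0)
    \/ foldr (single_op d) m w' = 0.
  elim: w' => [|y w' IH] /=; first by left; exists [::].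
  case: y => x /=; last by right.
  case: IH => [[w0 [s0 ->]]|->]; last by right; rewrite lin0.
  by left; exists (x :: w0); rewrite /= s0.
by case: (H w) => // -[w0 [s0 ->]]; apply: hK; rewrite s0.
Qed.

Lemma single_fgeom K m : nilpotent d K ->
  fgeom K lv (single_op d) (fone m) = fgeom K bv d (fone m).
Proof.
move=> hK; apply: fgeom_unique => // g.
rewrite {1}(fgeom_fix _ single_op_linear (single_nilpotent hK)); congr (_ + _).
rewrite /letter_vec fcons_sumtype [X in _ + X](_ : _ = 0) ?addr0 //.
by rewrite /fcons big1.
Qed.

Lemma single_action_exists : exists Phi : T -> X -> X, action_of (T := T) (single_op d) Phi.
Proof. by apply: (action_exists G) => //; apply: zero_in_ad. Qed.

Lemma single_gen Phi al m : action_of (T := T) (single_op d) Phi -> dual_deg 0 al ->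
  Phi (ta_in T al) m = Psi d al m.
Proof.
move=> [_ _ h] hal; rewrite h; last by apply: kept_gen_space; left.
rewrite /gen_op big_sumType /= [X in _ + X]big1 ?addr0 // => c _.
exact: (lin0 (s_act_linear _)).
Qed.
End SingleAction.

Section Psi.
Context {k : fieldType} {P : finType} {A : graded_algebra k P}.
Context {b : seq A -> A} {BB : bar_basis A} {rk : P -> nat}.
Hypothesis G : bar_facts b BB rk.
Context {X Y : smodule k P} (t : int) (f : ad BB X Y t).
Hypothesis hf : in_ad f.

Lemma Psi_dual al n m : dual_deg n al ->
  Psi f al m = \sum_(x : idx BB t) dual_coeff x al *: f x m.
Proof.
move=> hal; apply: eq_bigr => x _; rewrite (dual_value G _ hal) s_actZ (s_act_e G).
by rewrite in_ad_tgt.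
Qed.

Lemma dual_coeff_dvec (x x' : idx BB t) : dual_coeff x (dvec x') = (x' == x)%:R.
Proof.
rewrite /dual_coeff /dvec bcoordZ bcoord_vec (bcoord_e G).
by case: eqP => [->|]; rewrite ?eqxx ?mulr1 ?mul0r.
Qed.

Lemma Psi_dvec (x : idx BB t) m : Psi f (dvec x) m = f x m.
Proof.
rewrite (Psi_dual _ (dvec_dual G x)) (bigD1 x) //= big1 ?addr0 => [|y yx].
  by rewrite dual_coeff_dvec eqxx scale1r.
by rewrite dual_coeff_dvec eq_sym (negbTE yx) scale0r.
Qed.
End Psi.

(** * The action of the tensor algebra on a chain *)

Section ChainAction.
Context {k : fieldType} {P : finType} {A : graded_algebra k P}.
Context {b : seq A -> A} {BB : bar_basis A} {rk : P -> nat}.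
Hypothesis G : bar_facts b BB rk.
Local Notation bv := (@bvec _ _ _ BB _).
Local Notation gco y := (@gcoord _ _ _ b BB _ y).
Context (T : tensor_algebra (@gen_space _ _ A) (@dual_l _ _ A) (@dual_r _ _ A)).

Section ChainModule.
Context (X0 X1 X2 X3 : smodule k P).

Definition chain_e (i : P) (u : chain_space (X0 := X0) (X1 := X1) (X2 := X2) (X3 := X3)) :
    chain_space (X0 := X0) (X1 := X1) (X2 := X2) (X3 := X3) :=
  (sm_e X0 i (pr0 u), sm_e X1 i (pr1 u), sm_e X2 i (pr2 u), sm_e X3 i (pr3 u)).

Lemma chain_e_linear i : linear (chain_e i).
Proof.
by move=> c u v; apply: chain_spaceP; [apply: (linearP (sm_e X0 i))
  | apply: (linearP (sm_e X1 i)) | apply: (linearP (sm_e X2 i))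
  | apply: (linearP (sm_e X3 i))].
Qed.

HB.instance Definition _ i := GRing.isLinear.Build k
  (chain_space (X0 := X0) (X1 := X1) (X2 := X2) (X3 := X3))
  (chain_space (X0 := X0) (X1 := X1) (X2 := X2) (X3 := X3))
  *:%R (chain_e i) (chain_e_linear i).

Lemma chain_e_orth i j u : chain_e i (chain_e j u) = if i == j then chain_e i u else 0.
Proof.
by apply: chain_spaceP; rewrite [LHS]sm_orth; case: eqP.
Qed.

Lemma chain_e_sum u : u = \sum_i chain_e i u.
Proof.
apply: chain_spaceP.
- by rewrite (lin_sum pr0_linear) [LHS](sm_sum (s := X0)).
- by rewrite (lin_sum pr1_linear) [LHS](sm_sum (s := X1)).
- by rewrite (lin_sum pr2_linear) [LHS](sm_sum (s := X2)).
- by rewrite (lin_sum pr3_linear) [LHS](sm_sum (s := X3)).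
Qed.

Definition chain_smodule : smodule k P :=
  @SModule k P (chain_space (X0 := X0) (X1 := X1) (X2 := X2) (X3 := X3))
    (fun i => chain_e i) chain_e_orth chain_e_sum.
End ChainModule.

Context (X0 X1 X2 : tw_object b BB).
Context (t0 : ad BB X0 X1 (-1)) (t1 : ad BB X1 X2 (-1)).
Hypothesis h0 : in_ad t0.
Hypothesis h1 : in_ad t1.

(** Two morphisms suffice here, so the fourth place of the chain is filled by [X2] and a zero
    map. *)
Let zero_ad : ad BB X2 X2 (-1) := fun _ _ => 0.
Local Notation d0 := (tw_delta X0).
Local Notation d1 := (tw_delta X1).
Local Notation d2 := (tw_delta X2).
Let U := chain_smodule X0 X1 X2 X2.
Let op : letter (BB := BB) -> U -> U :=
  chain_op d0 d1 d2 d2 (J_part t0) (J_part t1) zero_ad.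
Let ld := @tw_delta_linear _ _ _ b BB.
Let hz : in_ad zero_ad := @zero_in_ad _ _ _ _ _ _ _.

Lemma op_in0 : in_ad (fun x : idx BB 0 => op (inl x)).
Proof.
move=> x; split; first by apply: chain_op_linear => //; try exact: ld;
  move=> y; apply: in_ad_linear; [exact: J_part_in | exact: J_part_in | exact: hz].
by move=> u; apply: chain_spaceP;
  [apply: (proj2 (tw_in X0 x)) | apply: (proj2 (tw_in X1 x))
  | apply: (proj2 (tw_in X2 x)) | apply: (proj2 (tw_in X2 x))].
Qed.

Lemma op_in1 : in_ad (fun x : idx BB (-1) => op (inr x)).
Proof.
move=> x; split; first by apply: chain_op_linear => //; try exact: ld;
  move=> y; apply: in_ad_linear; [exact: J_part_in | exact: J_part_in | exact: hz].
move=> u; apply: chain_spaceP.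
- by rewrite -[LHS]/(0 : X0) -[RHS]/(sm_e X0 _ 0) linear0.
- exact: (proj2 (J_part_in h0 x)).
- exact: (proj2 (J_part_in h1 x)).
- by rewrite -[LHS]/(0 : X2) -[RHS]/(sm_e X2 _ 0) linear0.
Qed.

Lemma op_be i u : op (inr (be BB i)) u = 0.
Proof.
apply: chain_spaceP => //=.
- by rewrite /pr1 /= /J_part is_be_be.
- by rewrite /pr2 /= /J_part is_be_be.
Qed.

Definition chain_action (Phi : T -> U -> U) : Prop := action_of (T := T) op Phi.

Lemma chain_action_exists : exists Phi, chain_action Phi.
Proof. exact: (action_exists G T op_in0 op_in1). Qed.

Context (Phi : T -> U -> U) (hPhi : chain_action Phi).
Context (Phi0 : T -> X0 -> X0) (hPhi0 : action_of (T := T) (single_op d0) Phi0).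
Context (Phi1 : T -> X1 -> X1) (hPhi1 : action_of (T := T) (single_op d1) Phi1).
Context (Phi2 : T -> X2 -> X2) (hPhi2 : action_of (T := T) (single_op d2) Phi2).
Let L := let: And3 l _ _ := hPhi in l.
Let L0 := let: And3 l _ _ := hPhi0 in l.
Let L1 := let: And3 l _ _ := hPhi1 in l.
Let L2 := let: And3 l _ _ := hPhi2 in l.

Definition in0 (x : X0) : U := (x, 0, 0, 0).
Definition in1 (x : X1) : U := (0, x, 0, 0).

(** The degree in [T] counts the steps along the chain: elements of degree 0 act by diagonal blocks,
    elements of degree 1 ([shift]) by blocks one step off the diagonal. The fourth component is
    ignored. *)
Definition diag (x : T) : Prop := forall u,
  [/\ pr0 (Phi x u) = Phi0 x (pr0 u), pr1 (Phi x u) = Phi1 x (pr1 u)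
    & pr2 (Phi x u) = Phi2 x (pr2 u)].

Definition shift (x : T) : Prop := forall u,
  [/\ pr0 (Phi x u) = 0, pr1 (Phi x u) = pr1 (Phi x (in0 (pr0 u)))
    & pr2 (Phi x u) = pr2 (Phi x (in1 (pr1 u)))].

Lemma gen_pr0 al u : pr0 (gen_op op al u : U)
  = \sum_(x : idx BB 0) s_act BB (al (bvec x)) (d0 x (pr0 u)).
Proof.
rewrite /gen_op (lin_sum pr0_linear) big_sumType /= [X in _ + X]big1 ?addr0 => [|c _].
  apply: eq_bigr => x _; rewrite /s_act (lin_sum pr0_linear).
  by apply: eq_bigr => i _.
by rewrite (lin_sum pr0_linear) big1 // => i _; rewrite -[LHS]/(_ *: sm_e X0 i 0) linear0 scaler0.
Qed.

Lemma gen_pr1 al u : pr1 (gen_op op al u : U)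
  = \sum_(x : idx BB 0) s_act BB (al (bvec x)) (d1 x (pr1 u))
  + \sum_(x : idx BB (-1)) s_act BB (al (bvec x)) (J_part t0 x (pr0 u)).
Proof.
rewrite /gen_op (lin_sum pr1_linear) big_sumType /=; congr (_ + _);
  apply: eq_bigr => x _; rewrite /s_act (lin_sum pr1_linear);
  by apply: eq_bigr => i _.
Qed.

Lemma gen_pr2 al u : pr2 (gen_op op al u : U)
  = \sum_(x : idx BB 0) s_act BB (al (bvec x)) (d2 x (pr2 u))
  + \sum_(x : idx BB (-1)) s_act BB (al (bvec x)) (J_part t1 x (pr1 u)).
Proof.
rewrite /gen_op (lin_sum pr2_linear) big_sumType /=; congr (_ + _);
  apply: eq_bigr => x _; rewrite /s_act (lin_sum pr2_linear);
  by apply: eq_bigr => i _.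
Qed.

Lemma dual0_hom al (x : idx BB (-1)) : dual_deg 0 al -> al (bvec x) = 0.
Proof. by move=> [_ _ _ h]; apply: (h (-1) (bvec x)) => //; apply: bvec_deg. Qed.

Lemma dual1_ext al (x : idx BB 0) : dual_deg 1 al -> al (bvec x) = 0.
Proof. by move=> [_ _ _ h]; apply: (h 0 (bvec x)) => //; apply: bvec_deg. Qed.

Lemma diag_gen al : dual_deg 0 al -> diag (ta_in T al).
Proof.
move=> hal u; have [_ _ hg] := hPhi.
rewrite hg; last by apply: kept_gen_space; left.
rewrite gen_pr0 gen_pr1 gen_pr2 (single_gen _ hPhi0) // (single_gen _ hPhi1) //.
rewrite (single_gen _ hPhi2) //; split=> //; rewrite [X in _ + X]big1 ?addr0 // => x _;
  by rewrite dual0_hom // s_act0.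
Qed.

Lemma J_sum (X Y : smodule k P) (f : ad BB X Y (-1)) al m : dual_J al ->
  \sum_(x : idx BB (-1)) s_act BB (al (bvec x)) (J_part f x m) = Psi f al m.
Proof.
move=> [_ he]; apply: eq_bigr => x _; rewrite /J_part; case: ifP => // /is_beP[i ->].
by rewrite bvec_e he !s_act0.
Qed.

Lemma ext_sum0 (X : smodule k P) (d : ad BB X X 0) al m : dual_deg 1 al ->
  \sum_(x : idx BB 0) s_act BB (al (bvec x)) (d x m) = 0.
Proof. by move=> hal; rewrite big1 // => x _; rewrite dual1_ext // s_act0. Qed.

Lemma gen_J al u : dual_J al ->
  [/\ pr0 (Phi (ta_in T al) u) = 0, pr1 (Phi (ta_in T al) u) = Psi t0 al (pr0 u)
    & pr2 (Phi (ta_in T al) u) = Psi t1 al (pr1 u)].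
Proof.
move=> hal; have [_ _ hg] := hPhi; have [hal1 _] := hal.
rewrite hg; last by apply: kept_gen_space; right.
rewrite gen_pr0 gen_pr1 gen_pr2 !ext_sum0 // !add0r.
by rewrite (J_sum t0) // (J_sum t1).
Qed.

Lemma shift_gen al : dual_J al -> shift (ta_in T al).
Proof.
move=> hal u; have [-> -> ->] := gen_J u hal.
by have [_ -> _] := gen_J (in0 (pr0 u)) hal; have [_ _ ->] := gen_J (in1 (pr1 u)) hal.
Qed.

(** Both claims are proved together, since a product of degree 1 has one factor of each kind. *)
Lemma diag_shift n x : tdeg n x -> (n = 0%N -> diag x) /\ (n = 1%N -> shift x).
Proof.
have lc c y z u : Phi (c *: y + z) u = c *: Phi y u + Phi z u by rewrite (la_linl L).
have PhiM y z u : Phi (y * z) u = Phi y (Phi z u) by rewrite (la_mul L).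
elim=> {n x}.
- move=> i; split=> // _ u; have [_ -> _] := hPhi.
  have [_ he0 _] := hPhi0; have [_ he1 _] := hPhi1; have [_ he2 _] := hPhi2.
  by rewrite he0 he1 he2.
- by move=> al hal; split=> // _; apply: diag_gen.
- by move=> al hal; split=> // _; apply: shift_gen.
- move=> n m x y _ [dx sx] _ [dy sy]; split=> nm.
    have [n0 m0] : n = 0%N /\ m = 0%N by lia.
    move=> u; rewrite PhiM (la_mul L0) (la_mul L1) (la_mul L2).
    have [-> -> ->] := dx n0 (Phi y u).
    by have [-> -> ->] := dy m0 u.
  have : (n = 0 /\ m = 1) \/ (n = 1 /\ m = 0)%N by lia.
  case=> -[n0 m0] u; rewrite !PhiM.
    have H w := dx n0 w; have [s0 s1 s2] := sy m0 u.
    have [-> -> ->] := H (Phi y u).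
    have [_ -> _] := H (Phi y (in0 (pr0 u))); have [_ _ ->] := H (Phi y (in1 (pr1 u))).
    by rewrite s0 s1 s2 (lin0 (la_linr L0 _)).
  have H w := dy m0 w; have S w := sx n0 w.
  have [-> -> ->] := S (Phi y u).
  have [_ -> _] := S (Phi y (in0 (pr0 u))); have [_ _ ->] := S (Phi y (in1 (pr1 u))).
  have [-> -> _] := H u; have [-> _ _] := H (in0 (pr0 u)).
  by have [_ -> _] := H (in1 (pr1 u)).
- move=> n; split=> _ u; rewrite (lin0 (la_linl L _)).
    by rewrite (lin0 (la_linl L0 _)) (lin0 (la_linl L1 _)) (lin0 (la_linl L2 _)).
  by rewrite !(lin0 (la_linl L _)).
- move=> n c x y _ [dx sx] _ [dy sy]; split=> n0 u.
    rewrite lc // (la_linl L0) (la_linl L1) (la_linl L2).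
    have [a0 a1 a2] := dx n0 u; have [b0 b1 b2] := dy n0 u.
    by rewrite pr0_linear pr1_linear pr2_linear a0 a1 a2 b0 b1 b2.
  rewrite !lc //.
  have [a0 a1 a2] := sx n0 u; have [b0 b1 b2] := sy n0 u.
  rewrite pr0_linear !pr1_linear !pr2_linear a0 b0 -a1 -a2 -b1 -b2.
  by rewrite scaler0 addr0.
Qed.

Lemma diag_tdeg x : tdeg 0 x -> diag x.
Proof. by case/diag_shift => h _; apply: h. Qed.

Lemma shift_tdeg x : tdeg 1 x -> shift x.
Proof. by case/diag_shift => _ h; apply: h. Qed.

Definition act01 (v : T) (x : X0) : X1 := pr1 (Phi v (in0 x)).
Definition act12 (v : T) (x : X1) : X2 := pr2 (Phi v (in1 x)).
Definition act02 (v : T) (x : X0) : X2 := pr2 (Phi v (in0 x)).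

Lemma in0_linear c x y : in0 (c *: x + y) = c *: in0 x + in0 y.
Proof.
apply: chain_spaceP => //; [rewrite -[RHS]/(c *: (0 : X1) + 0)
  | rewrite -[RHS]/(c *: (0 : X2) + 0) | rewrite -[RHS]/(c *: (0 : X2) + 0)];
  by rewrite scaler0 addr0.
Qed.

Lemma in1_linear c x y : in1 (c *: x + y) = c *: in1 x + in1 y.
Proof.
apply: chain_spaceP => //; [rewrite -[RHS]/(c *: (0 : X0) + 0)
  | rewrite -[RHS]/(c *: (0 : X2) + 0) | rewrite -[RHS]/(c *: (0 : X2) + 0)];
  by rewrite scaler0 addr0.
Qed.

Lemma act01_linl x : linear (fun v => act01 v x).
Proof. by move=> c u v; rewrite /act01 (la_linl L). Qed.

Lemma act01_linr v : linear (act01 v).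
Proof. by move=> c x y; rewrite /act01 in0_linear (la_linr L). Qed.

Lemma act12_linl x : linear (fun v => act12 v x).
Proof. by move=> c u v; rewrite /act12 (la_linl L). Qed.

Lemma act12_linr v : linear (act12 v).
Proof. by move=> c x y; rewrite /act12 in1_linear (la_linr L). Qed.

Lemma act02_linl x : linear (fun v => act02 v x).
Proof. by move=> c u v; rewrite /act02 (la_linl L). Qed.

Lemma act01_mull a v x : tdeg 0 a -> act01 (a * v) x = Phi1 a (act01 v x).
Proof. by move=> /diag_tdeg h; rewrite /act01 (la_mul L); have [_ -> _] := h (Phi v (in0 x)). Qed.

Lemma act12_mull a v x : tdeg 0 a -> act12 (a * v) x = Phi2 a (act12 v x).
Proof. by move=> /diag_tdeg h; rewrite /act12 (la_mul L); have [_ _ ->] := h (Phi v (in1 x)). Qed.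

Lemma act01_mulr v a x : tdeg 1 v -> tdeg 0 a -> act01 (v * a) x = act01 v (Phi0 a x).
Proof.
move=> /shift_tdeg hv /diag_tdeg ha; rewrite /act01 (la_mul L).
by have [_ -> _] := hv (Phi a (in0 x)); have [-> _ _] := ha (in0 x).
Qed.

Lemma act12_mulr v a x : tdeg 1 v -> tdeg 0 a -> act12 (v * a) x = act12 v (Phi1 a x).
Proof.
move=> /shift_tdeg hv /diag_tdeg ha; rewrite /act12 (la_mul L).
by have [_ _ ->] := hv (Phi a (in1 x)); have [_ -> _] := ha (in1 x).
Qed.

Lemma act02_linr v : linear (act02 v).
Proof. by move=> c x y; rewrite /act02 in0_linear (la_linr L). Qed.

Lemma act02_mull a w x : tdeg 0 a -> act02 (a * w) x = Phi2 a (act02 w x).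
Proof. by move=> /diag_tdeg h; rewrite /act02 (la_mul L); have [_ _ ->] := h (Phi w (in0 x)). Qed.

Lemma act02_mul u v x : tdeg 1 u -> act02 (u * v) x = act12 u (act01 v x).
Proof.
move=> /shift_tdeg hu; rewrite /act02 /act12 /act01 (la_mul L).
by have [_ _ ->] := hu (Phi v (in0 x)).
Qed.

Lemma act01_gen al x : dual_J al -> act01 (ta_in T al) x = Psi t0 al x.
Proof. by move=> hal; rewrite /act01; have [_ -> _] := gen_J (in0 x) hal. Qed.

Lemma act12_gen al x : dual_J al -> act12 (ta_in T al) x = Psi t1 al x.
Proof. by move=> hal; rewrite /act12; have [_ _ ->] := gen_J (in1 x) hal. Qed.

Lemma b1_tw_in (X Y : tw_object b BB) (f : ad BB X Y (-1)) : in_ad f -> in_ad (b1_tw f).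
Proof.
move=> hf; have [K [nX nY _ _]] := common_nilpotent X Y Y Y.
have lf x := in_ad_linear x hf.
pose S (m : X) := fgeom K bv (tw_delta Y) (fcons bv f
    (fgeom K bv (tw_delta X) (fone m))).
have -> : b1_tw f = fun y m => S m (gco y).
  by apply: funext => y; apply: funext => m; apply: b1_twE.
apply: (in_ad_of_paths G) => [g | i m].
  apply: fgeom_linear => // ?; apply: fcons_linear => // ?.
  by apply: fgeom_linear => // ?; apply: fone_linear.
apply: (path_fgeom G); [exact: tw_in|apply: (path_fcons_hom G) => //].
apply: (path_fgeom G); first exact: tw_in.
exact/formal_in_fone/path_fone/sm_e_id.
Qed.

Lemma fone0 (X : lmodType k) : fone (0 : X) = (fun=> 0) :> formal k A X.
Proof. by apply: funext => g; rewrite /fone scaler0. Qed.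

Lemma fcons00 (I : finType) (v : I -> A) (X Y : lmodType k) (f : I -> X -> Y) :
  (forall x, linear (f x)) -> fcons v f (fun=> 0) = fun=> 0.
Proof. by move=> hf; apply: funext => g; apply: fcons0. Qed.

Lemma act01_delta al y x : dual_deg 0 al -> pi_d b (T := T) al y ->
  act01 y x = \sum_(z : idx BB 0) dual_coeff z al *: b1_tw (J_part t0) z x.
Proof.
move=> hal hy; have [K [n0 n1 n2 _]] := common_nilpotent X0 X1 X2 X2.
have hJ0 := J_part_in h0; have hJ1 := J_part_in h1.
have l0 z := in_ad_linear z hJ0; have l1 z := in_ad_linear z hJ1.
have lz z := in_ad_linear z hz.
have nU : nilpotent op (K + (K + (K + K))) by apply: chain_nilpotent => //; apply: ld.
rewrite /act01 (action_pi_d (t := 0) G op_in0 op_in1 op_be hPhi _ hal nU hy) /dual_sum.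
rewrite (lin_sum pr1_linear); apply: eq_bigr => z _.
rewrite (linZ pr1_linear); congr (_ *: _).
rewrite -[LHS]/(sm_e X1 (btgt z) (pr1 _)) -[in RHS](in_ad_tgt (z : idx BB (-1 + 1)) x (b1_tw_in hJ0)).
congr (sm_e _ _ _); rewrite -[LHS]/((fun g => pr1 (fgeom _ _ _ _ g)) (gco z)).
rewrite (chain_fone1 l0 l1 lz n0 n1 n2 n2) fone0 fgeom0 ?add0r //; try exact: ld.
by rewrite -(b1_twE (t := -1) z _ n0 n1 l0).
Qed.

Lemma act02_delta al y x : dual_J al -> pi_d b (T := T) al y ->
  act02 y x = \sum_(z : idx BB (-1)) dual_coeff z al *: b2_tw (J_part t1) (J_part t0) z x.
Proof.
move=> [hal _] hy; have [K [n0 n1 n2 _]] := common_nilpotent X0 X1 X2 X2.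
have hJ0 := J_part_in h0; have hJ1 := J_part_in h1.
have l0 z := in_ad_linear z hJ0; have l1 z := in_ad_linear z hJ1.
have lz z := in_ad_linear z hz.
have nU : nilpotent op (K + (K + (K + K))) by apply: chain_nilpotent => //; apply: ld.
rewrite /act02 (action_pi_d (t := -1) G op_in0 op_in1 op_be hPhi _ hal nU hy) /dual_sum.
rewrite (lin_sum pr2_linear); apply: eq_bigr => z _.
rewrite (linZ pr2_linear); congr (_ *: _).
rewrite -[LHS]/(sm_e X2 (btgt z) (pr2 _)) -[in RHS](in_ad_tgt z x (b2_tw_in G hJ0 hJ1)).
congr (sm_e _ _ _); rewrite -[LHS]/((fun g => pr2 (fgeom _ _ _ _ g)) (gco z)).
rewrite (chain_fone2 l0 l1 lz n0 n1 n2 n2) !fone0 !fgeom0 ?fcons00 ?fgeom0 ?add0r //; try exact: ld.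
by rewrite -(b2_twE z _ n0 n1 n2 l0 l1).
Qed.
End ChainAction.

(** * The functor to modules *)

Section ModuleFunctor.
Context {k : fieldType} {P : finType} {A : graded_algebra k P}.
Context {b : seq A -> A} {BB : bar_basis A} {rk : P -> nat}.
Hypothesis G : bar_facts b BB rk.
Context (T : tensor_algebra (@gen_space _ _ A) (@dual_l _ _ A) (@dual_r _ _ A)).
Context (W : weak_ditalgebra b T).
Implicit Types X Y Z : tw_object b BB.

Definition ob_action X : T -> X -> X :=
  sval (cid (single_action_exists G T (tw_in X))).

Lemma ob_actionP X : action_of (T := T) (single_op (tw_delta X)) (@ob_action X).
Proof. exact: (svalP (cid (single_action_exists G T (tw_in X)))). Qed.

Lemma ob_action_linear X : linear_action (@ob_action X).
Proof. by have [] := ob_actionP X. Qed.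

Lemma ob_action_e X i m : ob_action (ta_e T i) m = sm_e X i m.
Proof. by have [_ -> _] := ob_actionP X. Qed.

Lemma ob_action_gen X al m : dual_deg 0 al ->
  ob_action (ta_in T al) m = Psi (tw_delta X) al m.
Proof. exact: (single_gen _ (ob_actionP X)). Qed.

(** [beta] of a functional on B_1 acts by a combination of components of the Maurer-Cartan
    equation. *)
Lemma ob_action_beta X al y (m : X) : dual_deg (-1) al -> beta b (T := T) al y ->
  ob_action y m = 0.
Proof.
move=> hal hy; have [K nK] := tw_nilpotent X.
rewrite (action_beta (t := 1) G (tw_in X) (@zero_in_ad _ _ _ _ X X (-1))
  (ob_actionP X) m hal (single_nilpotent (tw_in X) nK) _ hy) //.
rewrite /dual_sum big1 // => z _.
by rewrite (single_fgeom (tw_in X) m nK) tw_mc_geom // linear0 scaler0.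
Qed.

Lemma ob_action_I X (a : Adelta T) (m : X) : idealI b a -> ob_action (val a) m = 0.
Proof.
have L := ob_action_linear X; move=> ha; elim: ha m => {a} [al a hal hb| |a a' _ h _ h'|c a c' _ h] m.
- exact: ob_action_beta hb.
- by rewrite raddf0 (lin0 (la_linl L m)).
- by rewrite raddfD /= (linD (la_linl L m)) h h' addr0.
- by rewrite !rmorphM /= !(la_mul L) h (lin0 (la_linr L _)).
Qed.

Section ModuleOf.
Variable X : tw_object b BB.
Let act (a : Adelta T) (m : X) : X := ob_action (val a) m.
Let L := ob_action_linear X.

Lemma M_lin_l m : linear (fun a => act a m).
Proof. by move=> c a a'; rewrite /act linearP /= (la_linl L m). Qed.

Lemma M_lin_r a : linear (act a).
Proof. exact: (la_linr L). Qed.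

Lemma M_one m : act 1 m = m.
Proof. by rewrite /act rmorph1 (la_one L). Qed.

Lemma M_mul a a' m : act (a * a') m = act a (act a' m).
Proof. by rewrite /act rmorphM (la_mul L). Qed.

Definition M_mod : module_over (Adelta T) X :=
  ModuleOver M_lin_l M_lin_r M_one M_mul.
End ModuleOf.

Definition M_ob X : annihilated_module b T X :=
  @AnnihilatedModule _ _ _ b T X (M_mod X) (fun a m => @ob_action_I X a m).

Definition MM X : ai_module b T := AIModule (M_ob X).

(* The bimodule map on V induced by an element of degree -1 of ad(B). *)
Definition hom_act X Y (t : ad BB X Y (-1)) (v : T) (m : X) : Y :=
  match pselect (in_ad t) with
  | left h => act01 (sval (cid (chain_action_exists G T h (@zero_in_ad _ _ _ BB Y Y (-1))))) v m
  | right _ => 0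
  end.

(** A bimodule morphism on V, as a function on all of [T] constrained on degree 1 only, which avoids
    the subtype. *)
Definition bimodule_map X Y (L : T -> X -> Y) : Prop :=
  [/\ forall c u v m, tdeg 1 u -> tdeg 1 v -> L (c *: u + v) m = c *: L u m + L v m,
      forall v, tdeg 1 v -> linear (L v),
      forall a v m, tdeg 0 a -> tdeg 1 v -> L (a * v) m = ob_action a (L v m)
    & forall v a m, tdeg 1 v -> tdeg 0 a -> L (v * a) m = L v (ob_action a m)].

(** A product of degree 1 has one factor of degree 1 and one of degree 0, so V is generated as a
    bimodule by the functionals on [J]. *)
Lemma bimodule_map_ext X Y (L L' : T -> X -> Y) :
  bimodule_map L -> bimodule_map L' ->
  (forall al m, dual_J al -> L (ta_in T al) m = L' (ta_in T al) m) ->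
  forall v m, tdeg 1 v -> L v m = L' v m.
Proof.
move=> [l1 l2 l3 l4] [l1' l2' l3' l4'] h.
suff H n u : tdeg n u -> n = 1%N -> forall m, L u m = L' u m.
  by move=> v m hv; apply: (H 1%N).
elim=> {n u} //.
- by move=> al hal _ m; apply: h.
- move=> n p x y hx IHx hy IHy np m.
  have : (n = 0 /\ p = 1) \/ (n = 1 /\ p = 0)%N by lia.
  case=> -[n0 p0]; subst n p; first by rewrite l3 // l3' // IHy.
  by rewrite l4 // l4' // IHx.
- have h0 c : tdeg 1 (c *: (0 : T)) by rewrite scaler0; apply: tdeg_zero.
  have e0 : (0 : T) = -1 *: 0 + 0 by rewrite scaler0 addr0.
  move=> n _ m; rewrite e0 l1 ?l1' ?scaleN1r ?addNr //; exact: tdeg_zero.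
- move=> n c x y hx IHx hy IHy n1 m; subst n.
  by rewrite l1 // l1' // IHx // IHy.
Qed.

Section Chains.
Context X0 X1 X2 (t0 : ad BB X0 X1 (-1)) (t1 : ad BB X1 X2 (-1)).
Hypothesis h0 : in_ad t0.
Hypothesis h1 : in_ad t1.
Context (Phi : T -> chain_smodule X0 X1 X2 X2 -> chain_smodule X0 X1 X2 X2).
Hypothesis hPhi : chain_action (T := T) t0 t1 Phi.

Lemma act01_bimodule : bimodule_map (act01 Phi).
Proof.
have p0 := ob_actionP X0; have p1 := ob_actionP X1; have p2 := ob_actionP X2.
split.
- by move=> c u v m _ _; apply: (act01_linl hPhi).
- by move=> v _; apply: (act01_linr hPhi).
- by move=> a v m ha _; apply: (act01_mull hPhi p0 p1 p2).
- by move=> v a m hv ha; apply: (act01_mulr hPhi p0 p1 p2).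
Qed.

Lemma act12_bimodule : bimodule_map (act12 Phi).
Proof.
have p0 := ob_actionP X0; have p1 := ob_actionP X1; have p2 := ob_actionP X2.
split.
- by move=> c u v m _ _; apply: (act12_linl hPhi).
- by move=> v _; apply: (act12_linr hPhi).
- by move=> a v m ha _; apply: (act12_mull hPhi p0 p1 p2).
- by move=> v a m hv ha; apply: (act12_mulr hPhi p0 p1 p2).
Qed.
End Chains.
End ModuleFunctor.

(** * Cocycles and morphisms of modules *)

Section Morphisms.
Context {k : fieldType} {P : finType} {A : graded_algebra k P}.
Context {b : seq A -> A} {BB : bar_basis A} {rk : P -> nat}.
Hypothesis G : bar_facts b BB rk.
Context (T : tensor_algebra (@gen_space _ _ A) (@dual_l _ _ A) (@dual_r _ _ A)).
Context (W : weak_ditalgebra b T).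
Implicit Types X Y Z : tw_object b BB.
Local Notation oact X := (@ob_action _ _ _ b BB rk G T X).
Local Notation hact := (@hom_act _ _ _ b BB rk G T _ _).
Local Notation MM := (MM G T).

Lemma hom_actE X Y (t : ad BB X Y (-1)) : in_ad t ->
  exists2 Phi, chain_action (T := T) t (fun (_ : idx BB (-1)) (_ : Y) => 0 : Y) Phi
    & hact t = act01 Phi.
Proof.
move=> ht; rewrite /hom_act; case: pselect => // h.
exists (sval (cid (chain_action_exists G T h (@zero_in_ad _ _ _ BB Y Y (-1))))) => //.
exact: svalP (cid (chain_action_exists G T h (@zero_in_ad _ _ _ BB Y Y (-1)))).
Qed.

Lemma hom_act_bimodule X Y (t : ad BB X Y (-1)) : in_ad t ->
  bimodule_map G (T := T) (hact t).
Proof. by move=> ht; have [Phi h ->] := hom_actE ht; exact: (act01_bimodule G h). Qed.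

Lemma hom_act_gen X Y (t : ad BB X Y (-1)) al m : in_ad t -> dual_J al ->
  hact t (ta_in T al) m = Psi t al m.
Proof. by move=> ht hal; have [Phi h ->] := hom_actE ht; rewrite (act01_gen h). Qed.

Section Chain.
Context X0 X1 X2 (t0 : ad BB X0 X1 (-1)) (t1 : ad BB X1 X2 (-1)).
Hypothesis h0 : in_ad t0.
Hypothesis h1 : in_ad t1.
Context (Phi : T -> chain_smodule X0 X1 X2 X2 -> chain_smodule X0 X1 X2 X2).
Hypothesis hPhi : chain_action (T := T) t0 t1 Phi.

Lemma act01_hom v m : tdeg 1 v -> act01 Phi v m = hact t0 v m.
Proof.
apply: (bimodule_map_ext (act01_bimodule G hPhi) (hom_act_bimodule h0)).
by move=> al {}m hal; rewrite hom_act_gen // (act01_gen hPhi).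
Qed.

Lemma act12_hom v m : tdeg 1 v -> act12 Phi v m = hact t1 v m.
Proof.
apply: (bimodule_map_ext (act12_bimodule G hPhi) (hom_act_bimodule h1)).
by move=> al {}m hal; rewrite hom_act_gen // (act12_gen hPhi).
Qed.
End Chain.

Lemma e_sum_sm_e X Y (t : ad BB X Y (-1)) i m : in_ad t ->
  sm_e Y i (e_sum t m) = e_sum t (sm_e X i m).
Proof.
move=> ht; rewrite /e_sum linear_sum (bigD1 i) //= [RHS](bigD1 i) //= !big1 ?addr0.
- have := in_ad_tgt (be BB i) m ht; rewrite (tgt_be G) => ->.
  by have := in_ad_src (be BB i) m ht; rewrite (src_be G) => ->.
- move=> j /eqP ji; apply: (in_ad_src0 _ ht); rewrite (src_be G) //.
- move=> j /eqP ji; have := in_ad_tgt (be BB j) m ht; rewrite (tgt_be G) => <-.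
  by rewrite sm_orth; case: eqP => // /esym.
Qed.

Lemma e_sum_be X Y (t : ad BB X Y (-1)) i m : in_ad t ->
  sm_e Y i (e_sum t m) = t (be BB i) m.
Proof.
move=> ht; rewrite /e_sum linear_sum (bigD1 i) //= !big1 ?addr0.
  by have := in_ad_tgt (be BB i) m ht; rewrite (tgt_be G) => ->.
move=> j /eqP ji; have := in_ad_tgt (be BB j) m ht; rewrite (tgt_be G) => <-.
by rewrite sm_orth; case: eqP => // /esym.
Qed.

Lemma e_sum_linear X Y (t : ad BB X Y (-1)) : in_ad t -> linear (e_sum t).
Proof.
move=> ht c u v; rewrite /e_sum scaler_sumr -big_split; apply: eq_bigr => i _.
exact: (in_ad_linear _ ht).
Qed.

(** The two halves of [b1_tw_split]: the unit part of [t] gives the commutator, the J-part gives the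
    action of [delta]. *)
Lemma delta_gen_defect X Y (t : ad BB X Y (-1)) al m : in_ad t -> dual_deg 0 al ->
  e_sum t (oact X (ta_in T al) m) + hact t (delta W (ta_in T al)) m
    - oact Y (ta_in T al) (e_sum t m)
  = \sum_(z : idx BB 0) dual_coeff z al *: b1_tw t z m.
Proof.
move=> ht hal; have [Phi hPhi ->] := hom_actE ht.
have kal : gen_space al by apply: kept_gen_space; left.
rewrite (act01_delta G ht (@zero_in_ad _ _ _ BB Y Y (-1)) hPhi _ hal (delta_gen W kal)).
rewrite !ob_action_gen // !(Psi_dual G (tw_in _) _ hal).
rewrite (lin_sum (e_sum_linear ht)) -big_split -sumrB; apply: eq_bigr => z _.
by rewrite /= (linZ (e_sum_linear ht)) -scalerDr -scalerBr (b1_tw_split G _ _ ht) addrAC.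
Qed.

Lemma cocycle_mor X Y (t : ad BB X Y (-1)) : tw_cocycle t ->
  forall a m, tdeg 0 a ->
    oact Y a (e_sum t m) = e_sum t (oact X a m) + hact t (delta W a) m.
Proof.
move=> [ht hc]; suff H n a : tdeg n a -> n = 0%N -> forall m,
    oact Y a (e_sum t m) = e_sum t (oact X a m) + hact t (delta W a) m.
  by move=> a m ha; apply: (H 0%N).
have LX := ob_action_linear G T X; have LY := ob_action_linear G T Y.
have El := e_sum_linear ht; have [l1 l2 l3 l4] := hom_act_bimodule ht.
have H0 m : hact t 0 m = 0.
  have -> : (0 : T) = -1 *: 0 + 0 by rewrite scaler0 addr0.
  by rewrite l1 ?scaleN1r ?addNr //; apply: tdeg_zero.
elim=> {n a} //.
- move=> i _ m; rewrite delta_e H0 addr0 !ob_action_e; exact: e_sum_sm_e.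
- move=> al hal _ m; have := delta_gen_defect m ht hal.
  rewrite [RHS]big1 => [|z _]; last by rewrite hc scaler0.
  by move/eqP; rewrite subr_eq0 => /eqP.
- move=> n p x y hx IHx hy IHy np m; have [n0 p0] : n = 0%N /\ p = 0%N by lia.
  subst n p; rewrite (delta_mul W _ hx) expr0 mul1r !(la_mul LX) !(la_mul LY).
  rewrite IHy // (linD (la_linr LY _)) IHx //.
  have dx := delta_deg W hx; have dy := delta_deg W hy.
  have dxy : tdeg 1 (delta W x * y) := tdeg_mul dx hy.
  have xdy : tdeg 1 (x * delta W y) := tdeg_mul hx dy.
  by rewrite -[delta W x * y]scale1r (l1 _ _ _ _ dxy xdy) scale1r l4 // l3 // addrA.
- move=> n _ m; rewrite (lin0 (delta_lin W)) H0 addr0.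
  by rewrite (lin0 (la_linl LY _)) (lin0 (la_linl LX _)) (lin0 El).
- move=> n c x y hx IHx hy IHy n0 m; subst n.
  rewrite (la_linl LY) (la_linl LX) El (delta_lin W) l1; try exact: delta_deg.
  by rewrite IHx // IHy // scalerDr addrACA.
Qed.

Lemma mor_cocycle X Y (t : ad BB X Y (-1)) : in_ad t ->
  (forall al m, dual_deg 0 al ->
     oact Y (ta_in T al) (e_sum t m)
     = e_sum t (oact X (ta_in T al) m) + hact t (delta W (ta_in T al)) m) ->
  tw_cocycle t.
Proof.
move=> ht h; split=> // z m; have hz := dvec_kept0 G z.
have := delta_gen_defect m ht hz; rewrite -h // subrr (bigD1 z) //= big1 ?addr0.
  by rewrite (dual_coeff_dvec G) eqxx scale1r => <-.
by move=> x xz; rewrite (dual_coeff_dvec G) eq_sym (negbTE xz) scale0r.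
Qed.

Definition M_mor X Y (t : ad BB X Y (-1)) : ai_hom (MM X) (MM Y) :=
  (e_sum t, fun v => hact t (val v)).

Lemma M_mor_mor X Y (t : ad BB X Y (-1)) : tw_cocycle t -> ai_mor W (M_mor t).
Proof.
move=> hc; have [ht _] := hc; have [l1 l2 l3 l4] := hom_act_bimodule ht.
have vP (v : Vdelta T) : tdeg 1 (val v) by apply/tpartP; apply: (valP v).
have aP (a : Adelta T) : tdeg 0 (val a) by apply/tpartP; apply: (valP a).
split.
- exact: e_sum_linear.
- by move=> v; apply: l2.
- by move=> m c u v; rewrite -[LHS]/(hact t (c *: val u + val v) m) l1.
- move=> a v a' m; rewrite -[LHS]/(hact t (val a * val v * val a') m) l4 ?l3 //.
  exact: (tdeg_mul (aP a) (vP v)).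
- by move=> a m; apply: cocycle_mor.
Qed.
End Morphisms.

(** * Composition of morphisms *)

Section Composition.
Context {k : fieldType} {P : finType} {A : graded_algebra k P}.
Context {b : seq A -> A} {BB : bar_basis A} {rk : P -> nat}.
Hypothesis G : bar_facts b BB rk.
Context (T : tensor_algebra (@gen_space _ _ A) (@dual_l _ _ A) (@dual_r _ _ A)).
Context (W : weak_ditalgebra b T).
Implicit Types X Y Z : tw_object b BB.
Local Notation oact X := (@ob_action _ _ _ b BB rk G T X).
Local Notation hact := (@hom_act _ _ _ b BB rk G T _ _).
Local Notation MM := (MM G T).
Local Notation M_mor := (@M_mor _ _ _ b BB rk G T _ _).

Lemma tdeg_val (v : Vdelta T) : tdeg 1 (val v).
Proof. by apply/tpartP; apply: (valP v). Qed.

Lemma tdeg_vala (a : Adelta T) : tdeg 0 (val a).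
Proof. by apply/tpartP; apply: (valP a). Qed.

(** A product of degree 2 splits as 0 + 2, 1 + 1 or 2 + 0; in the outer cases the factor of degree 0
    is absorbed by a neighbour. *)
Lemma tdeg2_decomposition (x : T) : tdeg 2 x ->
  exists s : seq (Vdelta T * Vdelta T), x = \sum_(p <- s) val p.1 * val p.2.
Proof.
suff H n y : tdeg n y -> n = 2%N -> exists s : seq (Vdelta T * Vdelta T),
    y = \sum_(p <- s) val p.1 * val p.2 by move=> hx; apply: (H 2%N).
elim=> {n y} //.
- move=> n p x' y hx IHx hy IHy np.
  have : (n = 0 /\ p = 2 \/ n = 1 /\ p = 1 \/ n = 2 /\ p = 0)%N by lia.
  case=> [[n0 p0]|[[n0 p0]|[n0 p0]]]; subst n p.
  + have [s ->] := IHy erefl; have hx' : x' \in @tpart0 _ _ _ T by apply/tpartP.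
    exists [seq (V_l (exist _ x' hx') p.1, p.2) | p <- s].
    rewrite big_map mulr_sumr; apply: eq_bigr => p _; exact: mulrA.
  + have hx' : x' \in @tpart _ _ _ T 1 by apply/tpartP.
    have hy' : y \in @tpart _ _ _ T 1 by apply/tpartP.
    by exists [:: (exist _ x' hx', exist _ y hy')]; rewrite big_seq1.
  + have [s ->] := IHx erefl; have hy' : y \in @tpart0 _ _ _ T by apply/tpartP.
    exists [seq (p.1, V_r p.2 (exist _ y hy')) | p <- s].
    rewrite big_map mulr_suml; apply: eq_bigr => p _; exact: esym (mulrA _ _ _).
- by move=> n _; exists [::]; rewrite big_nil.
- move=> n c x' y hx IHx hy IHy n0; have [s ->] := IHx n0; have [s' ->] := IHy n0.
  exists ([seq (c *: p.1, p.2) | p <- s] ++ s').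
  rewrite big_cat big_map scaler_sumr; congr (_ + _); apply: eq_bigr => p _.
  by rewrite -scalerAl.
Qed.

Lemma decomposition_exists v : exists s, decomposition W v s.
Proof. exact/tdeg2_decomposition/delta_deg/tdeg_val. Qed.

Section Pair.
Context X0 X1 X2 (t0 : ad BB X0 X1 (-1)) (t1 : ad BB X1 X2 (-1)).
Hypothesis c0 : tw_cocycle t0.
Hypothesis c1 : tw_cocycle t1.
Let h0 := proj1 c0.
Let h1 := proj1 c1.
Context (Phi : T -> chain_smodule X0 X1 X2 X2 -> chain_smodule X0 X1 X2 X2).
Hypothesis hPhi : chain_action (T := T) t0 t1 Phi.

Lemma act02_hom u v m : tdeg 1 u -> tdeg 1 v ->
  act02 Phi (u * v) m = hact t1 u (hact t0 v m).
Proof.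
have p0 := ob_actionP G T X0; have p1 := ob_actionP G T X1; have p2 := ob_actionP G T X2.
by move=> hu hv; rewrite (act02_mul hPhi p0 p1 p2) // (act12_hom G h1 hPhi) // (act01_hom G h0 hPhi).
Qed.

Lemma act02_mulr w a m : tdeg 2 w -> tdeg 0 a ->
  act02 Phi (w * a) m = act02 Phi w (oact X0 a m).
Proof.
move=> /tdeg2_decomposition[s ->] ha; rewrite mulr_suml.
rewrite !(lin_sum (act02_linl hPhi _)); apply: eq_bigr => p _.
have [l1 l2 l3 l4] := hom_act_bimodule G T h0.
have hp := tdeg_val p.2; have hpa : tdeg 1 (val p.2 * a) := tdeg_mul hp ha.
by rewrite -mulrA !act02_hom ?l4 //; exact: tdeg_val.
Qed.

(** The formula of [ai_comp1], with the sum over a decomposition replaced by the block from [X0] to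
    [X2] of the action of [delta v]. This form does not refer to a decomposition at all. *)
Definition comp_act (v : T) (m : X0) : X2 :=
  e_sum t1 (hact t0 v m) + hact t1 v (e_sum t0 m) + act02 Phi (delta W v) m.

(** [e_sum t1] and [e_sum t0] commute with elements of degree 0 only up to [delta], by
    [cocycle_mor]; the extra terms of the Leibniz rule compensate for this on either side. *)
Lemma comp_act_bimodule : bimodule_map G (T := T) comp_act.
Proof.
have [l1 l2 l3 l4] := hom_act_bimodule G T h0.
have [g1 g2 g3 g4] := hom_act_bimodule G T h1.
have E0 := e_sum_linear h0; have E1 := e_sum_linear h1.
have LL m := act02_linl hPhi m; have LR w := act02_linr hPhi w.
have L2 := ob_action_linear G T X2.
split.
- move=> c u v m hu hv; rewrite /comp_act l1 // g1 // E1 (delta_lin W) LL.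
  by rewrite !scalerDr (addrACA (c *: _)) (addrACA (_ + _)).
- move=> v hv c x y; rewrite /comp_act l2 // E1 E0 g2 // LR.
  by rewrite !scalerDr (addrACA (c *: _)) (addrACA (_ + _)).
- move=> a v m ha hv; have da := delta_deg W ha; have dv := delta_deg W hv.
  rewrite /comp_act l3 // g3 // (delta_mul W _ ha) expr0 mul1r (linD (LL m)).
  rewrite act02_hom // (act02_mull hPhi (ob_actionP G T X0) (ob_actionP G T X1) (ob_actionP G T X2)) //.
  rewrite !(linD (la_linr L2 _)) (cocycle_mor G W c1) // -!addrA; congr (_ + _).
  by rewrite addrCA.
- move=> v a m hv ha; have da := delta_deg W ha; have dv := delta_deg W hv.
  rewrite /comp_act l4 // g4 // (delta_mul W _ hv) expr1 mulN1r (linD (LL m)).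
  rewrite (linN (LL m)) (act02_hom _ hv da) act02_mulr // (cocycle_mor G W c0) //.
  by rewrite (linD (g2 v hv)) -!addrA; congr (_ + _); congr (_ + _); rewrite addrCA addrN addr0.
Qed.

(** The three terms are those of [b2_tw_split]; a functional on [J] does not see the difference
    between [t1] and its J-part. *)
Lemma comp_act_gen al m : dual_J al -> comp_act (ta_in T al) m = Psi (b2_tw t1 t0) al m.
Proof.
move=> hal; have [hal1 _] := hal.
have kal : gen_space al by apply: kept_gen_space; right.
rewrite /comp_act !hom_act_gen // -(J_sum t1) // -/(Psi (J_part t1) al (e_sum t0 m)).
rewrite (Psi_dual G h0 _ hal1) (Psi_dual G (J_part_in h1) _ hal1).
rewrite (Psi_dual G (b2_tw_in G h0 h1) _ hal1).
rewrite (act02_delta G h0 h1 hPhi _ hal (delta_gen W kal)).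
rewrite (lin_sum (e_sum_linear h1)) -!big_split; apply: eq_bigr => z _ /=.
by rewrite (linZ (e_sum_linear h1)) -!scalerDr (b2_tw_split G _ _ h0 h1).
Qed.

Lemma comp_act_hom v m : tdeg 1 v -> comp_act v m = hact (b2_tw t1 t0) v m.
Proof.
have h := b2_tw_in G h0 h1.
apply: (bimodule_map_ext comp_act_bimodule (hom_act_bimodule G T h)) => al {}m hal.
by rewrite comp_act_gen // hom_act_gen.
Qed.
End Pair.

Lemma e_sum_b2 X0 X1 X2 (t0 : ad BB X0 X1 (-1)) (t1 : ad BB X1 X2 (-1)) m :
  in_ad t0 -> in_ad t1 -> e_sum (b2_tw t1 t0) m = e_sum t1 (e_sum t0 m).
Proof.
move=> h0 h1; rewrite {1}/e_sum [RHS](lin_sum (e_sum_linear h1)).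
apply: eq_bigr => i _; rewrite (b2_tw_split G) // (b2_tw_J_be G) //.
by rewrite /J_part is_be_be !addr0.
Qed.

Lemma M_mor_comp1 X0 X1 X2 (t0 : ad BB X0 X1 (-1)) (t1 : ad BB X1 X2 (-1)) v s :
  tw_cocycle t0 -> tw_cocycle t1 -> decomposition W v s ->
  ai_comp1 (M_mor t1) (M_mor t0) v s = (M_mor (b2_tw t1 t0)).2 v.
Proof.
move=> c0 c1 hs; have [h0 _] := c0; have [h1 _] := c1.
have [Phi hPhi] := chain_action_exists G T h0 h1.
apply: funext => m; rewrite /= -(comp_act_hom c0 c1 hPhi); last exact: tdeg_val.
rewrite /ai_comp1 /comp_act hs; congr (_ + _).
rewrite (lin_sum (act02_linl hPhi m)); apply: eq_bigr => p _.
by rewrite (act02_hom c0 c1 hPhi) //; apply: tdeg_val.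
Qed.

Lemma M_mor_comp X0 X1 X2 (t0 : ad BB X0 X1 (-1)) (t1 : ad BB X1 X2 (-1)) :
  tw_cocycle t0 -> tw_cocycle t1 ->
  ai_comp W (M_mor t1) (M_mor t0) = M_mor (b2_tw t1 t0).
Proof.
move=> c0 c1; congr pair.
  by apply: funext => m; rewrite e_sum_b2 //; [case: c0 | case: c1].
apply: funext => v; apply: M_mor_comp1 => //.
exact: (xgetPex _ (decomposition_exists v)).
Qed.

Lemma M_mor_inj X Y (t t' : ad BB X Y (-1)) : in_ad t -> in_ad t' ->
  M_mor t = M_mor t' -> t = t'.
Proof.
move=> h h' tt'; apply: funext => x; apply: funext => m.
have [/is_beP[i ->]|hx] := boolP (is_be x).
  rewrite -(e_sum_be G) // -(e_sum_be G i m h').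
  by rewrite -[e_sum t]/(M_mor t).1 tt'.
have hJ := dvec_J G hx.
rewrite -(Psi_dvec G h) -(Psi_dvec G h') -!(hom_act_gen G T) //.
by rewrite -[LHS]/((M_mor t).2 (V_gen T hJ) m) tt'.
Qed.

Lemma dvec_l t (x : idx BB t) : dual_l (btgt x) (dvec x) = dvec x.
Proof.
apply: funext => a; rewrite /dual_l /dvec -scalerAl (bf_ee G) eqxx //.
Qed.

Lemma dvec_r t (x : idx BB t) : dual_r (bsrc x) (dvec x) = dvec x.
Proof.
apply: funext => a; rewrite /dual_r /dvec; congr (_ *: _).
rewrite -{2}[a]mulr1 -(bf_e1 G) mulr_sumr bcoord_sum (bigD1 (bsrc x)) //= big1 ?addr0 //.
by move=> j /eqP ji; rewrite (bcoord_mulr G).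
Qed.

Lemma gen_dvec_lr t (x : idx BB t) : gen_space (dvec x) ->
  ta_e T (btgt x) * ta_in T (dvec x) * ta_e T (bsrc x) = ta_in T (dvec x).
Proof.
move=> gx; have [_ _ _ h] := ta_compat T.
have [hl _] := h (btgt x) _ gx; have [_ hr] := h (bsrc x) _ gx.
by rewrite -hl dvec_l -hr dvec_r.
Qed.

Lemma ta_in0 : ta_in T 0 = 0.
Proof.
have [_ _ tl _] := ta_compat T.
have g0 : gen_space (0 : A -> A) by apply: kept_gen_space; left; apply: dual_deg0.
by have := tl (-1) 0 0 g0 g0; rewrite scaler0 addr0 scaleN1r => ->; rewrite addNr.
Qed.

Section Full.
Context X Y (f : ai_hom (MM X) (MM Y)).
Hypothesis hf : ai_mor W f.

Definition mor_act (v : T) (m : X) : Y :=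
  match pselect (v \in @tpart _ _ _ T 1) with
  | left h => f.2 (exist _ v h) m
  | right _ => 0
  end.

Lemma mor_actE (v : Vdelta T) m : mor_act (val v) m = f.2 v m.
Proof.
rewrite /mor_act; case: pselect => [h|]; last by case; apply: valP.
by congr (f.2 _ m); apply: val_inj.
Qed.

Lemma mor_act_bimodule : bimodule_map G (T := T) mor_act.
Proof.
have [f1 f2 f3 f4 f5] := hf.
have inV v : tdeg 1 v -> exists w : Vdelta T, val w = v.
  by move=> hv; have h : v \in @tpart _ _ _ T 1 by [apply/tpartP]; exists (exist _ v h).
have inA a : tdeg 0 a -> exists w : Adelta T, val w = a.
  by move=> hv; have h : a \in @tpart0 _ _ _ T by [apply/tpartP]; exists (exist _ a h).
have V1 (v : Vdelta T) : V_r v 1 = v by apply: val_inj; rewrite /= mulr1.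
have V1l (v : Vdelta T) : V_l 1 v = v by apply: val_inj; rewrite /= mul1r.
split.
- move=> c u v m /inV[u' <-] /inV[v' <-]; rewrite !mor_actE -f3 -mor_actE.
  by congr mor_act; rewrite linearP.
- by move=> v /inV[v' <-] c x y; rewrite !mor_actE f2.
- move=> a v m /inA[a' <-] /inV[v' <-].
  rewrite -[_ * _]/(val (V_l a' v')) !mor_actE -{1}[V_l a' v']V1 f4 act_one //.
- move=> v a m /inV[v' <-] /inA[a' <-].
  rewrite -[_ * _]/(val (V_r v' a')) !mor_actE -{1}[v']V1l f4 act_one //.
Qed.

(** Inverts [Psi] on the dual basis: [f.1] supplies the coefficients at the units, [f.2] all
    others. *)
Definition mor_ad : ad BB X Y (-1) := fun x m =>
  if is_be x then sm_e Y (btgt x) (f.1 m) else mor_act (ta_in T (dvec x)) m.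

(** Since [delta] vanishes on [e_i], the morphism condition at [e_i] says exactly this. *)
Lemma mor_sm_e i m : sm_e Y i (f.1 m) = f.1 (sm_e X i m).
Proof.
have [f1 f2 f3 f4 f5] := hf; have := f5 (A_e T i) m.
rewrite -[aim_act _ _ _]/(oact Y (ta_e T i) (f.1 m)).
rewrite -[aim_act (MM X) _ _]/(oact X (ta_e T i) m) !ob_action_e => ->.
have -> : delta_A W (A_e T i) = 0 by apply: val_inj; rewrite /= delta_e.
by rewrite (lin0 (f3 m)) addr0.
Qed.

Lemma mor_ad_in : in_ad mor_ad.
Proof.
have [f1 f2 f3 f4 f5] := hf; have [l1 l2 l3 l4] := mor_act_bimodule.
move=> x; rewrite /mor_ad; have [/is_beP[i ->]|hx] := boolP (is_be x).
  rewrite (tgt_be G) (src_be G); split=> [c u v|m]; first by rewrite f1 linearP.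
  by rewrite -mor_sm_e sm_e_id sm_e_id.
have hJ := dvec_J G hx; have hg : gen_space (dvec x) by apply: kept_gen_space; right.
have h1 := tdeg_1 T hJ; split; first exact: l2.
move=> m; rewrite -{1}(gen_dvec_lr hg) l4 ?l3 ?ob_action_e //; try exact: tdeg_e.
exact: (tdeg_mul (tdeg_e T _) h1).
Qed.

Lemma M_mor_ad : M_mor mor_ad = f.
Proof.
have [f1 f2 f3 f4 f5] := hf; have hin := mor_ad_in.
have bm := mor_act_bimodule.
rewrite [RHS]surjective_pairing; congr pair.
  apply: funext => m; rewrite [RHS](sm_sum (s := Y)) /e_sum; apply: eq_bigr => i _.
  by rewrite /mor_ad is_be_be (tgt_be G).
apply: funext => v; apply: funext => m; rewrite -mor_actE.
apply: (bimodule_map_ext (hom_act_bimodule G T hin) bm); last exact: tdeg_val.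
move=> al {}m hal; rewrite hom_act_gen //; have [hal1 hal0] := hal.
have [l1 l2 l3 l4] := bm.
rewrite (Psi_dual G hin _ hal1) {2}(dual_expand G (t := -1) hal1).
have H0 : mor_act 0 m = 0.
  have -> : (0 : T) = -1 *: 0 + 0 by rewrite scaler0 addr0.
  by rewrite l1 ?scaleN1r ?addNr //; apply: tdeg_zero.
have [_ _ tl _] := ta_compat T.
set u := LHS; set w := (X in ta_in T X).
(* [ta_in] is additive on [gen_space] only, so membership in [dual_J] is carried along the sum. *)
suff H : u = mor_act (ta_in T w) m /\ dual_J w by case: H.
rewrite /u /w {u w}.
apply: (big_rec2 (fun (u : Y) (v : A -> A) => u = mor_act (ta_in T v) m /\ dual_J v))
  => [|x u w _ [-> hw]].
  by rewrite ta_in0 H0; split=> //; split=> //; apply: dual_deg0.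
have [/is_beP[i xi]|hx] := boolP (is_be x).
  have -> : dual_coeff x al = 0 by rewrite /dual_coeff xi bvec_e hal0 bcoord0.
  by rewrite !scale0r !add0r.
have hJ := dvec_J G hx; split; last exact: dual_J_lin.
rewrite tl; try by apply: kept_gen_space; right.
by rewrite l1 ?(negbTE hx) //; try exact: tdeg_1; rewrite /mor_ad (negbTE hx).
Qed.

Lemma mor_ad_cocycle : tw_cocycle mor_ad.
Proof.
have [f1 f2 f3 f4 f5] := hf.
apply: (mor_cocycle (G := G) (W := W) mor_ad_in) => al m hal.
have -> : e_sum mor_ad = f.1 by rewrite -[LHS]/(M_mor mor_ad).1 M_mor_ad.
have := f5 (A_gen T hal) m.
rewrite -[aim_act (MM X) _ _]/(oact X (ta_in T al) m).
rewrite -[aim_act (MM Y) _ _]/(oact Y (ta_in T al) (f.1 m)) => ->.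
by congr (_ + _); rewrite -{1}M_mor_ad.
Qed.
End Full.
End Composition.

(** * Modules annihilated by I *)

Section AnnihilatedModules.
Context {k : fieldType} {P : finType} {A : graded_algebra k P}.
Context {b : seq A -> A} {BB : bar_basis A} {rk : P -> nat}.
Hypothesis G : bar_facts b BB rk.
Local Notation bv := (@bvec _ _ _ BB _).
Local Notation e := (@ga_e _ _ A).
Context (T : tensor_algebra (@gen_space _ _ A) (@dual_l _ _ A) (@dual_r _ _ A)).
Local Notation E0 := (idx BB 0).
Implicit Types (w : seq E0) (a : seq A).

Fixpoint word_coord w a : k :=
  match w, a with
  | x :: w', a0 :: a' => bcoord x a0 * word_coord w' a'
  | _, _ => 1
  end.

Lemma multilinear_expand a u : (forall x, x \in a -> bdeg 0 x) ->
  b (u ++ a) = \sum_(w <- words (size a)) word_coord w a *: b (u ++ map bv w).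
Proof.
elim: a u => [|a0 a IH] u ha; first by rewrite big_seq1 scale1r.
have ha' x : x \in a -> bdeg 0 x by move=> h; apply: ha; rewrite in_cons h orbT.
have lb : linear (fun z => b (u ++ z :: a)) by move=> c y z; apply: (bf_lin G).
have -> : b (u ++ a0 :: a) = \sum_(x : E0) bcoord x a0 *: b (u ++ bv x :: a).
  rewrite {1}(@bvec_span _ _ _ BB _ _ (ha a0 (mem_head _ _))).
  by rewrite (lin_sum lb); apply: eq_bigr => x _; rewrite (linZ lb).
rewrite [RHS]big_words_S; apply: eq_bigr => x _; rewrite -cat_rcons IH // scaler_sumr.
by apply: eq_bigr => w _; rewrite cat_rcons scalerA.
Qed.

Definition linked (x y : E0) : bool := bsrc x == btgt y.

(** At an unlinked pair, the idempotent at the source of one letter can be moved across the tensor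
    sign, where it kills the next letter. *)
Lemma bar_unlinked u x w : ~~ path linked x w -> b (map bv (u ++ x :: w)) = 0.
Proof.
elim: w u x => [|y w IH] u x //=; rewrite negb_and.
case: (boolP (linked x y)) => [_ /= h|/eqP nxy _]; first by rewrite -cat_rcons IH.
have pairs (v : seq E0) : map bv v = map snd [seq (0 : int, bv z) | z <- v].
  by rewrite -map_comp; apply: eq_map.
have bw (v : seq E0) : bar_word [seq (0 : int, bv z) | z <- v].
  by move=> p /mapP[z _ ->]; exact: (bvec_deg z).
rewrite map_cat /= -[bv x](bvec_r x) !pairs.
rewrite (bf_mid G _ (bvec_deg x) (bvec_deg y) (bw _) (bw _)).
have -> : e (bsrc x) * bv y = 0 *: bv y.
  by rewrite -[in LHS](bvec_l y) mulrA (bf_ee G) (introF eqP nxy) mul0r scale0r.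
have := bf_lin G (map snd [seq (0 : int, bv z) | z <- u] ++ [:: bv x])
          (map snd [seq (0 : int, bv z) | z <- w]) (-1) 0 0.
rewrite scaler0 addr0 scale0r -!catA /= scaleN1r => ->.
by rewrite addNr.
Qed.

Lemma size_linked x w : path linked x w -> (size w < rk (btgt x))%N.
Proof.
elim: w x => [|y w IH] x /=; first by move=> _; apply: leq_ltn_trans (bf_ext G x).
by case/andP => /eqP xy /IH h; apply: leq_ltn_trans (bf_ext G x); rewrite xy.
Qed.

(** The value of the inner pairing lies at the target of [y], which is the source of [x], so it is
    absorbed by the outer functional. *)
Lemma theta_linked x w a : path linked x w -> size a = (size w).+1 ->
  theta (map (@dvec _ _ _ BB 0) (x :: w)) a = word_coord (x :: w) a *: e (btgt x).
Proof.
elim: w x a => [|y w IH] x [|a0 a] //=.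
  by move=> _ _; rewrite /dvec !mulr1.
case/andP=> /eqP xy hw [sa].
case: a sa => [|a1 a] // sa.
rewrite -[dvec y _]/(theta (map (@dvec _ _ _ BB 0) (y :: w)) (a1 :: a)) IH //.
rewrite -xy -scalerAr /dvec bcoordZ -[LHS]scalerA.
rewrite -[bcoord x _ *: _]/(dual_r (bsrc x) (dvec x) a0) (dvec_r G) /dvec scalerA.
by rewrite mulrC.
Qed.

(** Pure tensors are lists without a coefficient, so the scalar goes into the first factor. *)
Definition scale_head (c : k) (s : seq (A -> A)) : seq (A -> A) :=
  if s is f :: s' then (c *: f) :: s' else [::].

Lemma theta_scale_head c s a : s != [::] -> size a = size s ->
  theta (scale_head c s) a = c *: theta s a.
Proof. by case: s => // f s _; case: a. Qed.

Lemma tdeg_sum n (I : eqType) (r : seq I) (F : I -> T) :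
  (forall i, i \in r -> tdeg n (F i)) -> tdeg n (\sum_(i <- r) F i).
Proof.
move=> h; rewrite big_seq; elim/big_rec: _ => [|i x hi hx]; first exact: tdeg_zero.
by rewrite -[F i]scale1r; apply: tdeg_lin => //; apply: h.
Qed.

Lemma tdeg_tword (s : seq (A -> A)) : (forall al, al \in s -> dual_deg 0 al) ->
  tdeg 0 (tword T s).
Proof.
move=> h; rewrite /tword; elim: s h => [|al s IH] h.
  by rewrite big_nil; apply: tdeg_one.
rewrite big_cons; apply: (@tdeg_mul _ _ _ _ 0 0); first by apply/tdeg_0/h/mem_head.
by apply: IH => al' h'; apply: h; rewrite in_cons h' orbT.
Qed.

(* The terms of the expansion of dvec y o b_n along words in the basis of B_0;
   only linked words contribute, and these are bounded by rk. *)
Lemma beta_exists (y : idx BB 1) : exists2 z : T, tdeg 0 z & beta b (T := T) (dvec y) z.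
Proof.
pose coef w := bcoord y (b (map bv w)).
pose ws n := [seq scale_head (coef w) (map (@dvec _ _ _ BB 0) w) | w <- words n].
pose N := (\max_i rk i).+1.
have hdual n s : s \in ws n -> forall al, al \in s -> dual_deg 0 al.
  move=> /mapP[w _ ->] al; case: w => [|x w] //=; rewrite in_cons => /orP[/eqP ->|].
    by have := dual_deg_lin (coef (x :: w)) (dvec_kept0 G x) (dual_deg0 0); rewrite addr0.
  by move=> /mapP[x' _ ->]; exact: (dvec_kept0 G).
exists (\sum_(2 <= n < N) \sum_(s <- ws n) tword T s).
  apply: tdeg_sum => n _; apply: tdeg_sum => s hs; apply: tdeg_tword; exact: hdual hs.
exists ws, N; split=> // n; last first.
  move=> Nn; rewrite /ws big_map big_seq big1 // => w /size_words sw.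
  case: w sw => [|x w] sw; first by rewrite -sw in Nn.
  have -> : coef (x :: w) = 0.
    rewrite /coef -[x :: w]/([::] ++ x :: w) bar_unlinked ?bcoord0 //.
    apply/negP => /size_linked h; have := leq_bigmax (F := rk) (btgt x).
    move: h sw Nn; rewrite /N /=; set R := \max_i _; move: (rk _) => r; lia.
  by rewrite /= scale0r /tword big_cons ta_in0 mul0r.
move=> n1; split.
  move=> s hs; split; last exact: hdual hs.
  by case/mapP: hs => w /size_words sw ->; case: w sw => [|x w] //=; rewrite size_map.
move=> a sa ha; rewrite /ws big_map /dvec -[a in b a]cat0s multilinear_expand // sa.
rewrite bcoord_sum scaler_suml big_seq [RHS]big_seq; apply: eq_bigr => w /size_words sw.
rewrite cat0s bcoordZ -/(coef w).
case: w sw => [|x w] sw; first by rewrite -sw in n1.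
rewrite theta_scale_head ?size_map ?sw //.
have [hp|hp] := boolP (path linked x w); last first.
  have -> : coef (x :: w) = 0 by rewrite /coef -[x :: w]/([::] ++ x :: w) bar_unlinked ?bcoord0.
  by rewrite mulr0 !scale0r.
rewrite theta_linked // ?sa -?sw // scalerA mulrC.
(* The two sides carry idempotents at different targets; unless these agree, the coefficient is
   zero. *)
have [->|/eqP hyx] := eqVneq (btgt x) (btgt y); first by [].
have -> : coef (x :: w) = 0; last by rewrite !mulr0 !scale0r.
have bw : bar_word [seq (0 : int, bv z) | z <- w].
  by move=> p /mapP[z _ ->]; exact: (bvec_deg z).
rewrite /coef /= -[bv x](bvec_l x).
have -> : map bv w = map snd [seq (0 : int, bv z) | z <- w].
  by rewrite -map_comp; apply: eq_map.
by rewrite (bf_left G _ (bvec_deg x) bw) (bcoord_mull G).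
Qed.
End AnnihilatedModules.

Section ModulesAreTwisted.
Context {k : fieldType} {P : finType} {A : graded_algebra k P}.
Context {b : seq A -> A} {BB : bar_basis A} {rk : P -> nat}.
Hypothesis G : bar_facts b BB rk.
Local Notation bv := (@bvec _ _ _ BB _).
Local Notation gco y := (@gcoord _ _ _ b BB _ y).
Context (T : tensor_algebra (@gen_space _ _ A) (@dual_l _ _ A) (@dual_r _ _ A)).

Lemma ta_in_expand al : dual_deg 0 al ->
  ta_in T al = \sum_(x : idx BB 0) dual_coeff x al *: ta_in T (dvec x).
Proof.
move=> hal; have [_ _ tl _] := ta_compat T.
rewrite {1}(dual_expand G (t := 0) hal).
suff H : ta_in T (\sum_(x : idx BB 0) dual_coeff x al *: dvec x)
      = \sum_(x : idx BB 0) dual_coeff x al *: ta_in T (dvec x)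
   /\ dual_deg 0 (\sum_(x : idx BB 0) dual_coeff x al *: dvec x) by case: H.
apply: (big_rec2 (fun (u : A -> A) (v : T) => ta_in T u = v /\ dual_deg 0 u))
  => [|x v u _ [<- hu]]; first by split; [apply: ta_in0 | apply: dual_deg0].
have hx := dvec_kept0 G x; split; last exact: dual_deg_lin.
by rewrite tl //; apply: kept_gen_space; left.
Qed.

Section OneModule.
Context (M : lmodType k) (am : annihilated_module b T M).

Definition mod_e (i : P) (m : M) : M := am (A_e T i) m.

Lemma mod_e_linear i : linear (mod_e i).
Proof. exact: act_lin_r. Qed.

HB.instance Definition _ i :=
  GRing.isLinear.Build k M M *:%R (mod_e i) (mod_e_linear i).

Lemma mod_e_orth i j m : mod_e i (mod_e j m) = if i == j then mod_e i m else 0.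
Proof.
have [h _ _ _] := ta_compat T.
rewrite /mod_e -act_mul; have -> : A_e T i * A_e T j = if i == j then A_e T i else 0.
  by apply: val_inj; rewrite /= h; case: ifP.
by case: ifP => // _; rewrite (lin0 (act_lin_l am m)).
Qed.

Lemma mod_e_sum m : m = \sum_i mod_e i m.
Proof.
have [_ h _ _] := ta_compat T.
rewrite -{1}[m](act_one am) -(lin_sum (act_lin_l am m)); congr (am _ m).
by apply: val_inj; rewrite rmorph1 raddf_sum -h.
Qed.

Definition mod_smodule : smodule k P := SModule mod_e_orth mod_e_sum.

Definition mod_delta : ad BB mod_smodule mod_smodule 0 :=
  fun x m => am (A_gen T (dvec_kept0 G x)) m.

Lemma mod_delta_in : in_ad mod_delta.
Proof.
move=> x; split; first exact: act_lin_r.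
move=> m; rewrite /= /mod_e /mod_delta -!act_mul; congr (am _ m).
apply: val_inj; rewrite /= (gen_dvec_lr G) //.
by apply: kept_gen_space; left; apply: (dvec_kept0 G x).
Qed.

(** Letters of degree 0 raise the rank strictly. Step [r] of the filtration consists of the vectors
    supported at ranks at least [N - r]. *)
Lemma mod_filtration : finite_filtration mod_delta.
Proof.
pose N := (\max_i rk i).+1.
exists N, (fun r => [set m | forall i, (rk i + r < N)%N -> mod_e i m = 0]); split.
- move=> r; split=> [i _|c m m' h h' i hi|i m h j hj]; first exact: linear0.
    by rewrite linearP /= h // h' // scaler0 addr0.
  by rewrite /= mod_e_orth; case: eqP => // _; apply: h.
- apply/seteqP; split=> m /= h; last by move=> i _; rewrite h linear0.
  rewrite (mod_e_sum m) big1 // => i _; apply: h.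
  by rewrite addn0 ltnS; apply: (leq_bigmax (F := rk)).
- by apply/seteqP; split=> // m _ i; rewrite /=; lia.
- by move=> r _ m h i hi; apply: h; move: hi; rewrite /=; lia.
- move=> r x m _ h i hi /=; have hx := mod_delta_in.
  have := in_ad_tgt x m hx; rewrite /= => <-; rewrite mod_e_orth; case: eqP => // it.
  have hs : mod_delta x m = mod_delta x (mod_e (bsrc x) m) := esym (in_ad_src x m hx).
  rewrite hs h ?(lin0 (in_ad_linear x hx)) ?linear0 //.
  by have := bf_ext G x; move: hi; rewrite it /=; lia.
Qed.

Lemma mod_action Phi : action_of (T := T) (single_op mod_delta) Phi ->
  forall a m, Phi (val a) m = am a m.
Proof.
move=> hPhi; have [L he _] := hPhi.
have inA x : tdeg 0 x -> exists w : Adelta T, val w = x.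
  by move=> hv; have h : x \in @tpart0 _ _ _ T by [apply/tpartP]; exists (exist _ x h).
suff H n x : tdeg n x -> n = 0%N -> forall a, val a = x -> forall m, Phi x m = am a m.
  by move=> a m; apply: (H 0%N) => //; apply: tdeg_vala.
elim=> {n x} //.
- move=> i _ a ai m; rewrite he; congr (am _ m); exact: val_inj.
- move=> al hal _ a aal m; rewrite (single_gen _ hPhi) //.
  rewrite (Psi_dual G mod_delta_in _ hal).
  have -> : a = \sum_(x : idx BB 0) dual_coeff x al *: A_gen T (dvec_kept0 G x).
    by apply: val_inj; rewrite aal raddf_sum (ta_in_expand hal); apply: eq_bigr.
  rewrite (lin_sum (act_lin_l am m)); apply: eq_bigr => x _.
  by rewrite (linZ (act_lin_l am m)).
- move=> n p x y hx IHx hy IHy np a axy m.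
  have [n0 p0] : n = 0%N /\ p = 0%N by lia.
  subst n p; have [ax hax] := inA _ hx; have [ay hay] := inA _ hy.
  have -> : a = ax * ay by apply: val_inj; rewrite axy /= hax hay.
  by rewrite (la_mul L) act_mul (IHy _ ay) // (IHx _ ax).
- move=> n _ a a0 m; have -> : a = 0 by apply: val_inj.
  by rewrite (lin0 (la_linl L m)) (lin0 (act_lin_l am m)).
- move=> n c x y hx IHx hy IHy n0 a axy m; subst n.
  have [ax hax] := inA _ hx; have [ay hay] := inA _ hy.
  have -> : a = c *: ax + ay by apply: val_inj; rewrite axy /= hax hay.
  by rewrite (la_linl L) act_lin_l (IHy _ ay) // (IHx _ ax).
Qed.

Lemma mod_mc (y : idx BB 1) m :
  \sum_(s \in [set s : nat | (0 < s)%N])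
    b_ad b (pow_l mod_delta s (AdNil BB mod_smodule)) (t := 1) y m = 0.
Proof.
have hin := mod_delta_in; have ld x := in_ad_linear x hin.
have [K nK] := nilpotent_of_filtration hin mod_filtration.
have [Phi hPhi] := single_action_exists G T hin.
rewrite (mc_geom (K := K)) //.
have [z hz hb] := beta_exists G T y.
have hz' : z \in @tpart0 _ _ _ T by apply/tpartP.
pose a : Adelta T := exist _ z hz'.
have hy : dual_deg (-1) (dvec y) := dvec_dual G y.
have a0 : am a m = 0 by apply: am_I; apply: (@idealI_gen _ _ _ _ _ (dvec y)).
have := action_beta (t := 1) G hin (@zero_in_ad _ _ _ BB mod_smodule mod_smodule (-1))
  hPhi m hy (single_nilpotent hin nK) (fun _ _ => erefl) hb.
rewrite -[z]/(val a) (mod_action hPhi) a0 /dual_sum (bigD1 y) //= big1; last first.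
  by move=> x xy; rewrite (dual_coeff_dvec G) eq_sym (negbTE xy) scale0r.
rewrite (dual_coeff_dvec G) eqxx scale1r addr0 (single_fgeom hin _ nK) => h.
have hS : in_ad (fun (y : idx BB 1) m => fgeom K bv mod_delta (fone m) (gco y) : mod_smodule).
  apply: (in_ad_of_paths G (S := fun m => fgeom K bv mod_delta (fone m))) => [g|i m'].
    by apply: fgeom_linear => // ?; apply: fone_linear.
  apply: (path_fgeom G) => //; apply/formal_in_fone/path_fone/sm_e_id.
exact: etrans (esym (in_ad_tgt y m hS)) (esym h).
Qed.

Definition mod_tw : tw_object b BB := TwObject mod_delta_in mod_filtration mod_mc.

(** Equality of the structures, with proofs identified by irrelevance, gives equality of objects in
    [mod_twE] instead of an isomorphism. *)
Lemma annihilated_module_ext (am1 am2 : annihilated_module b T M) :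
  (forall a m, am1 a m = am2 a m) -> am1 = am2.
Proof.
case: am1 am2 => [[f1 l1 r1 o1 m1] I1] [[f2 l2 r2 o2 m2] I2] /= h.
have ff : f1 = f2 by apply: funext => a; apply: funext => m.
subst f2.
have -> : l1 = l2 by apply: Prop_irrelevance.
have -> : r1 = r2 by apply: Prop_irrelevance.
have -> : o1 = o2 by apply: Prop_irrelevance.
have -> : m1 = m2 by apply: Prop_irrelevance.
by congr AnnihilatedModule; apply: Prop_irrelevance.
Qed.

Lemma mod_twE : MM G T mod_tw = AIModule am.
Proof.
congr AIModule; apply: annihilated_module_ext => a m.
exact: (mod_action (ob_actionP G T mod_tw) a m).
Qed.
End OneModule.

Lemma ai_module_twisted (Q : ai_module b T) : exists X : tw_object b BB, MM G T X = Q.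
Proof. by case: Q => M am; exists (mod_tw am); apply: mod_twE. Qed.
End ModulesAreTwisted.

(** * The equivalence *)

Section Equivalence.
Local Notation hom := Defs.hom.
Local Notation comp := Defs.comp.
Context (C D : precat) (F : prefunctor C D).
Hypothesis hD : is_category D.
Hypothesis heqD : forall (X Y : D) (f g : hom X Y), heq f g -> f = g.
Hypothesis hF : is_functor F.
Hypothesis C_comp : forall (X Y Z : C) (g : hom Y Z) (f : hom X Y),
  mor g -> mor f -> mor (comp g f).
Hypothesis C_id : forall X : C, mor (idm X).
Hypothesis C_hom : forall X Y : C, hom X Y.
Hypothesis full : forall (X Y : C) (g : hom (F X) (F Y)),
  mor g -> exists f : hom X Y, mor f /\ fmap F f = g.
Hypothesis faithful : forall (X Y : C) (f g : hom X Y),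
  mor f -> mor g -> fmap F f = fmap F g -> heq f g.
Hypothesis surjective : forall Z : D, exists X : C, F X = Z.

Let id_l (X Y : D) (f : hom X Y) : mor f -> comp (idm Y) f = f.
Proof. by move=> hf; apply/heqD/comp_id_l. Qed.
Let assoc (X Y Z U : D) (h : hom Z U) (g : hom Y Z) (f : hom X Y) :
  mor h -> mor g -> mor f -> comp h (comp g f) = comp (comp h g) f.
Proof. by move=> *; apply/heqD/comp_assoc. Qed.
Let F_id X : fmap F (idm X) = idm (F X).
Proof. exact/heqD/fmap_id. Qed.
Let F_comp (X Y Z : C) (g : hom Y Z) (f : hom X Y) : mor g -> mor f ->
  fmap F (comp g f) = comp (fmap F g) (fmap F f).
Proof. by move=> *; apply/heqD/fmap_comp. Qed.
Let F_mor := fmap_mor hF.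
Let D_comp := mor_comp hD.
Let D_refl := heq_refl hD.

(** The equality [F X = Z] is repackaged as a pair of inverse morphisms, so that no transport along
    it occurs later. *)
Lemma section_exists (Z : D) :
  {s : {X : C & (hom Z (F X) * hom (F X) Z)%type} |
    [/\ mor (projT2 s).1, mor (projT2 s).2,
        comp (projT2 s).2 (projT2 s).1 = idm Z
      & comp (projT2 s).1 (projT2 s).2 = idm (F (projT1 s))]}.
Proof.
apply: cid; have [X <-] := surjective Z.
have h := mor_id hD (F X).
by exists (existT _ X (idm (F X), idm (F X))); split; rewrite //= id_l.
Qed.

Let sec Z := projT1 (sval (section_exists Z)).
Let u Z : hom Z (F (sec Z)) := (projT2 (sval (section_exists Z))).1.
Let v Z : hom (F (sec Z)) Z := (projT2 (sval (section_exists Z))).2.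
Let u_mor Z : mor (u Z). Proof. by have [] := svalP (section_exists Z). Qed.
Let v_mor Z : mor (v Z). Proof. by have [] := svalP (section_exists Z). Qed.
Let vu Z : comp (v Z) (u Z) = idm Z. Proof. by have [] := svalP (section_exists Z). Qed.
Let uv Z : comp (u Z) (v Z) = idm (F (sec Z)).
Proof. by have [] := svalP (section_exists Z). Qed.

(** A prefunctor is defined on all of [hom]; outside [mor] an arbitrary default is taken. *)
Let lift X Y (g : hom (F X) (F Y)) : hom X Y :=
  match pselect (mor g) with
  | left h => sval (cid (full h))
  | right _ => C_hom X Y
  end.

Let lift_mor X Y (g : hom (F X) (F Y)) : mor g -> mor (lift g).
Proof.
by move=> hg; rewrite /lift; case: pselect => // h; exact: (proj1 (svalP (cid (full h)))).
Qed.

Let F_lift X Y (g : hom (F X) (F Y)) : mor g -> fmap F (lift g) = g.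
Proof.
by move=> hg; rewrite /lift; case: pselect => // h; exact: (proj2 (svalP (cid (full h)))).
Qed.

Lemma full_faithful_equivalence : is_equivalence F.
Proof.
pose conj (Z Z' : D) (g : hom Z Z') := comp (u Z') (comp g (v Z)).
have conj_mor Z Z' (g : hom Z Z') : mor g -> mor (conj _ _ g).
  by move=> hg; apply: D_comp => //; apply: D_comp.
exists (@Prefunctor D C sec (fun Z Z' g => lift (conj _ _ g))); split.
- split=> /=.
  + by move=> Z Z' g hg; apply/lift_mor/conj_mor.
  + move=> Z Z' f g hf hg /heqD <-; apply: faithful => //; exact/lift_mor/conj_mor.
  + move=> Z; have hi := conj_mor _ _ _ (mor_id hD Z).
    apply: faithful; [exact: lift_mor | exact: C_id|].
    by rewrite F_lift // F_id /conj id_l ?uv.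
  + move=> X Y Z g f hg hf; have hgf := D_comp hg hf.
    have cf := conj_mor _ _ _ hf; have cg := conj_mor _ _ _ hg.
    have cgf := conj_mor _ _ _ hgf.
    apply: faithful; [exact: lift_mor | by apply: C_comp; apply: lift_mor|].
    rewrite F_comp; try exact: lift_mor.
    have gv := D_comp hg (v_mor Y); have fv := D_comp hf (v_mor X).
    rewrite !F_lift // -(assoc (u_mor Z) gv cf) -(assoc hg (v_mor Y) cf).
    by rewrite /conj -(assoc hg hf (v_mor X)) (assoc (v_mor Y) (u_mor Y) fv) vu id_l.
- exists (fun X => lift (v (F X))), (fun X => lift (u (F X))); split=> /=.
  + by move=> X; split; apply: lift_mor.
  + move=> X; apply: faithful; [by apply: C_comp; apply: lift_mor | exact: C_id|].
    by rewrite F_comp ?F_lift ?uv ?F_id //; apply: lift_mor.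
  + move=> X; apply: faithful; [by apply: C_comp; apply: lift_mor | exact: C_id|].
    by rewrite F_comp ?F_lift ?vu ?F_id //; apply: lift_mor.
  + move=> X Y f hf; have Ff := F_mor hf; have cf := conj_mor _ _ _ Ff.
    have Fv := D_comp Ff (v_mor (F X)).
    apply: faithful; try by apply: C_comp => //; apply: lift_mor.
    rewrite !F_comp //; try exact: lift_mor.
    by rewrite !F_lift // /conj (assoc (v_mor (F Y)) (u_mor (F Y)) Fv) vu id_l.
- exists v, u; split=> /= [Z|Z|Z|X Y f hf].
  + by split.
  + by rewrite uv; apply/D_refl/mor_id.
  + by rewrite vu; apply/D_refl/mor_id.
  + have fv := D_comp hf (v_mor X).
    rewrite F_lift; last exact: conj_mor.
    by rewrite /conj (assoc (v_mor Y) (u_mor Y) fv) vu id_l //; apply: D_refl.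
Qed.
End Equivalence.

(** * The three categories and the functor *)

Section Categories.
Context {k : fieldType} {P : finType} {A : graded_algebra k P}.
Context {b : seq A -> A} {BB : bar_basis A} {rk : P -> nat}.
Hypothesis G : bar_facts b BB rk.
Local Notation e := (@ga_e _ _ A).
Context (T : tensor_algebra (@gen_space _ _ A) (@dual_l _ _ A) (@dual_r _ _ A)).
Context (W : weak_ditalgebra b T).
Implicit Types X Y Z : tw_object b BB.
Local Notation hact := (@hom_act _ _ _ b BB rk G T _ _).
Local Notation MM := (MM G T).
Local Notation M_mor := (@M_mor _ _ _ b BB rk G T _ _).
Local Notation AI := (AI_Mod W).
Local Notation Zm1 := (Zm1_tw b BB).
Local Notation Hm1 := (Hm1_tw b BB).

Lemma ad_low X Y n (t : ad BB X Y n) : n < -1 -> t = 0.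
Proof. by move=> hn; apply: funext => x; case: (bf_low G hn x). Qed.

Lemma expand_pow_nil (X Y : smodule k P) (d : ad BB Y Y 0) n (c : adtensor BB X Y) :
  expand c = [::] -> expand (pow_l d n c) = [::].
Proof.
move=> hc; elim: n => //= n ->.
by elim: (enum _) => //= x s ->.
Qed.

(** There is no basis element of degree -2, so the tensor expands to an empty sum. *)
Lemma b1_tw_low X Y (h : ad BB X Y (-2)) y m : b1_tw h y m = 0.
Proof.
rewrite /b1_tw fsbig1 // => i _; rewrite /b_ad expand_pow_nil ?big_nil //.
by rewrite /=; case: (enum _) => // x s; case: (bf_low G _ x).
Qed.

Lemma cohomologousE X Y (t t' : ad BB X Y (-1)) : tw_cohomologous t t' <-> t = t'.
Proof.
split=> [[h _ tt']|->].
  apply: funext => y; apply: funext => m; apply/eqP; rewrite -subr_eq0 tt'.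
  by rewrite b1_tw_low.
exists (fun _ _ => 0); first exact: zero_in_ad.
by move=> y m; rewrite subrr b1_tw_low.
Qed.

Lemma tw_id_in X : in_ad (@tw_id _ _ _ b BB X).
Proof.
move=> x; rewrite /tw_id; split=> [c u v|m].
  by rewrite scaler_sumr -big_split; apply: eq_bigr => i _; rewrite linearP.
rewrite linear_sum; apply: eq_bigr => i /eqP ->.
by rewrite (tgt_be G) (src_be G) !sm_e_id.
Qed.

Lemma tw_id_be X i (m : X) : @tw_id _ _ _ b BB X (be BB i) m = sm_e X i m.
Proof.
rewrite /tw_id (eq_bigl (fun j => j == i)) ?big_pred1_eq // => j.
by rewrite eq_sym; apply/eqP/eqP => [/(be_injective G)|->].
Qed.

Lemma M_mor_id X : M_mor (@tw_id _ _ _ b BB X) = (id, fun _ _ => 0).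
Proof.
have hi := tw_id_in X; congr pair.
  apply: funext => m; rewrite /e_sum [RHS](sm_sum (s := X)).
  by apply: eq_bigr => i _; apply: tw_id_be.
apply: funext => v; apply: funext => m.
have b0 : bimodule_map G (T := T) (fun _ (_ : X) => 0 : X).
  split=> // [c u v' m' _ _|v' _ c u u'|a v' m' _ _]; try by rewrite scaler0 addr0.
  by rewrite (lin0 (la_linr (ob_action_linear G T X) a)).
apply: (bimodule_map_ext (hom_act_bimodule G T hi) b0); last exact: tdeg_val.
move=> al {}m hal; rewrite hom_act_gen // /Psi big1 // => x _.
have [/is_beP[i ->]|hx] := boolP (is_be x).
  by rewrite bvec_e (proj2 hal) s_act0.
rewrite /tw_id big1 ?(lin0 (s_act_linear _)) // => i /eqP xi.
by move: hx; rewrite xi is_be_be.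
Qed.

(** Read off on modules, where [tw_id] becomes the identity and the morphism condition is
    trivial. *)
Lemma tw_id_cocycle X : tw_cocycle (@tw_id _ _ _ b BB X).
Proof.
apply: (mor_cocycle (G := G) (W := W) (tw_id_in X)) => al m hal.
have -> : e_sum (@tw_id _ _ _ b BB X) = id.
  by rewrite -[LHS]/(M_mor (@tw_id _ _ _ b BB X)).1 M_mor_id.
have h0 : (M_mor (@tw_id _ _ _ b BB X)).2 = fun _ _ => 0 by rewrite M_mor_id.
have hd : delta W (ta_in T al) \in @tpart _ _ _ T 1 by apply/tpartP/delta_deg/tdeg_0.
pose w : Vdelta T := exist _ (delta W (ta_in T al)) hd.
by rewrite -[hact _ _ _]/((M_mor (@tw_id _ _ _ b BB X)).2 w m) h0 addr0.
Qed.

Lemma ai_comp_idl (M N : ai_module b T) (f : ai_hom M N) :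
  ai_comp W (idm (p := AI) N) f = f.
Proof.
rewrite [RHS]surjective_pairing; congr pair.
apply: funext => v; apply: funext => m.
by rewrite /ai_comp1 /= big1 ?addr0.
Qed.

Lemma ai_comp_idr (M N : ai_module b T) (f : ai_hom M N) : ai_mor W f ->
  ai_comp W f (idm (p := AI) M) = f.
Proof.
move=> [f1 f2 f3 _ _]; rewrite [RHS]surjective_pairing; congr pair.
apply: funext => v; apply: funext => m.
rewrite /ai_comp1 /= (lin0 f1) add0r big1 ?addr0 // => p _.
exact: (lin0 (f2 _)).
Qed.

(** [M_mor] is injective and multiplicative, so the unit law is inherited from modules. *)
Lemma b2_tw_idl X Y (f : ad BB X Y (-1)) : tw_cocycle f -> b2_tw (@tw_id _ _ _ b BB Y) f = f.
Proof.
move=> hf; have hi := tw_id_cocycle Y; have [fin _] := hf; have [iin _] := hi.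
apply: (M_mor_inj (G := G) (T := T) (b2_tw_in G fin iin) fin).
by rewrite -(M_mor_comp G W hf hi) M_mor_id ai_comp_idl.
Qed.

Lemma b2_tw_idr X Y (f : ad BB X Y (-1)) : tw_cocycle f -> b2_tw f (@tw_id _ _ _ b BB X) = f.
Proof.
move=> hf; have hi := tw_id_cocycle X; have [fin _] := hf; have [iin _] := hi.
apply: (M_mor_inj (G := G) (T := T) (b2_tw_in G iin fin) fin).
by rewrite -(M_mor_comp G W hi hf) M_mor_id ai_comp_idr //; apply: M_mor_mor.
Qed.

Lemma Zm1_category : is_category Zm1.
Proof.
split=> //=; try by move=> *; congruence.
- exact: tw_id_cocycle.
- by move=> X Y Z g f hg hf; apply: (b2_tw_cocycle G).
- by move=> X Y f; apply: b2_tw_idl.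
- by move=> X Y f; apply: b2_tw_idr.
- by move=> X Y Z U h g f hh hg hf; apply: (b2_tw_assoc G).
Qed.

Lemma Hm1_category : is_category Hm1.
Proof.
have Z := Zm1_category; split=> /=.
- by move=> *; apply/cohomologousE.
- by move=> X Y f g _ _ /cohomologousE ->; apply/cohomologousE.
- by move=> X Y f g h _ _ _ /cohomologousE -> /cohomologousE ->; apply/cohomologousE.
- exact: (mor_id Z).
- exact: (mor_comp Z).
- by move=> X Y U g g' f f' _ _ _ _ /cohomologousE -> /cohomologousE ->; apply/cohomologousE.
- by move=> X Y f hf; apply/cohomologousE/(comp_id_l Z).
- by move=> X Y f hf; apply/cohomologousE/(comp_id_r Z).
- by move=> X Y U V h g f hh hg hf; apply/cohomologousE/(comp_assoc Z).
Qed.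

Lemma ai_mor_tw X Y (f : ai_hom (MM X) (MM Y)) : ai_mor W f ->
  exists t : ad BB X Y (-1), tw_cocycle t /\ M_mor t = f.
Proof.
by move=> hf; exists (mor_ad f); split; [apply: (mor_ad_cocycle (W := W)) | apply: (M_mor_ad (W := W))].
Qed.

(** Objects and morphisms come from [tw(B)], where every decomposition yields the image of the same
    product [b2_tw]. *)
Lemma ai_comp1_decomposition (M N Q : ai_module b T) (g : ai_hom N Q) (f : ai_hom M N) v s :
  ai_mor W g -> ai_mor W f -> decomposition W v s ->
  (ai_comp W g f).2 v = ai_comp1 g f v s.
Proof.
have [X0 e0] := ai_module_twisted G M; have [X1 e1] := ai_module_twisted G N.
have [X2 e2] := ai_module_twisted G Q; subst M N Q.
move=> /ai_mor_tw[t1 [c1 <-]] /ai_mor_tw[t0 [c0 <-]] hs.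
by rewrite (M_mor_comp G W c0 c1) (M_mor_comp1 G c0 c1 hs).
Qed.

Lemma AI_category : is_category AI.
Proof.
have Z := Zm1_category; split=> //=; try by move=> *; congruence.
- move=> M; have [X <-] := ai_module_twisted G M.
  by have := M_mor_mor G W (tw_id_cocycle X); rewrite M_mor_id.
- move=> M N Q; have [X0 e0] := ai_module_twisted G M.
  have [X1 e1] := ai_module_twisted G N; have [X2 e2] := ai_module_twisted G Q.
  subst M N Q => g f /ai_mor_tw[t1 [c1 <-]] /ai_mor_tw[t0 [c0 <-]].
  rewrite (M_mor_comp G W c0 c1); apply: M_mor_mor; exact: (b2_tw_cocycle G).
- by move=> M N f _; apply: ai_comp_idl.
- by move=> M N f hf; apply: ai_comp_idr.
- move=> M N Q U; have [X0 e0] := ai_module_twisted G M.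
  have [X1 e1] := ai_module_twisted G N; have [X2 e2] := ai_module_twisted G Q.
  have [X3 e3] := ai_module_twisted G U; subst M N Q U => h g f.
  move=> /ai_mor_tw[t2 [c2 <-]] /ai_mor_tw[t1 [c1 <-]] /ai_mor_tw[t0 [c0 <-]].
  have c10 := b2_tw_cocycle G c1 c0; have c21 := b2_tw_cocycle G c2 c1.
  rewrite (M_mor_comp G W c0 c1) (M_mor_comp G W c1 c2) (M_mor_comp G W c10 c2).
  by rewrite (M_mor_comp G W c0 c21) (b2_tw_assoc G).
Qed.

(** The functor of the theorem is written with [Psi] and the [es]; it is known to agree with [M_mor]
    on elements of [ad] only, which is all that is assumed of [F]. *)
Section TheFunctor.
Context (F : forall X Y, ad BB X Y (-1) -> ai_hom (MM X) (MM Y)).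
Hypothesis F_eq : forall X Y (t : ad BB X Y (-1)), in_ad t -> F t = M_mor t.

Let FZ : prefunctor Zm1 AI := @Prefunctor Zm1 AI MM F.
Let FH : prefunctor Hm1 AI := @Prefunctor Hm1 AI MM F.

Lemma FZ_functor : is_functor FZ.
Proof.
have Z := Zm1_category; split=> /=.
- by move=> X Y f hf; rewrite F_eq; [apply: M_mor_mor | case: hf].
- by move=> X Y f g _ _ ->.
- by move=> X; rewrite F_eq ?M_mor_id //; apply: tw_id_in.
- move=> X Y U g f hg hf; have hgf := b2_tw_cocycle G hg hf.
  by rewrite !F_eq ?(M_mor_comp G W hf hg) //; [case: hf | case: hg | case: hgf].
Qed.

Lemma FH_functor : is_functor FH.
Proof.
have [h1 h2 h3 h4] := FZ_functor; split.
- exact: h1.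
- by move=> X Y f g _ _ /cohomologousE ->.
- exact: h3.
- exact: h4.
Qed.

Lemma F_full X Y (g : ai_hom (MM X) (MM Y)) : ai_mor W g ->
  exists f : ad BB X Y (-1), tw_cocycle f /\ F f = g.
Proof.
by move=> /ai_mor_tw[t [ct <-]]; exists t; split=> //; apply: F_eq; case: ct.
Qed.

Lemma F_faithful X Y (f g : ad BB X Y (-1)) : tw_cocycle f -> tw_cocycle g ->
  F f = F g -> f = g.
Proof. by move=> [hf _] [hg _]; rewrite !F_eq //; apply: M_mor_inj. Qed.

Lemma FZ_equivalence : is_equivalence FZ.
Proof.
have Z := Zm1_category.
apply: (full_faithful_equivalence AI_category _ FZ_functor (mor_comp Z) (mor_id Z)) => //.
- by move=> X Y _ _; exact: 0.
- by move=> X Y g; apply: F_full.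
- by move=> X Y f g; apply: F_faithful.
- exact: ai_module_twisted.
Qed.

Lemma FH_equivalence : is_equivalence FH.
Proof.
have Z := Hm1_category.
apply: (full_faithful_equivalence AI_category _ FH_functor (mor_comp Z) (mor_id Z)) => //.
- by move=> X Y _ _; exact: 0.
- by move=> X Y g; apply: F_full.
- by move=> X Y f g hf hg h; apply/cohomologousE/F_faithful.
- exact: ai_module_twisted.
Qed.
End TheFunctor.

Lemma Psi_unit X Y (t : ad BB X Y (-1)) (es : P -> A -> A) :
  (forall j, is_estar j (es j)) -> in_ad t ->
  Psi t (fun a => \sum_j es j a) = e_sum t.
Proof.
move=> hes ht; apply: funext => m; rewrite /Psi /e_sum.
rewrite -(sum_is_be G (fun x => t x m)); apply: eq_bigr => x _.
case: ifP => [/is_beP[i ->]|hx]; last first.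
  rewrite big1 ?s_act0 // => j _; have [_ _ h] := hes j; apply: h.
  by apply: bvec_J => i xi; move: hx; rewrite xi is_be_be.
rewrite (_ : \sum_j _ = e i) ?(s_act_e G); first last.
  rewrite (bigD1 i) //= big1 ?addr0 => [|j /negbTE ji].
    by have [_ he _] := hes i; rewrite bvec_e he eqxx.
  by have [_ he _] := hes j; rewrite bvec_e he ji.
by have := in_ad_tgt (be BB i) m ht; rewrite (tgt_be G).
Qed.
End Categories.

Section Rank.
Context {disp : Order.disp_t} {P : finPreorderType disp}.
Implicit Types i j : P.

(** The size of the down-set: it is monotone, and strictly so when [i <= j] without [i ~ j], which
    is the situation of [hs_ext]. *)
Definition rank i : nat := #|[pred j | (j <= i)%O]|.

Lemma rank_le i j : (i <= j)%O -> (rank i <= rank j)%N.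
Proof.
move=> ij; apply/subset_leq_card/fintype.subsetP => l; rewrite !inE => li.
exact: le_trans ij.
Qed.

Lemma rank_lt i j : (i <= j)%O -> ~ (j <= i)%O -> (rank i < rank j)%N.
Proof.
move=> ij ji; apply/proper_card/fintype.properP; split.
  by apply/fintype.subsetP => l; rewrite !inE => li; apply: le_trans ij.
by exists j; rewrite !inE ?lexx //; apply/negP.
Qed.
End Rank.

Lemma yoneda_bar_facts (k : fieldType) (L : falgType k) (disp : Order.disp_t)
    (P : finPreorderType disp) (D : P -> lmodType L) (hD : homological_system D)
    (Delta : direct_sum D) (R : projective_resolution Delta) (Y : yoneda_algebra R)
    (m b : seq (yoneda_graded Y) -> yoneda_graded Y) (BB : bar_basis (yoneda_graded Y)) :
  strict_Ainfinity m -> is_bar m b -> bar_facts b BB (@rank disp P).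
Proof.
move=> hm hb; apply: (bar_facts_of_Ainfinity hm hb).
- exact: yoneda_deg0.
- exact: yoneda_deg_lin.
- exact: yoneda_ee.
- exact: yoneda_sum_e.
- exact: yoneda_deg_neg.
- exact: yoneda_span.
- by move=> a s t da ta as0 a0; apply/rank_le/(yoneda_hom_directed hD da ta as0 a0).
- move=> a s t da ta as0 a0; have [st h] := yoneda_ext_directed hD da ta as0 a0.
  by apply: rank_lt => // ts; apply: h.
Qed.

Theorem theorem8p3 (k : closedFieldType) (L : falgType k)
    (disp : Order.disp_t) (P : finPreorderType disp) (D : P -> lmodType L)
    (hD : homological_system D) (hadm : admissible D)
    (Delta : direct_sum D) (R : projective_resolution Delta)
    (Y : yoneda_algebra R)
    (m : seq (yoneda_graded Y) -> yoneda_graded Y) (hm : strict_Ainfinity m)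
    (b : seq (yoneda_graded Y) -> yoneda_graded Y) (hb : is_bar m b)
    (BB : bar_basis (yoneda_graded Y))
    (T : tensor_algebra (@gen_space _ _ (yoneda_graded Y)) (@dual_l _ _ _)
           (@dual_r _ _ _))
    (W : weak_ditalgebra b T)
    (es : P -> yoneda_graded Y -> yoneda_graded Y)
    (hes : forall j, is_estar j (es j)) :
  is_category (Hm1_tw b BB) /\
  is_category (Zm1_tw b BB) /\
  is_category (AI_Mod W) /\
  (forall (M N Q : ai_module b T) (g : ai_hom N Q) (f : ai_hom M N),
     ai_mor W g -> ai_mor W f -> forall v,
     (exists s, decomposition W v s) /\
     (forall s, decomposition W v s -> (ai_comp W g f).2 v = ai_comp1 g f v s)) /\
  equivalent (Hm1_tw b BB) (AI_Mod W) /\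
  (forall (X1 X2 : tw_object b BB) (n : int) (t : ad BB X1 X2 n),
     n < -1 -> in_ad t -> t = 0) /\
  (forall (X1 X2 : tw_object b BB) (t t' : ad BB X1 X2 (-1)),
     tw_cocycle t -> tw_cocycle t' -> (tw_cohomologous t t' <-> t = t')) /\
  exists (M_ob : forall X : tw_object b BB, annihilated_module b T X)
         (M_1 : forall X1 X2 : tw_object b BB,
            ad BB X1 X2 (-1) -> Vdelta T -> X1 -> X2),
    let M : prefunctor (Zm1_tw b BB) (AI_Mod W) :=
      @Prefunctor (Zm1_tw b BB) (AI_Mod W) (fun X => AIModule (M_ob X))
        (fun X1 X2 t => (Psi t (fun a => \sum_j es j a), M_1 X1 X2 t)) in
    [/\ forall (X : tw_object b BB) i x, M_ob X (A_e T i) x = sm_e X i x,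
        forall (X : tw_object b BB) zeta (h : dual_deg 0 zeta) x,
          M_ob X (A_gen T h) x = Psi (tw_delta X) zeta x,
        forall (X1 X2 : tw_object b BB) (t : ad BB X1 X2 (-1)) xi (h : dual_J xi) x,
          tw_cocycle t -> M_1 X1 X2 t (V_gen T h) x = Psi t xi x,
        is_functor M
      & is_equivalence M].
Proof.
have G := yoneda_bar_facts hD BB hm hb.
have Fe (X1 X2 : tw_object b BB) (t : ad BB X1 X2 (-1)) : in_ad t ->
    (Psi t (fun a => \sum_j es j a), fun v : Vdelta T => hom_act G t (val v))
    = M_mor G T t.
  by move=> ht; rewrite (Psi_unit G hes ht).
split; first exact: (Hm1_category G W).
split; first exact: (Zm1_category G W).
split; first exact: (AI_category G W).
split.
  move=> M N Q g f hg hf v; split; first exact: decomposition_exists.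
  by move=> s; apply: (ai_comp1_decomposition G hg hf).
split.
  exists (@Prefunctor (Hm1_tw b BB) (AI_Mod W) (MM G T) (fun X1 X2 t => M_mor G T t)).
  by split; [apply: FH_functor | apply: FH_equivalence].
split; first by move=> X1 X2 n t hn _; apply: (ad_low G).
split; first by move=> X1 X2 t t' _ _; apply: (cohomologousE G).
exists (M_ob G T), (fun X1 X2 t v => hom_act G t (val v)) => M; split.
- by move=> X i x; apply: ob_action_e.
- by move=> X zeta h x; apply: ob_action_gen.
- by move=> X1 X2 t xi h x [ht _]; apply: hom_act_gen.
- exact: (FZ_functor W Fe).
- exact: (FZ_equivalence W Fe).
Qed.
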